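(* The following decision problem, Helly-$B_1$ EPG recognition, is NP-complete: given a graph $G$, decide whether $G$ admits a Helly $B_1$-EPG representation.
   Context: A grid is the set of integer points of the plane; a grid edge joins two grid points at Euclidean distance $1$, and is horizontal or vertical. A path in the grid is a sequence of distinct grid edges in which consecutive edges share exactly one grid point and non-consecutive edges share none. A bend of a path is a pair of consecutive edges of the path having different directions. Two paths (edge-)intersect if they have a common grid edge. An EPG representation of a graph $G$ is a family $(P_v)_{v\in V(G)}$ of grid paths such that distinct vertices $u,v$ are adjacent in $G$ if and only if $P_u$ and $P_v$ share at least one grid edge. It is a $B_k$-EPG representation if every path has at most $k$ bends. An EPG representation is Helly if every subfamily of pairwise edge-intersecting paths has a grid edge common to all paths of the subfamily. *)

(* Defs.v *)
From mathcomp Require Import all_boot all_order all_algebra.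
Set Implicit Arguments. Unset Strict Implicit. Unset Printing Implicit Defensive.
Import GRing.Theory.

Definition gpoint := (int * int)%type.
(* a grid edge (a,b,true) joins (a,b) and (a+1,b) (horizontal);
   (a,b,false) joins (a,b) and (a,b+1) (vertical).  Every grid edge has
   exactly one such representation. *)
Definition gedge := (int * int * bool)%type.

Definition gedge_horizontal (e : gedge) : bool := e.2.

Definition gedge_ends (e : gedge) : seq gpoint :=
  let: (a, b, h) := e in
  [:: (a, b); if h then ((a + 1)%R, b) else (a, (b + 1)%R)].

Definition shared_pts (e f : gedge) : nat :=
  count (fun p => p \in gedge_ends f) (gedge_ends e).

Definition is_grid_path (s : seq gedge) : Prop :=
  [/\ 0 < size s, uniq s &
      forall i j, i < j -> j < size s ->
        shared_pts (nth (0%R, 0%R, true) s i) (nth (0%R, 0%R, true) s j)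
        = (if j == i.+1 then 1 else 0)].

Definition bends (s : seq gedge) : nat :=
  count (fun ef : gedge * gedge =>
           gedge_horizontal ef.1 != gedge_horizontal ef.2)
        (zip s (behead s)).

Definition edge_intersect (P Q : seq gedge) : bool := has (fun e => e \in Q) P.

Definition simple_graph n (adj : rel 'I_n) : Prop :=
  symmetric adj /\ irreflexive adj.

Definition EPG_rep n (adj : rel 'I_n) (P : 'I_n -> seq gedge) : Prop :=
  (forall v, is_grid_path (P v)) /\
  (forall u v, u != v -> (adj u v <-> edge_intersect (P u) (P v))).

Definition Bk_EPG_rep (k : nat) n (adj : rel 'I_n) (P : 'I_n -> seq gedge) :=
  EPG_rep adj P /\ forall v, bends (P v) <= k.

Definition Helly_rep n (P : 'I_n -> seq gedge) : Prop :=
  forall S : {set 'I_n},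
    (forall u v, u \in S -> v \in S -> edge_intersect (P u) (P v)) ->
    exists g : gedge, forall u, u \in S -> g \in P u.

Definition has_Helly_B1_EPG n (adj : rel 'I_n) : Prop :=
  exists P : 'I_n -> seq gedge, Bk_EPG_rep 1 adj P /\ Helly_rep P.

Inductive move := MoveL | MoveR | Stay.

Unset Implicit Arguments.
Record TM := {
  tm_state : finType;
  tm_sym : finType;
  tm_blank : tm_sym;
  tm_in : bool -> tm_sym;
  tm_out : tm_sym -> option bool;
  tm_start : tm_state;
  tm_halt : pred tm_state;
  tm_accept : pred tm_state;
  tm_delta : tm_state -> tm_sym -> tm_state * tm_sym * move
}.
Set Implicit Arguments.

(* configuration: state, left part of tape (nearest cell first), scanned
   symbol, right part of tape; the tape is blank outside. *)
Definition config (M : TM) :=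
  (tm_state M * seq (tm_sym M) * tm_sym M * seq (tm_sym M))%type.

Definition tm_step (M : TM) (c : config M) : config M :=
  let: (q, l, a, r) := c in
  if tm_halt M q then c else
  let: (q', b, m) := tm_delta M q a in
  match m with
  | Stay => (q', l, b, r)
  | MoveL => match l with
             | [::] => (q', [::], tm_blank M, b :: r)
             | c0 :: l' => (q', l', c0, b :: r)
             end
  | MoveR => match r with
             | [::] => (q', b :: l, tm_blank M, [::])
             | c0 :: r' => (q', b :: l, c0, r')
             end
  end.

Definition tm_init (M : TM) (x : seq bool) : config M :=
  match x with
  | [::] => (tm_start M, [::], tm_blank M, [::])
  | y :: ys => (tm_start M, [::], tm_in M y, map (tm_in M) ys)
  end.

Definition tm_run (M : TM) (t : nat) (x : seq bool) : config M :=
  iter t (@tm_step M) (tm_init M x).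

Definition cfg_state (M : TM) (c : config M) : tm_state M :=
  let: (q, _, _, _) := c in q.

Fixpoint decode_out (M : TM) (s : seq (tm_sym M)) : seq bool :=
  match s with
  | [::] => [::]
  | a :: s' => match tm_out M a with
               | Some b => b :: @decode_out M s'
               | None => [::]
               end
  end.

Definition cfg_output (M : TM) (c : config M) : seq bool :=
  let: (_, _, a, r) := c in @decode_out M (a :: r).

Definition language := seq bool -> Prop.

Definition poly_bound (k n : nat) : nat := n ^ k + k.

Definition in_P (L : language) : Prop :=
  exists (M : TM) (k : nat), forall x : seq bool,
    let c := tm_run M (poly_bound k (size x)) x in
    tm_halt M (cfg_state c) /\ (tm_accept M (cfg_state c) <-> L x).

Definition poly_computable (f : seq bool -> seq bool) : Prop :=
  exists (M : TM) (k : nat), forall x : seq bool,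
    let c := tm_run M (poly_bound k (size x)) x in
    tm_halt M (cfg_state c) /\ cfg_output c = f x.

Definition pair_str (x y : seq bool) : seq bool :=
  flatten [seq [:: true; b] | b <- x] ++ false :: y.

Definition in_NP (L : language) : Prop :=
  exists (V : language) (k : nat), in_P V /\
    forall x, L x <-> exists w, size w <= poly_bound k (size x) /\ V (pair_str x w).

Definition karp_reducible (L1 L2 : language) : Prop :=
  exists f, poly_computable f /\ forall x, L1 x <-> L2 (f x).

Definition NP_hard (L : language) : Prop :=
  forall L', in_NP L' -> karp_reducible L' L.

Definition NP_complete (L : language) : Prop := in_NP L /\ NP_hard L.

Definition graph_enc n (adj : rel 'I_n) : seq bool :=
  [seq adj i j | i <- enum 'I_n, j <- enum 'I_n].

Definition Helly_B1_EPG_recognition : language :=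
  fun x => exists n (adj : rel 'I_n),
    simple_graph adj /\ x = graph_enc adj /\ has_Helly_B1_EPG adj.

(* Main.v *)
(* Hardness. In a B1 representation every path is a horizontal and a vertical segment, and a
   segment has only two ends to stick out of: among three pairwise disjoint paths meeting a
   segment along its line, one is contained in it there. Encode a boolean by a direction. A hub
   with nine independent neighbours contains three of them in one direction; other neighbours
   of these must then be met in the other direction, where at most two of them can stick out.
   Hence a centre joined by links to three such vertices, where each link has a pendant neighbour
   forcing it to stick out of the centre, cannot have its three variables equal, and any other
   assignment can be drawn. The graph is triangle-free, so the Helly condition is automatic.
   Not-all-equal satisfiability is NP-hard by the Cook-Levin tableau, in which the conjunction of
   two facts is expressed by a single not-all-equal constraint with its negated conjuncts.

   Membership. The coordinates of a representation on n vertices can be compressed to at most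
   3n+1 values per axis; the certificate is the incidence table of paths and grid edges, and
   Gilmore's criterion reduces the Helly condition to triples of edges.

   Polynomial time. Functions built from sums, products, input bits and bounded quantifiers are
   computed by programs with polynomially bounded counters; a single-tape machine simulates these
   by keeping each counter as a marked tape cell. *)
From HB Require Import structures.
Require Import Defs.
From mathcomp Require Import all_boot all_order all_algebra.
From mathcomp Require Import zify.
From Stdlib Require Import FunctionalExtensionality.
Set Implicit Arguments. Unset Strict Implicit. Unset Printing Implicit Defensive.

(** * Turing machine tapes *)

(** Which variable vertices end up inside their hub depends on the representation. Gadgets are
    therefore attached to every triple of distinct variable vertices of a constraint, in enough
    copies that the pigeonhole principle leaves one usable gadget. In the drawing this costs only
    room, since every gadget owns two lines. The vertices of the graph are numbers whose digits
    describe their place in a gadget, so adjacency is arithmetic in two numbers and the input; the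
    constraints of the tableau are likewise an arithmetic relation on the numbers of the
    propositional variables. Polynomial time thus follows, for the reduction and for the verifier
    alike, from closure properties of one class of functions, and no machine is written for a
    particular problem. The tableau needs no constraint for the uniqueness of cell contents: it is
    enough that the contents of the actual run are forced to hold and that non-accepting final
    states are forbidden. *)

Section TapeView.
Variable M : TM.

Definition upd (T : Type) (f : nat -> T) i v := fun j => if j == i then v else f j.

Definition mvh (m : move) (h : nat) :=
  match m with MoveL => h.-1 | MoveR => h.+1 | Stay => h end.

(* Cell [s] of the tape when the scanned cell is given the number [h]. *)
Definition tape (c : config M) (h s : nat) : tm_sym M :=
  let: (q, l, a, r) := c in
  if s < h then nth (tm_blank M) l (h - s.+1) else nth (tm_blank M) (a :: r) (s - h).

(** Cell numbers are absolute, so a step changes the tape only at the scanned cell, whichever way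
    the head moves. The cell to the left of cell 0 has no number, hence the hypothesis on left
    moves. *)
Lemma tape_step c h q' b m :
  ~~ tm_halt M (cfg_state c) ->
  tm_delta M (cfg_state c) (tape c h h) = (q', b, m) ->
  (m = MoveL -> 0 < h) ->
  cfg_state (tm_step c) = q' /\
  forall s, tape (tm_step c) (mvh m h) s = upd (tape c h) h b s.
Proof.
case: c => [[[q l] a] r] /= /negbTE nh; rewrite ltnn subnn /= nh => -> hL.
case: m hL => hL /=.
- move/(_ erefl): hL => h0; case: l => [|c0 l] /=; split=> // s; rewrite /upd /tape.
    case: (ltngtP s h) => sh.
    + case: (ltnP s h.-1) => sh2; first by rewrite !nth_nil.
      have -> : s - h.-1 = 0 by lia.
      by rewrite nth_nil.
    + have -> : s < h.-1 = false by lia.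
      have -> : s - h.-1 = (s - h.+1).+2 by lia.
      by have -> : s - h = (s - h.+1).+1 by lia.
    + rewrite sh; have -> : h < h.-1 = false by lia.
      by have -> : h - h.-1 = 1 by lia.
  case: (ltngtP s h) => sh.
  + case: (ltnP s h.-1) => sh2; first by have -> : h - s.+1 = (h.-1 - s.+1).+1 by lia.
    have -> : s - h.-1 = 0 by lia.
    by have -> : h - s.+1 = 0 by lia.
  + have -> : s < h.-1 = false by lia.
    have -> : s - h.-1 = (s - h.+1).+2 by lia.
    by have -> : s - h = (s - h.+1).+1 by lia.
  + rewrite sh; have -> : h < h.-1 = false by lia.
    by have -> : h - h.-1 = 1 by lia.
- case: r => [|c0 r] /=; split=> // s; rewrite /upd /tape ltnS.
    case: (ltngtP s h) => sh.
    + by have -> : h.+1 - s.+1 = (h - s.+1).+1 by lia.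
    + have -> : s - h = (s - h.+1).+1 by lia.
      by rewrite /= nth_nil; case: (s - h.+1) => [|n] //=; rewrite nth_nil.
    + by rewrite sh subnn.
  case: (ltngtP s h) => sh.
  + by have -> : h.+1 - s.+1 = (h - s.+1).+1 by lia.
  + by have -> : s - h = (s - h.+1).+1 by lia.
  + by rewrite sh subnn.
- split=> // s; rewrite /upd /tape; case: (ltngtP s h) => sh //.
    by have -> : s - h = (s - h.+1).+1 by lia.
  by rewrite sh subnn.
Qed.

Lemma tape_init x h s :
  tape (tm_init M x) h s =
  if s < h then tm_blank M else nth (tm_blank M) (map (tm_in M) x) (s - h).
Proof.
case: x => [|y ys] /=; rewrite nth_nil; case: ifP => // _.
by case: (s - h) => [|n] //=; rewrite nth_nil.
Qed.

(** Reading stops at the first symbol without output bit. Since [onth o i] is [None] past the end of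
    [o], pointwise agreement also fixes where it stops. *)
Lemma cfg_output_tape (c : config M) h o :
  (forall i, tm_out M (tape c h (h + i)) = onth o i) -> cfg_output c = o.
Proof.
case: c => [[[q l] a] r] H.
have {}H i : tm_out M (nth (tm_blank M) (a :: r) i) = onth o i.
  by rewrite -H /= ltnNge leq_addr /= addKn.
rewrite /cfg_output; move: (a :: r) H => {a r} w.
elim: w o => [|a w IH] [|b o] //= H.
- by have := H 0; have := H (size o).+1; rewrite !nth_nil /= onth_default // => ->.
- by rewrite (H 0).
- by rewrite (H 0) /=; congr cons; apply: IH => i; apply: (H i.+1).
Qed.
End TapeView.

(** * Counter machines *)

Inductive cop := Nop of bool | Inc of nat | Dec of nat | Bit of bool & nat | Emit of bool.

Definition creg o := match o with Inc i | Dec i | Bit _ i => i | _ => 0 end.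

(* A transition [mnx q b], where [b] is the outcome of the operation of [q], leads to a state
   or leaves the machine with a boolean exit code. *)
Record mach := Mach {
  mq : finType; m0 : mq; mop : mq -> cop; mnx : mq -> bool -> mq + bool }.

(* the contents of the registers and the output written so far *)
Definition store := ((nat -> nat) * seq bool)%type.

Definition doop (y : seq bool) (o : cop) (s : store) : bool * store :=
  match o with
  | Nop b => (b, s)
  | Inc i => (true, (upd s.1 i (s.1 i).+1, s.2))
  | Dec i => if s.1 i is n.+1 then (true, (upd s.1 i n, s.2)) else (false, s)
  | Bit b i => (onth y (s.1 i) == Some b, s)
  | Emit b => (true, (s.1, rcons s.2 b))
  end.

Definition mstep (A : mach) y (c : (mq A + bool) * store) : (mq A + bool) * store :=
  match c with
  | (inl q, s) => let: (b, s') := doop y (mop q) s in (mnx q b, s')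
  | _ => c
  end.

(* A step of the counter machine is a sweep from the home cell to the mark of the register,
   and back: states are the initial one, [sGo] (moving right), [sPut] (setting the displaced
   mark), [sBack] (moving left) and [sHalt]. *)
Section Simulation.
Variable A : mach.
Let K := (\max_(q : mq A) creg (mop q)).+1.

(* A tape cell holds the input bit, a mark on the home cell, the set of registers whose value
   is the position of the cell, and the output bit. *)
Definition ssym : finType := (option bool * bool * {ffun 'I_K -> bool} * option bool)%type.
Definition sst : finType := (option (mq A * bool) + (mq A + bool) * bool)%type.

Definition smark (a : ssym) i := a.1.2 (inord i).
Definition sset (a : ssym) i v : ssym :=
  (a.1.1, [ffun j => if j == inord i then v else a.1.2 j], a.2).

Definition sInit : sst := inl None.
Definition sGo q : sst := inl (Some (q, false)).
Definition sPut q : sst := inl (Some (q, true)).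
Definition sBack r : sst := inr (r, false).
Definition sHalt r : sst := inr (r, true).
Definition sNext (r : mq A + bool) : sst := if r is inl q then sGo q else sHalt r.

(** A zero register has its mark on the home cell; this is how [Dec] notices failure without ever
    moving left of that cell. [Emit] writes in the first cell that has no output bit. *)
Definition sdelta (st : sst) (a : ssym) : sst * ssym * move :=
  match st with
  | inl None => (sGo (m0 A), (a.1.1.1, true, [ffun=> true], None), Stay)
  | inl (Some (q, false)) =>
    match mop q with
    | Nop b => (sBack (mnx q b), a, Stay)
    | Emit b => if a.2 is None then (sBack (mnx q true), (a.1, Some b), Stay)
                else (st, a, MoveR)
    | Inc i => if smark a i then (sPut q, sset a i false, MoveR) else (st, a, MoveR)
    | Dec i => if smark a i then
                 if a.1.1.2 then (sBack (mnx q false), a, Stay)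
                 else (sPut q, sset a i false, MoveL)
               else (st, a, MoveR)
    | Bit b i => if smark a i then (sBack (mnx q (a.1.1.1 == Some b)), a, Stay)
                 else (st, a, MoveR)
    end
  | inl (Some (q, true)) => (sBack (mnx q true), sset a (creg (mop q)) true, Stay)
  | inr (r, false) => if a.1.1.2 then (sNext r, a, Stay) else (st, a, MoveL)
  | inr (r, true) => (st, a, Stay)
  end.

Definition simTM : TM := {|
  tm_state := sst; tm_sym := ssym;
  tm_blank := ((None, false, [ffun=> false], None) : ssym);
  tm_in := fun b => ((Some b, false, [ffun=> false], None) : ssym);
  tm_out := fun a : ssym => a.2;
  tm_start := sInit;
  tm_halt := fun s : sst => if s is inr (_, true) then true else false;
  tm_accept := fun s : sst => s == sHalt (inr true);
  tm_delta := sdelta |}.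

Definition stape (y : seq bool) (s : store) (i : nat) : ssym :=
  (onth y i, i == 0, [ffun j : 'I_K => s.1 j == i], onth s.2 i).

Definition srel (c : config simTM) q h (T : nat -> ssym) :=
  cfg_state c = q /\ forall s, tape c h s = T s.

Definition reach n q h T q' h' T' :=
  forall c, srel c q h T -> srel (iter n (@tm_step simTM) c) q' h' T'.

Lemma reach_trans n m q h T q1 h1 T1 q2 h2 T2 :
  reach n q h T q1 h1 T1 -> reach m q1 h1 T1 q2 h2 T2 -> reach (n + m) q h T q2 h2 T2.
Proof. by move=> H1 H2 c /H1/H2; rewrite addnC iterD. Qed.

Lemma reach1 q h T q' b m T' :
  ~~ tm_halt simTM q -> sdelta q (T h) = (q', b, m) -> (m = MoveL -> 0 < h) ->
  (forall s, upd T h b s = T' s) -> reach 1 q h T q' (mvh m h) T'.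
Proof.
move=> nh E hL HT c [Eq Et] /=.
have [|||E1 E2] := @tape_step simTM c h q' b m => //; first by rewrite Eq.
  by rewrite Eq Et.
split=> // s; rewrite E2 -HT /upd; by case: ifP.
Qed.

Lemma upd_id (T : Type) (f : nat -> T) i s : upd f i (f i) s = f s.
Proof. by rewrite /upd; case: eqP => [->|]. Qed.

Lemma reach_right q h p T :
  ~~ tm_halt simTM q -> h <= p ->
  (forall s, h <= s < p -> sdelta q (T s) = (q, T s, MoveR)) ->
  reach (p - h) q h T q p T.
Proof.
move=> nh; elim: p => [|p IH] hp H.
  by have -> : h = 0 by lia.
have [->|ne] := eqVneq h p.+1; first by rewrite subnn.
have hp' : h <= p by lia.
rewrite subSn // -addn1; apply: (reach_trans (q1 := q) (h1 := p) (T1 := T)).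
  by apply: IH => // s hs; apply: H; lia.
by apply: (@reach1 q p T q (T p) MoveR T) => //; [apply: H; lia | exact: upd_id].
Qed.

Lemma reach_back r p y s :
  reach p.+1 (sBack r) p (stape y s) (sNext r) 0 (stape y s).
Proof.
elim: p => [|p IH].
  by apply: (reach1 (b := stape y s 0) (m := Stay)) => //= i; exact: upd_id.
rewrite -add1n; apply: reach_trans IH.
by apply: (reach1 (b := stape y s p.+1) (m := MoveL)) => //= i; exact: upd_id.
Qed.

Lemma inordK_creg (q : mq A) : (inord (creg (mop q)) : 'I_K) = creg (mop q) :> nat.
Proof. by apply: inordK; rewrite ltnS; apply: leq_bigmax. Qed.

Lemma smark_stape y s (q : mq A) i :
  smark (stape y s i) (creg (mop q)) = (s.1 (creg (mop q)) == i).
Proof. by rewrite /smark /= ffunE inordK_creg. Qed.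

(* Moving one mark by one cell clears it in one cell and sets it in a neighbour. *)
Lemma upd2_stape y (s : store) (q : mq A) j v i :
  s.1 (creg (mop q)) = j -> v != j ->
  let T := upd (stape y s) j (sset (stape y s j) (creg (mop q)) false) in
  upd T v (sset (T v) (creg (mop q)) true) i = stape y (upd s.1 (creg (mop q)) v, s.2) i.
Proof.
move=> Ej vj /=; rewrite /upd /stape /sset /= (negbTE vj).
have E (k : 'I_K) : (k == inord (creg (mop q))) = (k == creg (mop q) :> nat).
  by rewrite -val_eqE /= inordK_creg.
case: (eqVneq i v) => [->|ne]; first congr (_, _, _, _).
  by apply/ffunP => k; rewrite !ffunE E /=; case: eqP => // _; rewrite eqxx.
case: (eqVneq i j) => [->|nj] /=; congr (_, _, _, _); apply/ffunP => k; rewrite !ffunE ?E.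
  by case: eqP => // _; rewrite (negbTE vj).
by case: (eqVneq (k : nat) (creg (mop q))) => // ->;
  rewrite Ej [v == i]eq_sym (negbTE ne) eq_sym (negbTE nj).
Qed.

(** A mark stands at the value of its register and the output ends at its length, so a sweep turns
    back at cell [B.+1] at the latest. *)
Lemma sim_step y q s B :
  (forall i, s.1 i <= B) -> size s.2 <= B ->
  let: (q', s') := mstep y (inl q, s) in
  exists2 n, n <= B.*2 + 5 & reach n (sGo q) 0 (stape y s) (sNext q') 0 (stape y s').
Proof.
move=> HB Ho; rewrite /mstep.
have go p : (forall i, i < p -> sdelta (sGo q) (stape y s i) = (sGo q, stape y s i, MoveR)) ->
    reach p (sGo q) 0 (stape y s) (sGo q) p (stape y s).
  move=> H; have := @reach_right (sGo q) 0 p (stape y s) isT (leq0n _).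
  by rewrite subn0; apply.
have inst n a p r T' s' : reach n (sGo q) 0 (stape y s) a p T' ->
    reach 1 a p T' (sBack r) p (stape y s') -> n + p.+2 <= B.*2 + 5 ->
    exists2 n, n <= B.*2 + 5 & reach n (sGo q) 0 (stape y s) (sNext r) 0 (stape y s').
  move=> H1 H2 le; exists (n + (1 + p.+1)); first by lia.
  by apply: reach_trans H1 _; apply: reach_trans H2 _; apply: reach_back.
have mk i := smark_stape y s q i.
have u2 := @upd2_stape y s q.
case Eo: (mop q) mk u2 => [b|i|i|b i|b] /= mk u2.
- apply: (inst 0 (sGo q) 0 _ (stape y s)); [by move=> c | | lia].
  by apply: (reach1 (b := stape y s 0) (m := Stay)); rewrite /= ?Eo //= => ?; exact: upd_id.
- have H0 := HB i; pose T1 := upd (stape y s) (s.1 i) (sset (stape y s (s.1 i)) i false).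
  apply: (inst ((s.1 i) + 1) (sPut q) (s.1 i).+1 _ T1); last lia.
    apply: reach_trans (go (s.1 i) _) _.
      by move=> j jl; rewrite /= Eo mk; case: eqP => //; lia.
    apply: (reach1 (m := MoveR) (b := sset (stape y s (s.1 i)) i false)) => //.
    by rewrite /= Eo mk eqxx.
  apply: (reach1 (m := Stay) (b := sset (T1 (s.1 i).+1) i true)) => //.
    by rewrite /= Eo.
  by move=> j; rewrite /T1 u2 //; lia.
- have H0 := HB i.
  have HG : reach (s.1 i) (sGo q) 0 (stape y s) (sGo q) (s.1 i) (stape y s).
    by apply: go => j jl; rewrite /= Eo mk; case: eqP => //; lia.
  case Ei: (s.1 i) H0 HG u2 => [|n] H0 HG u2.
    apply: (inst 0 (sGo q) 0 _ (stape y s)); [by move=> c | | lia].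
    apply: (reach1 (m := Stay) (b := stape y s 0)) => //; last exact: upd_id.
    by rewrite /= Eo mk Ei eqxx.
  pose T1 := upd (stape y s) n.+1 (sset (stape y s n.+1) i false).
  apply: (inst (n.+1 + 1) (sPut q) n _ T1); last lia.
    apply: reach_trans HG _.
    apply: (reach1 (m := MoveL) (b := sset (stape y s n.+1) i false)) => //.
    by rewrite /= Eo mk Ei eqxx.
  apply: (reach1 (m := Stay) (b := sset (T1 n) i true)) => //.
    by rewrite /= Eo.
  by move=> j; rewrite /T1 u2 //; lia.
- have H0 := HB i.
  apply: (inst (s.1 i) (sGo q) (s.1 i) _ (stape y s)); last lia.
    by apply: go => j jl; rewrite /= Eo mk; case: eqP => //; lia.
  apply: (reach1 (m := Stay) (b := stape y s (s.1 i))) => //; last exact: upd_id.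
  by rewrite /= Eo mk eqxx.
- apply: (inst (size s.2) (sGo q) (size s.2) _ (stape y s)); last lia.
    apply: go => j jl; rewrite /= Eo.
    by have := onthTE s.2 j; rewrite jl; case: (onth s.2 j).
  apply: (reach1 (m := Stay) (b := ((stape y s (size s.2)).1, Some b))) => //.
    by rewrite /= Eo onth_default.
  move=> j; rewrite /upd /stape /= -cats1 onth_cat.
  case: (ltngtP j (size s.2)) => [jl|jl|->].
  + by congr (_, _, _, _).
  + congr (_, _, _, _); rewrite !onth_default //=; lia.
  + by rewrite subnn.
Qed.

Lemma mstep_bound y q s B : (forall i, s.1 i <= B) -> size s.2 <= B ->
  (forall i, (mstep (A := A) y (inl q, s)).2.1 i <= B.+1) /\
  size (mstep (A := A) y (inl q, s)).2.2 <= B.+1.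
Proof.
move=> H1 H2; rewrite /mstep; case: (mop q) => [b|i|i|b i|b] /=.
- by split=> [j|]; [have := H1 j|]; lia.
- by rewrite /upd; split=> [j|]; [case: ifP => _; [have := H1 i|have := H1 j]|]; lia.
- case E: (s.1 i) => [|n] /=; first by split=> [j|]; [have := H1 j|]; lia.
  by rewrite /upd; split=> [j|]; [case: ifP => _; [have := H1 i|have := H1 j]|]; lia.
- by split=> [j|]; [have := H1 j|]; lia.
- by rewrite size_rcons; split=> [j|]; [have := H1 j|]; lia.
Qed.

(** A step raises each register and the output length by at most one, so [B + t] bounds them
    throughout the run; the slowdown is quadratic. *)
Lemma sim_run y t q s b s' B :
  (forall i, s.1 i <= B) -> size s.2 <= B ->
  iter t (mstep (A := A) y) (inl q, s) = (inr b, s') ->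
  exists2 n, n <= t * ((B + t).*2 + 5) &
    reach n (sGo q) 0 (stape y s) (sHalt (inr b)) 0 (stape y s').
Proof.
elim: t q s B => [//|t IH] q s B H1 H2; rewrite iterSr => E.
have [B1 B2] := mstep_bound y q H1 H2.
have := sim_step y q H1 H2.
case E1 : (mstep y (inl q, s)) E B1 B2 => [[q'|b'] s1] /= E B1 B2 [n Hn R1]; last first.
  have Ef k : iter k (mstep (A := A) y) (inr b', s1) = (inr b', s1).
    by elim: k => //= k ->.
  move: E; rewrite Ef => -[<- <-]; exists n => //.
  by nia.
have [n2 Hn2 R2] := IH _ _ _ B1 B2 E.
by exists (n + n2); [nia | apply: reach_trans R1 R2].
Qed.

Lemma reach0_init x :
  reach 1 sInit 0 (fun s => nth (tm_blank simTM) (map (tm_in simTM) x) s)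
    (sGo (m0 A)) 0 (stape x (fun=> 0, [::])).
Proof.
set T := fun s => _.
have ET s : T s = (onth x s, false, [ffun=> false], None).
  rewrite /T; case: (ltnP s (size x)) => hs.
    have := onthTE x s; rewrite hs; case E: (onth x s) => [b|//] _.
    by rewrite (nth_map b) //=; congr (Some _, _, _, _); exact: onth_nth E.
  by rewrite nth_default ?size_map // onth_default.
apply: (reach1 (m := Stay) (b := (onth x 0, true, [ffun=> true], None))) => //.
  by rewrite ET.
move=> s; rewrite /upd /stape onth0n; case: (eqVneq s 0) => [->|ne].
  by congr (_, _, _, _); apply/ffunP => j; rewrite !ffunE.
rewrite ET; congr (_, _, _, _); apply/ffunP => j; rewrite !ffunE /=.
Qed.

Lemma tm_run_halted (M : TM) x n m :
  n <= m -> tm_halt M (cfg_state (tm_run M n x)) -> tm_run M m x = tm_run M n x.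
Proof.
move=> /subnK <- H; rewrite /tm_run addnC; elim: (m - n) => [|k IH]; first by rewrite addn0.
rewrite addnS /= {}IH; move: H; rewrite /tm_run.
by case: (iter n _ _) => [[[q l] a] r] /= ->.
Qed.

Lemma sim_correct x t b s :
  iter t (mstep (A := A) x) (inl (m0 A), (fun=> 0, [::])) = (inr b, s) ->
  forall n, t * (t.*2 + 5) + 1 <= n ->
  let c := tm_run simTM n x in
  [/\ tm_halt simTM (cfg_state c), tm_accept simTM (cfg_state c) = b & cfg_output c = s.2].
Proof.
move=> E n Hn /=.
have [n2 Hn2 R] := @sim_run x t (m0 A) (fun=> 0, [::]) b s 0 (fun=> leqnn _) isT E.
have [E1 E2] : srel (tm_run simTM (1 + n2) x) (sHalt (inr b)) 0 (stape x s).
  have HR := reach_trans (@reach0_init x) R; apply: HR; split.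
    by case: (x).
  by move=> i; rewrite tape_init /= subn0.
have hle : 1 + n2 <= n by rewrite add0n in Hn2; lia.
rewrite (tm_run_halted hle) E1 //; split=> //.
  by rewrite /= /sHalt; case: b {E E1 R}.
by apply: (cfg_output_tape (h := 0)) => i; rewrite add0n E2.
Qed.
End Simulation.

(** * Structured counter programs *)

Lemma upd_eq (T : Type) (f : nat -> T) i v : upd f i v i = v.
Proof. by rewrite /upd eqxx. Qed.

Definition prim o : mach := @Mach unit tt (fun=> o) (fun _ b => inr b).

Definition ite (A B C : mach) : mach :=
  @Mach (mq A + (mq B + mq C))%type (inl (m0 A))
    (fun q => match q with
              | inl q => mop q | inr (inl q) => mop q | inr (inr q) => mop q end)
    (fun q b => match q with
      | inl q => match mnx q b with
                 | inl q' => inl (inl q')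
                 | inr b' => inl (inr (if b' then inl (m0 B) else inr (m0 C))) end
      | inr (inl q) => match mnx q b with
                 | inl q' => inl (inr (inl q')) | inr b' => inr b' end
      | inr (inr q) => match mnx q b with
                 | inl q' => inl (inr (inr q')) | inr b' => inr b' end
      end).

Definition rep (A : mach) : mach :=
  @Mach (mq A) (m0 A) (@mop A)
    (fun q b => match mnx q b with
                | inl q' => inl q'
                | inr b' => if b' then inl (m0 A) else inr true end).

(** When the test [A] fails, [Nop false] supplies the exit code that makes [rep] leave; a body has
    to exit with true in order to be followed by another round. *)
Definition wh A B := rep (ite A B (prim (Nop false))).
Definition sq A B := ite A B (prim (Nop true)).
Definition zero i := wh (prim (Dec i)) (prim (Nop true)).
Definition mov i j := wh (prim (Dec i)) (prim (Inc j)).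

Definition ev (A : mach) y s t b s' :=
  exists2 t', t' <= t & iter t' (mstep (A := A) y) (inl (m0 A), s) = (inr b, s').

Lemma ev_le A y s t t' b s' : t <= t' -> ev A y s t b s' -> ev A y s t' b s'.
Proof. by move=> le [n n1 n2]; exists n => //; apply: leq_trans le. Qed.

(** A submachine runs inside a larger one as it does alone, until it exits and [ex] takes over; all
    combinators rest on this. The time is only bounded by [t] because the inner run may have exited
    before step [t]. *)
Lemma mstep_embed (A D : mach) (g : mq A -> mq D) (ex : bool -> mq D + bool) y :
  (forall q, mop (g q) = mop q) ->
  (forall q b, mnx (g q) b = match mnx q b with inl q' => inl (g q') | inr b' => ex b' end) ->
  forall t q s b s', iter t (mstep (A := A) y) (inl q, s) = (inr b, s') ->
  exists2 t', t' <= t & iter t' (mstep (A := D) y) (inl (g q), s) = (ex b, s').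
Proof.
move=> Hop Hnx; elim=> [//|t IH] q s b s'; rewrite iterSr {2}/mstep.
have E1 : mstep (A := D) y (inl (g q), s) =
    let: (b, s') := doop y (mop q) s in
    (match mnx q b with inl q' => inl (g q') | inr b' => ex b' end, s').
  by rewrite /mstep Hop; case: (doop _ _ _) => b0 s0; rewrite Hnx.
case: (doop y (mop q) s) E1 => b0 s0; case: (mnx q b0) => [q'|b'] E1.
  move/IH => [t' le E]; exists t'.+1 => //.
  by rewrite iterSr E1.
have -> : iter t (mstep (A := A) y) (inr b', s0) = (inr b', s0) by elim: t {IH} => //= t ->.
by case=> <- <-; exists 1.
Qed.

Lemma ev_prim o y s b s' : doop y o s = (b, s') -> ev (prim o) y s 1 b s'.
Proof. by move=> E; exists 1 => //=; rewrite E. Qed.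

Lemma ev_ite A B C y s t1 b1 s1 t2 b2 s2 :
  ev A y s t1 b1 s1 -> ev (if b1 then B else C) y s1 t2 b2 s2 ->
  ev (ite A B C) y s (t1 + t2) b2 s2.
Proof.
move=> [n1 le1 E1] [n2 le2 E2].
have [|//|k1 h1 F1] := @mstep_embed A (ite A B C) inl
  (fun b => inl (inr (if b then inl (m0 B) else inr (m0 C)))) y _ _ _ _ _ _ _ E1 => //.
have [k2 h2 F2] : exists2 k, k <= n2 & iter k (mstep (A := ite A B C) y)
   (inl (inr (if b1 then inl (m0 B) else inr (m0 C))), s1) = (inr b2, s2).
  case: b1 E2 {E1 F1} => E2.
    exact: (@mstep_embed B (ite A B C) (inr \o inl) inr y _ _ _ _ _ _ _ E2).
  exact: (@mstep_embed C (ite A B C) (inr \o inr) inr y _ _ _ _ _ _ _ E2).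
by exists (k2 + k1); [lia | rewrite iterD F1].
Qed.

Lemma ev_sq A B y s t1 s1 t2 b2 s2 :
  ev A y s t1 true s1 -> ev B y s1 t2 b2 s2 -> ev (sq A B) y s (t1 + t2) b2 s2.
Proof. by move=> H1 H2; apply: ev_ite H1 _. Qed.

Lemma ev_wh A B y (S : nat -> store) s' n ta tb :
  (forall i, i < n -> exists2 s1, ev A y (S i) ta true s1 & ev B y s1 tb true (S i.+1)) ->
  ev A y (S n) ta false s' ->
  ev (wh A B) y (S 0) (n * (ta + tb) + ta + 1) true s'.
Proof.
move=> Hi Hn; set D := ite A B (prim (Nop false)).
have step q t s b s1 : iter t (mstep (A := D) y) (inl q, s) = (inr b, s1) ->
    exists2 t', t' <= t & iter t' (mstep (A := wh A B) y) (inl q, s) =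
      (if b then inl (m0 (wh A B)) else inr true, s1).
  exact: (@mstep_embed D (wh A B) id (fun b => if b then inl (m0 (wh A B)) else inr true)).
have HD i : i < n -> ev D y (S i) (ta + tb) true (S i.+1).
  by move=> /Hi[s1 H1 H2]; apply: ev_ite H1 _.
have HDn : ev D y (S n) (ta + 1) false s' by apply: ev_ite Hn _; exact: ev_prim.
suff: forall k, k <= n -> ev (wh A B) y (S (n - k)) (k * (ta + tb) + ta + 1) true s'.
  by move/(_ n (leqnn _)); rewrite subnn.
elim=> [_|k IH lk].
  rewrite subn0; case: HDn => t le /step[t' le' E]; exists t' => //; lia.
have [|t le /step[t' le' E]] := HD (n - k.+1); first by lia.
have [t2 le2 E2] := IH (ltnW lk).
exists (t2 + t'); first by nia.
rewrite iterD E; by have <- : n - k = (n - k.+1).+1 by lia.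
Qed.

(** [S i] is the store before round [i]. The test is itself the decrement, so the body starts with
    the counter already lowered. *)
Lemma ev_for B y r (S : nat -> store) n tb :
  (forall i, i <= n -> (S i).1 r = n - i) ->
  (forall i, i < n -> ev B y (upd (S i).1 r (n - i.+1), (S i).2) tb true (S i.+1)) ->
  ev (wh (prim (Dec r)) B) y (S 0) (n * (1 + tb) + 2) true (S n).
Proof.
move=> Hr HB; have -> : n * (1 + tb) + 2 = n * (1 + tb) + 1 + 1 by lia.
apply: ev_wh => [i lt|]; last first.
  by apply: ev_prim; rewrite /= Hr // subnn.
exists (upd (S i).1 r (n - i.+1), (S i).2); last exact: HB.
by apply: ev_prim; rewrite /= Hr ?(ltnW lt) //; have -> : n - i = (n - i.+1).+1 by lia.
Qed.

Ltac upd_ext := apply: functional_extensionality => ?; rewrite /upd;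
  repeat (case: eqP => ?; subst => //=); try (by lia); try (by congr (_ _); lia).

Lemma ev_zero y σ o i : ev (zero i) y (σ, o) (σ i * 2 + 2) true (upd σ i 0, o).
Proof.
have := @ev_for (prim (Nop true)) y i (fun k => (upd σ i (σ i - k), o)) (σ i) 1.
rewrite /= subnn; have -> : upd σ i (σ i - 0) = σ by upd_ext.
apply=> [k _|k lt]; first by rewrite /upd eqxx.
by apply: ev_prim => /=; congr (_, (_, _)); upd_ext.
Qed.

Lemma ev_mov y σ o i j : i != j ->
  ev (mov i j) y (σ, o) (σ i * 2 + 2) true (upd (upd σ j (σ j + σ i)) i 0, o).
Proof.
move=> ne.
have := @ev_for (prim (Inc j)) y i (fun k => (upd (upd σ j (σ j + k)) i (σ i - k), o)) (σ i) 1.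
rewrite /= subnn; have -> : upd (upd σ j (σ j + 0)) i (σ i - 0) = σ by upd_ext.
apply=> [k _|k lt]; first by rewrite /upd eqxx.
apply: ev_prim => /=; congr (_, (_, _)).
have -> : upd (upd (upd σ j (σ j + k)) i (σ i - k)) i (σ i - k.+1) j = σ j + k.
  by rewrite /upd eq_sym (negbTE ne) eqxx.
by upd_ext.
Qed.

(** * Polynomially computable functions *)

(** As the base [m + 2] is at least 2, a larger exponent absorbs constant factors and summands, and
    a single exponent describes the bound. *)
Definition poly (T : nat -> nat) := exists k, forall m, T m <= (m + 2) ^ k.

Lemma poly_cst c : poly (fun=> c).
Proof.
exists c => m; apply: leq_trans (_ : 2 ^ c <= _); first by apply: ltnW; exact: ltn_expl.
by case: c => // c; rewrite leq_exp2r // leq_addl.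
Qed.

Lemma poly_id : poly id.
Proof. by exists 1 => m; rewrite expn1 leq_addr. Qed.

Lemma poly_mul T1 T2 : poly T1 -> poly T2 -> poly (fun m => T1 m * T2 m).
Proof. by move=> [k1 H1] [k2 H2]; exists (k1 + k2) => m; rewrite expnD leq_mul. Qed.

Lemma poly_add T1 T2 : poly T1 -> poly T2 -> poly (fun m => T1 m + T2 m).
Proof.
move=> [k1 H1] [k2 H2]; exists (k1 + k2).+1 => m; rewrite expnS.
have h k : 0 < (m + 2) ^ k by rewrite expn_gt0 addn2.
apply: leq_trans (leq_add (H1 m) (H2 m)) _.
have : (m + 2) ^ k1 <= (m + 2) ^ (k1 + k2) by rewrite leq_pexp2l ?addn2 ?leq_addr.
have : (m + 2) ^ k2 <= (m + 2) ^ (k1 + k2) by rewrite leq_pexp2l ?addn2 ?leq_addl.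
by nia.
Qed.

Lemma poly_comp T1 T2 : poly T1 -> poly T2 -> poly (fun m => T1 (T2 m)).
Proof.
move=> [k1 H1] [k2 H2]; exists (k2.+2 * k1) => m.
apply: leq_trans (H1 _) _; rewrite expnM.
have h : T2 m + 2 <= (m + 2) ^ k2.+2.
  have := H2 m; rewrite !expnS.
  have : 0 < (m + 2) ^ k2 by rewrite expn_gt0 addn2.
  by nia.
by case: k1 {H1} => // k1; rewrite leq_exp2r.
Qed.

Ltac solve_poly := repeat first
  [ exact: poly_cst | exact: poly_id | assumption | apply: poly_add | apply: poly_mul
  | apply: poly_comp ].

Definition ctx := (seq bool * seq nat)%type.

(* [F] is computable in time polynomial in the length of the input word and the values of
   the variables: whatever registers [ρ] hold the variables, the value is put in any given
   register [s] beyond which all registers are free. *)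
Definition dT (F : ctx -> nat) :=
  forall ρ s, all (fun i => i < s) ρ -> exists A T, poly T /\
  forall y σ o m, (forall i, s <= i -> σ i = 0) -> size y <= m -> all (fun i => σ i <= m) ρ ->
    F (y, map σ ρ) <= T m /\
    ev A y (σ, o) (T m) true (upd σ s (F (y, map σ ρ)), o).

Definition dB (P : ctx -> bool) := dT (fun c => P c : nat).

Lemma eq_dT F G : F =1 G -> dT F -> dT G.
Proof. by move/functional_extensionality <-. Qed.

Lemma map_upd (σ : nat -> nat) s v ρ : all (fun i => i < s) ρ -> map (upd σ s v) ρ = map σ ρ.
Proof.
move=> /allP H; apply/eq_in_map => i /H; rewrite /upd; by case: eqP => // ->; rewrite ltnn.
Qed.

Lemma all_lt_le s s' ρ : s <= s' -> all (fun i => i < s) ρ -> all (fun i => i < s') ρ.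
Proof. by move=> le; apply: sub_all => i h; apply: leq_trans le. Qed.

Lemma all_upd_le (σ : nat -> nat) s v m ρ : all (fun i => i < s) ρ ->
  all (fun i => upd σ s v i <= m) ρ = all (fun i => σ i <= m) ρ.
Proof.
move=> /allP H; apply: eq_in_all => i /H; rewrite /upd; by case: eqP => // ->; rewrite ltnn.
Qed.

Lemma all_le_trans m m' (σ : nat -> nat) ρ : m <= m' ->
  all (fun i => σ i <= m) ρ -> all (fun i => σ i <= m') ρ.
Proof. by move=> le; apply: sub_all => i h; apply: leq_trans le. Qed.

Lemma dT0 : dT (fun=> 0).
Proof.
move=> ρ s _; exists (prim (Nop true)), (fun=> 1); split; first by solve_poly.
move=> y σ o m H _ _; split=> //; apply: ev_prim => /=; congr (_, (_, _)).
by apply: functional_extensionality => i; rewrite /upd; case: eqP => // ->; rewrite H.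
Qed.

Lemma dTS F : dT F -> dT (fun c => (F c).+1).
Proof.
move=> H ρ s Hs; have [A [T [pT HA]]] := H ρ s Hs.
exists (sq A (prim (Inc s))), (fun m => T m + 1); split; first by solve_poly.
move=> y σ o m h1 h2 h3; have [b1 b2] := HA y σ o m h1 h2 h3; split; first by lia.
apply: ev_sq b2 _; apply: ev_prim => /=; congr (_, (_, _)).
by rewrite upd_eq; upd_ext.
Qed.

Lemma dT_cst n : dT (fun=> n).
Proof. elim: n => [|n IH]; [exact: dT0 | exact: dTS]. Qed.

(** Reading a register by decrements destroys it: the loop drains [r] into the two registers [s] and
    [s.+1], and the second copy is moved back to [r]. *)
Lemma dT_hd : dT (fun c => head 0 c.2).
Proof.
move=> [|r ρ] s; first by move=> _; exact: dT0.
move=> /= /andP[rs _].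
exists (sq (wh (prim (Dec r)) (sq (prim (Inc s)) (prim (Inc s.+1)))) (mov s.+1 r)),
  (fun m => m * 3 + 2 + (m * 2 + 2)); split; first by solve_poly.
move=> y σ o m h1 _ /andP[h3 _]; split; first by lia.
apply: (@ev_le _ _ _ (σ r * (1 + (1 + 1)) + 2 + (σ r * 2 + 2))); first by lia.
pose S k : store := (upd (upd (upd σ s.+1 k) s k) r (σ r - k), o).
have Es := h1 s (leqnn _); have Es1 := h1 s.+1 (leqnSn _).
have -> : (σ, o) = S 0 by rewrite /S; congr (_, _); upd_ext; lia.
apply: ev_sq.
  apply: ev_for => [i le|i lt]; first by rewrite /= /upd eqxx.
  by apply: ev_sq; apply: ev_prim => //=; congr (_, (_, _)); upd_ext;
    rewrite /upd; repeat case: eqP => ?; lia.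
have E1 : (S (σ r)).1 s.+1 = σ r by rewrite /= /upd; repeat case: eqP => ?; lia.
have := @ev_mov y (S (σ r)).1 o s.+1 r; rewrite E1.
have -> : upd (upd (S (σ r)).1 r ((S (σ r)).1 r + σ r)) s.+1 0 = upd σ s (σ r).
  by upd_ext; rewrite /= /upd; repeat case: eqP => ?; subst => //; lia.
by apply; lia.
Qed.

Lemma dT_tl F : dT F -> dT (fun c => F (c.1, behead c.2)).
Proof.
move=> H ρ s Hs; have [|A [T [pT HA]]] := H (behead ρ) s.
  by case: ρ Hs => //= ? ? /andP[].
exists A, T; split=> // y σ o m h1 h2 h3; rewrite /= behead_map.
apply: HA => //; by case: ρ h3 {Hs} => //= ? ? /andP[].
Qed.

Section Binary.
Variables (F G : ctx -> nat) (op : nat -> nat -> nat) (B : nat -> mach) (Top : nat -> nat).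
Hypotheses (pop : poly Top)
  (HB : forall s y σ o m, σ s <= m -> σ s.+1 <= m ->
     op (σ s) (σ s.+1) <= Top m /\
     ev (B s) y (σ, o) (Top m) true (upd (upd σ s (op (σ s) (σ s.+1))) s.+1 0, o)).

(** The first value waits in [s] while the second is computed with [s.+1] as the first free
    register; [B] combines them and clears [s.+1]. *)
Lemma dT_binop : dT F -> dT G -> dT (fun c => op (F c) (G c)).
Proof.
move=> HF HG ρ s Hs; have [A [T [pT HA]]] := HF ρ s Hs.
have Hs1 := all_lt_le (leqnSn s) Hs.
have [A' [T' [pT' HA']]] := HG ρ s.+1 Hs1.
exists (sq A (sq A' (B s))), (fun m => T m + (T' m + Top (T m + T' m))).
split; first by solve_poly.
move=> y σ o m h1 h2 h3; have [b1 b2] := HA y σ o m h1 h2 h3.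
set v := F _ in b1 b2 *.
have [|||b3 b4] := HA' y (upd σ s v) o m; rewrite ?all_upd_le //.
  by move=> i hi; rewrite /upd; case: eqP => ?; [lia | apply: h1; lia].
rewrite map_upd // in b3 b4; set w := G _ in b3 b4 *.
have Ev : upd (upd σ s v) s.+1 w s = v by rewrite /upd; repeat case: eqP => ?; lia.
have Ew : upd (upd σ s v) s.+1 w s.+1 = w by rewrite /upd eqxx.
have := @HB s y (upd (upd σ s v) s.+1 w) o (T m + T' m); rewrite Ev Ew.
case=> [||b5 b6]; [lia | lia | split; first by lia].
apply: ev_sq b2 _; apply: ev_sq b4 _.
have <- : upd (upd (upd (upd σ s v) s.+1 w) s (op v w)) s.+1 0 = upd σ s (op v w) => //.
by upd_ext; rewrite h1.
Qed.
End Binary.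

Lemma dT_add F G : dT F -> dT G -> dT (fun c => F c + G c).
Proof.
apply: (@dT_binop F G addn (fun s => mov s.+1 s) (fun m => m * 2 + 2)); first by solve_poly.
move=> s y σ o m h1 h2; split; first by lia.
apply: (@ev_le _ _ _ (σ s.+1 * 2 + 2)); first by lia.
by apply: ev_mov; lia.
Qed.

Lemma dT_sub F G : dT F -> dT G -> dT (fun c => F c - G c).
Proof.
apply: (@dT_binop F G subn (fun s => wh (prim (Dec s.+1)) (ite (prim (Dec s))
   (prim (Nop true)) (prim (Nop true)))) (fun m => m * 3 + 2)); first by solve_poly.
move=> s y σ o m h1 h2; split; first by lia.
apply: (@ev_le _ _ _ (σ s.+1 * (1 + (1 + 1)) + 2)); first by lia.
pose S k : store := (upd (upd σ s (σ s - k)) s.+1 (σ s.+1 - k), o).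
have -> : (σ, o) = S 0 by rewrite /S; congr (_, _); upd_ext; lia.
have -> : (upd (upd σ s (σ s - σ s.+1)) s.+1 0, o) = S (σ s.+1) by rewrite /S subnn.
apply: ev_for => [i le|i lt]; first by rewrite /= /upd eqxx.
apply: (@ev_ite _ _ _ _ _ 1 (i < σ s) (S i.+1)).
  apply: ev_prim; rewrite /=.
  have -> : upd (upd (upd σ s (σ s - i)) s.+1 (σ s.+1 - i)) s.+1 (σ s.+1 - i.+1) s = σ s - i.
    by rewrite /upd; repeat case: eqP => ?; lia.
  case: (ltnP i (σ s)) => hi.
    have -> : σ s - i = (σ s - i.+1).+1 by lia.
    by congr (_, (_, _)); upd_ext.
  have -> : σ s - i = 0 by lia.
  by congr (_, (_, _)); upd_ext; lia.
by case: ifP => _; apply: ev_prim.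
Qed.

(** No operation yields the length. A position is inside the input when one of the two bit tests
    succeeds, so the program counts up to the first position where both fail. *)
Lemma dT_size : dT (fun c => size c.1).
Proof.
move=> ρ s _.
exists (wh (ite (prim (Bit true s)) (prim (Nop true)) (prim (Bit false s))) (prim (Inc s))),
  (fun m => m * 3 + 3); split; first by solve_poly.
move=> y σ o m h1 h2 _; split; first by rewrite /=; lia.
apply: (@ev_le _ _ _ (size y * (2 + 1) + 2 + 1)); first by lia.
have -> : (σ, o) = (upd σ s 0, o) by congr (_, _); upd_ext; rewrite h1.
have E k : upd σ s k s = k by rewrite /upd eqxx.
have T k b : ev (prim (Bit b s)) y (upd σ s k, o) 1 (onth y k == Some b) (upd σ s k, o).
  by apply: ev_prim; rewrite /= E.
apply: (@ev_wh _ _ _ (fun k => (upd σ s k, o))) => [i lt|]; last first.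
  by apply: (@ev_ite _ _ _ _ _ 1 _ _ 1 _ _ (T _ _)); rewrite onth_default //=;
     have := T (size y) false; rewrite onth_default.
exists (upd σ s i, o); last by apply: ev_prim; rewrite /= E; congr (_, (_, _)); upd_ext.
apply: (@ev_ite _ _ _ _ _ 1 _ _ 1 _ _ (T _ _)).
have := onthTE y i; rewrite lt; case Eb: (onth y i) => [[]|] // _ /=.
  exact: ev_prim.
by have := T i false; rewrite Eb eqxx.
Qed.

Lemma dT_bit b F : dT F -> dB (fun c => onth c.1 (F c) == Some b).
Proof.
move=> HF ρ s Hs; have [A [T [pT HA]]] := HF ρ s Hs.
exists (sq A (ite (prim (Bit b s)) (sq (zero s) (prim (Inc s))) (zero s))),
  (fun m => T m + (1 + (T m * 2 + 2 + 1))); split; first by solve_poly.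
move=> y σ o m h1 h2 h3; have [b1 b2] := HA y σ o m h1 h2 h3.
split; first by case: (_ == _); lia.
apply: ev_sq b2 _; rewrite [(_, _).1]/=; set v := F _ in b1 *.
have E : upd σ s v s = v by rewrite /upd eqxx.
apply: (@ev_ite _ _ _ _ _ 1 (onth y v == Some b) (upd σ s v, o)).
  by apply: ev_prim; rewrite /= E.
have H := ev_zero y (upd σ s v) o s; rewrite E in H.
case: (_ == _).
  apply: (@ev_le _ _ _ (v * 2 + 2 + 1)); first by lia.
  apply: ev_sq H _; apply: ev_prim => /=; congr (_, (_, _)).
  by rewrite upd_eq; upd_ext.
apply: (@ev_le _ _ _ (v * 2 + 2)); first by lia.
have -> : upd σ s false = upd (upd σ s v) s 0 by upd_ext.
exact: H.
Qed.

(** Bounded sums are the source of products, quantifiers and division. Register [s] counts down,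
    [s.+1] holds the bound variable, [s.+2] accumulates and [s.+3] receives the summand. The bound
    variable stays below [T m], so a summand takes time at most [T' (m + T m)]. *)
Lemma dT_sum F G : dT F -> dT G ->
  dT (fun c => \sum_(0 <= v < F c) G (c.1, v :: c.2)).
Proof.
move=> HF HG ρ s Hs; have [A [T [pT HA]]] := HF ρ s Hs.
have Hs3 : all (fun i => i < s.+3) (s.+1 :: ρ).
  by rewrite /= (all_lt_le _ Hs) ?andbT; lia.
have [A' [T' [pT' HA']]] := HG (s.+1 :: ρ) s.+3 Hs3.
pose body := sq A' (sq (mov s.+3 s.+2) (prim (Inc s.+1))).
exists (sq A (sq (wh (prim (Dec s)) body) (sq (zero s.+1) (mov s.+2 s)))),
  (fun m => T m + (T m * (1 + (T' (m + T m) + (T' (m + T m) * 2 + 2 + 1))) + 2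
    + (T m * 2 + 2 + (T m * T' (m + T m) * 2 + 2)))).
split; first by solve_poly.
move=> y σ o m h1 h2 h3; have [b1 b2] := HA y σ o m h1 h2 h3.
rewrite [(_, _).1]/= [(_, _).2]/=; set n := F _ in b1 b2 *; set M' := T' _.
pose g v := G (y, v :: map σ ρ).
pose S k : store :=
  (upd (upd (upd σ s (n - k)) s.+1 k) s.+2 (\sum_(0 <= v < k) g v), o).
have HS k v : k < n -> let σ' := upd (S k).1 s v in
    g k <= M' /\ ev A' y (σ', o) M' true (upd σ' s.+3 (g k), o).
  move=> lt σ'.
  have Em : map σ' ρ = map σ ρ.
    by rewrite /σ' /= !map_upd //; apply: all_lt_le Hs; lia.
  have E1 : σ' s.+1 = k by rewrite /σ' /= /upd; repeat case: eqP => ?; lia.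
  have [||| ] := HA' y σ' o (m + T m); rewrite /= ?E1 ?Em //.
  + by move=> i hi; rewrite /σ' /= /upd; repeat (case: eqP => ?; first lia); apply: h1; lia.
  + by lia.
  apply/andP; split; first by lia.
  by rewrite /σ' /= !all_upd_le ?(all_le_trans _ h3) ?leq_addr //; apply: all_lt_le Hs; lia.
have hg k : k < n -> g k <= M' by move=> lt; have [] := HS k 0 lt.
have hsum k : k <= n -> \sum_(0 <= v < k) g v <= k * M'.
  elim: k => [|k IH] lk; first by rewrite big_nil.
  by rewrite big_nat_recr //= mulSn addnC leq_add ?hg ?IH // ltnW.
have hn := hsum n (leqnn _).
rewrite -[\sum_(0 <= v < n) G _]/(\sum_(0 <= v < n) g v).
have hn2 : n * M' <= T m * M' by rewrite leq_mul2r b1 orbT.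
have b3 : n * (1 + (M' + (M' * 2 + 2 + 1))) <= T m * (1 + (M' + (M' * 2 + 2 + 1))).
  by rewrite leq_mul2r b1 orbT.
split; first by lia.
apply: ev_sq b2 _.
have ES0 : (upd σ s n, o) = S 0.
  by rewrite /S big_nil subn0; congr (_, _); upd_ext; rewrite h1 //; lia.
rewrite ES0; apply: (@ev_sq _ _ _ _ _ (S n)).
  apply: (@ev_le _ _ _ (n * (1 + (M' + (M' * 2 + 2 + 1))) + 2)); first by rewrite leq_add2r.
  apply: ev_for => [i le|i lt]; first by rewrite /= /upd; repeat case: eqP => ?; lia.
  have [c1 c2] := HS i (n - i.+1) lt.
  apply: ev_sq c2 _.
  set σ' := upd _ s.+3 _.
  have e3 : σ' s.+3 = g i by rewrite /σ' /upd eqxx.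
  have e2 : σ' s.+2 = \sum_(0 <= v < i) g v.
    by rewrite /σ' /= /upd; repeat case: eqP => ?; lia.
  have e1 : σ' s.+1 = i by rewrite /σ' /= /upd; repeat case: eqP => ?; lia.
  have Hm := @ev_mov y σ' o s.+3 s.+2; rewrite e3 e2 in Hm.
  apply: (@ev_sq _ _ _ _ (M' * 2 + 2)); first by apply: ev_le (Hm _); lia.
  apply: ev_prim => /=; congr (_, (_, _)).
  rewrite big_nat_recr //=.
  apply: functional_extensionality => j; rewrite /σ' /= /upd.
  by repeat (case: eqP => ?; try (exfalso; lia)); first [done | lia | rewrite h1; lia].
have e1 : (S n).1 s.+1 = n by rewrite /= /upd; repeat case: eqP => ?; lia.
have Hz := ev_zero y (S n).1 o s.+1; rewrite e1 in Hz.
apply: (@ev_sq _ _ _ _ (T m * 2 + 2)); first by apply: ev_le Hz; lia.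
set σ' := upd _ s.+1 0.
have e2 : σ' s.+2 = \sum_(0 <= v < n) g v.
  by rewrite /σ' /= /upd; repeat case: eqP => ?; lia.
have e3 : σ' s = 0 by rewrite /σ' /= /upd; repeat case: eqP => ?; lia.
have Hm := @ev_mov y σ' o s.+2 s; rewrite e3 e2 in Hm.
have -> : upd σ s (\sum_(0 <= v < n) g v) =
   upd (upd σ' s (0 + \sum_(0 <= v < n) g v)) s.+2 0.
  apply: functional_extensionality => j; rewrite /σ' /= /upd.
  by repeat (case: eqP => ?; try (exfalso; lia)); first [done | lia | rewrite h1; lia].
by apply: ev_le (Hm _); lia.
Qed.

Definition exb n (P : nat -> bool) := has P (iota 0 n).
Definition allb n (P : nat -> bool) := all P (iota 0 n).

Lemma exbP n (P : nat -> bool) : reflect (exists2 i, i < n & P i) (exb n P).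
Proof.
apply: (iffP hasP) => -[i]; first by rewrite mem_iota => /andP[_ ?] ?; exists i.
by move=> ? ?; exists i; rewrite ?mem_iota.
Qed.

Lemma allbP n (P : nat -> bool) : reflect (forall i, i < n -> P i) (allb n P).
Proof.
apply: (iffP allP) => H i; first by move=> ?; apply: H; rewrite mem_iota.
by rewrite mem_iota => /andP[_ ?]; apply: H.
Qed.

Lemma dT_sum' F (G : nat -> ctx -> nat) : dT F ->
  dT (fun c => G (head 0 c.2) (c.1, behead c.2)) ->
  dT (fun c => \sum_(0 <= v < F c) G v c).
Proof. by move=> HF HG; apply: eq_dT (dT_sum HF HG) => -[y e]. Qed.

Lemma dT_mul F G : dT F -> dT G -> dT (fun c => F c * G c).
Proof.
move=> HF HG; apply: eq_dT (dT_sum' HF (G := fun _ => G) _); last exact: dT_tl HG.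
by move=> c; rewrite sum_nat_const_nat subn0.
Qed.

Lemma dT_exp F k : dT F -> dT (fun c => F c ^ k).
Proof.
move=> HF; elim: k => [|k IH]; first exact: dT_cst.
by apply: eq_dT (dT_mul HF IH) => c; rewrite expnS.
Qed.

Lemma dB_not P : dB P -> dB (fun c => ~~ P c).
Proof. by move=> H; apply: eq_dT (dT_sub (dT_cst 1) H) => c; case: (P c). Qed.

Lemma dB_and P Q : dB P -> dB Q -> dB (fun c => P c && Q c).
Proof. by move=> H1 H2; apply: eq_dT (dT_mul H1 H2) => c; rewrite mulnb. Qed.

Lemma dB_or P Q : dB P -> dB Q -> dB (fun c => P c || Q c).
Proof.
move=> /dB_not H1 /dB_not H2; apply: eq_dT (dB_not (dB_and H1 H2)) => c.
by rewrite negb_and !negbK.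
Qed.

Lemma dB_imp P Q : dB P -> dB Q -> dB (fun c => P c ==> Q c).
Proof.
by move=> /dB_not H1 H2; apply: eq_dT (dB_or H1 H2) => c; rewrite implybE.
Qed.

Lemma dB_iff P Q : dB P -> dB Q -> dB (fun c => P c == Q c).
Proof.
move=> H1 H2; apply: eq_dT (dB_and (dB_imp H1 H2) (dB_imp H2 H1)) => c.
by case: (P c); case: (Q c).
Qed.

Lemma dB_leq F G : dT F -> dT G -> dB (fun c => F c <= G c).
Proof.
move=> H1 H2; apply: eq_dT (dT_sub (dT_cst 1) (dT_sub H1 H2)) => c.
by rewrite /leq; case: (F c - G c).
Qed.

Lemma dB_eq F G : dT F -> dT G -> dB (fun c => F c == G c :> nat).
Proof.
by move=> H1 H2; apply: eq_dT (dB_and (dB_leq H1 H2) (dB_leq H2 H1)) => c; rewrite eqn_leq.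
Qed.

Lemma dB_ex F (P : nat -> ctx -> bool) : dT F ->
  dB (fun c => P (head 0 c.2) (c.1, behead c.2)) -> dB (fun c => exb (F c) (P^~ c)).
Proof.
move=> HF HP; apply: eq_dT (dB_leq (dT_cst 1) (dT_sum' HF (G := fun v c => P v c) HP)) => c.
congr nat_of_bool; rewrite /exb -[in iota _ _](subn0 (F c)) -/(index_iota 0 _).
elim: (index_iota _ _) => [|v s IH]; first by rewrite big_nil.
by rewrite big_cons /= -IH; case: (P v c).
Qed.

Lemma dB_all F (P : nat -> ctx -> bool) : dT F ->
  dB (fun c => P (head 0 c.2) (c.1, behead c.2)) -> dB (fun c => allb (F c) (P^~ c)).
Proof.
move=> HF HP; apply: eq_dT (dB_not (dB_ex HF (P := fun v c => ~~ P v c) (dB_not HP))) => c.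
congr nat_of_bool; rewrite /exb /allb -[in RHS](negbK (all _ _)) -has_predC.
by congr negb; apply: eq_has.
Qed.

Lemma dB_cst b : dB (fun=> b).
Proof. exact: dT_cst. Qed.

Lemma dT_if P F G : dB P -> dT F -> dT G -> dT (fun c => if P c then F c else G c).
Proof.
move=> H1 H2 H3; apply: eq_dT (dT_add (dT_mul H1 H2) (dT_mul (dB_not H1) H3)) => c.
by case: (P c); rewrite ?mul1n ?mul0n ?addn0.
Qed.

(** The quotient is the number of [v] with [v.+1 * G c <= F c]; the factor [1 <= G c] reproduces the
    convention that division by zero gives zero. *)
Lemma dT_div F G : dT F -> dT G -> dT (fun c => F c %/ G c).
Proof.
move=> HF HG.
have H : dT (fun c => \sum_(0 <= v < F c) ((v.+1 * G c <= F c) : nat)).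
  apply: (dT_sum' (G := fun v c => ((v.+1 * G c <= F c) : nat))) => //.
  by apply: dB_leq (dT_mul (dTS dT_hd) (dT_tl HG)) (dT_tl HF).
apply: eq_dT (dT_mul (dB_leq (dT_cst 1) HG) H) => c.
case: (posnP (G c)) => [->|g0]; first by rewrite divn0.
rewrite mul1n; under eq_bigr => v _ do rewrite -leq_divRL //.
have : F c %/ G c <= F c := leq_div _ _.
move: (_ %/ _) => q; move: (F c) => n le.
suff -> : \sum_(0 <= v < n) (v < q) = minn n q by lia.
elim: n {le} => [|n IH]; first by rewrite big_nil min0n.
by rewrite big_nat_recr //= IH; lia.
Qed.

Lemma dT_mod F G : dT F -> dT G -> dT (fun c => F c %% G c).
Proof.
move=> H1 H2; apply: eq_dT (dT_sub H1 (dT_mul (dT_div H1 H2) H2)) => c.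
by rewrite {1}(divn_eq (F c) (G c)) addKn.
Qed.

(** From 2 on, [n + 2 <= n ^ 2] makes the exponent [k.*2] sufficient; for smaller [n] the bound is
    at most [3 ^ k], which the additive part of [poly_bound] covers. *)
Lemma poly_bound_poly T : poly T -> exists k, forall n, T n <= poly_bound k n.
Proof.
move=> [k H]; exists (k.*2 + 3 ^ k) => n; apply: leq_trans (H n) _; rewrite /poly_bound.
have [n2|n2] := leqP 2 n.
  apply: leq_trans (leq_addr _ _); rewrite expnD -mul2n expnM.
  apply: leq_trans (leq_pmulr _ _); last by rewrite expn_gt0; lia.
  by case: k {H} => // k; rewrite leq_exp2r //; nia.
apply: leq_trans (_ : 3 ^ k <= _); last by lia.
by case: k {H} => // k; rewrite leq_exp2r //; lia.
Qed.

Lemma poly_sim T : poly T -> poly (fun m => T m * ((T m).*2 + 5) + 1).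
Proof.
move=> H; have [k Hk] : poly (fun m => T m * (T m * 2 + 5) + 1) by solve_poly.
by exists k => m; rewrite -muln2; apply: Hk.
Qed.

Lemma dB_in_P (P : ctx -> bool) (L : language) :
  dB P -> (forall x, L x <-> P (x, [::])) -> in_P L.
Proof.
move=> HP HL; have [A [T [pT HA]]] := HP [::] 0 isT.
(* The truth value is left in register 0 as 0 or 1; the decrement turns it into the exit code, which
   decides acceptance. *)
pose D := sq A (prim (Dec 0)).
have pT1 : poly (fun m => T m + 1) by solve_poly.
have [k Hk] := poly_bound_poly (poly_sim pT1).
exists (simTM D), k => x; move: (poly_bound k (size x)) (Hk (size x)) => n Hn.
have [_ H1] := HA x (fun=> 0) [::] (size x) (fun _ _ => erefl) (leqnn _) isT.
have [s' [t le E]] : exists s', ev D x (fun=> 0, [::]) (T (size x) + 1) (P (x, [::])) s'.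
  case E: (P (x, [::])) H1 => /= H1.
    exists (upd (upd (fun=> 0) 0 1) 0 0, [::]); apply: ev_sq H1 _.
    exact: ev_prim.
  exists (upd (fun=> 0) 0 0, [::]); apply: ev_sq H1 _.
  exact: ev_prim.
have [|h1 h2 _] := sim_correct E (n := n); first by apply: leq_trans Hn; nia.
by split=> //; rewrite h2 HL.
Qed.

(** A reduction only needs a definable length and definable bits. Register 0 counts the remaining
    bits, register 1 is the index, register 2 receives the current bit and is cleared by the test
    that emits it. *)
Lemma poly_computable_mkseq (N : ctx -> nat) (P : ctx -> bool) : dT N -> dB P ->
  poly_computable (fun x => mkseq (fun v => P (x, [:: v])) (N (x, [::]))).
Proof.
move=> HN HP; have [A [T [pT HA]]] := HN [::] 0 isT.
have [A' [T' [pT' HA']]] := HP [:: 1] 2 isT.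
pose body := sq A' (sq (ite (prim (Dec 2)) (prim (Emit true)) (prim (Emit false))) (prim (Inc 1))).
pose D := sq A (wh (prim (Dec 0)) body).
pose TT m := T m + (T m * (1 + (T' (m + T m) + (1 + 1 + 1))) + 2).
have pT1 : poly TT by rewrite /TT; solve_poly.
have [k Hk] := poly_bound_poly (poly_sim pT1).
exists (simTM D), k => x; move: (poly_bound k (size x)) (Hk (size x)) => B HB.
have [hn H1] := HA x (fun=> 0) [::] (size x) (fun _ _ => erefl) (leqnn _) isT.
move: hn H1; rewrite [map _ _]/=; set n := N _ => hn H1.
set m := size x in hn H1 HB *.
pose S i : store := (upd (upd (fun=> 0) 0 (n - i)) 1 i, mkseq (fun v => P (x, [:: v])) i).
have [t le E] : ev D x (fun=> 0, [::]) (TT m) true (S n).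
  apply: ev_sq H1 _.
  have -> : (upd (fun=> 0) 0 n, [::]) = S 0 by rewrite /S subn0; congr (_, _); upd_ext.
  apply: (@ev_le _ _ _ (n * (1 + (T' (m + T m) + (1 + 1 + 1))) + 2)).
    by rewrite leq_add2r leq_mul2r hn orbT.
  apply: ev_for => [i lei|i lt]; first by rewrite /= /upd.
  have := HA' x (upd (S i).1 0 (n - i.+1)) (S i).2 (m + T m).
  rewrite /= andbT.
  have -> : upd (upd (upd (fun=> 0) 0 (n - i)) 1 i) 0 (n - i.+1) 1 = i by [].
  case=> [[|[|j]] // _|||_ H2]; rewrite -/m; [lia | lia | ].
  apply: ev_sq H2 _; apply: (@ev_sq _ _ _ _ _ (upd (S i).1 0 (n - i.+1), (S i.+1).2)).
    apply: (@ev_ite _ _ _ _ _ 1 (P (x, [:: i])) (upd (S i).1 0 (n - i.+1), (S i).2)).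
      apply: ev_prim; rewrite /= upd_eq; case: (P _) => /=; congr (_, (_, _));
      by apply: functional_extensionality => j; rewrite /upd; case: j => [|[|[|j]]].
    by case E: (P _); apply: ev_prim; rewrite /= mkseqS E.
  apply: ev_prim => /=; congr (_, (_, _)).
  by apply: functional_extensionality => j; rewrite /upd; case: j => [|[|[|j]]].
have [|h1 _ h2] := sim_correct E (n := B); first by apply: leq_trans HB; nia.
by split; [exact: h1 | exact: h2].
Qed.

(** * Paths with at most one bend *)

Local Notation edge0 := ((0%R, 0%R, true) : gedge).

Definition gedg (h : bool) (c x : int) : gedge := if h then (x, c, true) else (c, x, false).

Lemma gedgE (e : gedge) : exists c x, e = gedg e.2 c x.
Proof. by case: e => [[a b] []]; [exists b, a | exists a, b]. Qed.

Lemma shared_same h c x c' x' :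
  shared_pts (gedg h c x) (gedg h c' x') =
  if c != c' then 0 else (x == x').*2 + (x == x' + 1)%R + (x + 1 == x')%R :> nat.
Proof.
by rewrite /shared_pts /gedg; case: h; rewrite /= !inE !xpair_eqE /=; repeat case: eqP => ? /=; lia.
Qed.

Lemma shared_diff h c x c' x' :
  shared_pts (gedg h c x) (gedg (~~ h) c' x') =
  (((c == x') || (c == x' + 1)%R) && ((c' == x) || (c' == x + 1)%R)) :> nat.
Proof.
by rewrite /shared_pts /gedg; case: h; rewrite /= !inE !xpair_eqE /=; repeat case: eqP => ? /=; lia.
Qed.

Definition pathf (e : nat -> gedge) n := forall i j, i < j -> j < n ->
  shared_pts (e i) (e j) = (if j == i.+1 then 1 else 0).

Definition run h (c a : int) (d : bool) i := gedg h c (if d then a + i%:Z else a - i%:Z)%R.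

(** The first two edges fix the sense of travel; turning back is impossible since edges at distance
    two along the path share no point. A single edge has no sense of its own and is given the
    increasing one. *)
Lemma pathf_straight e n h : pathf e n -> (forall i, i < n -> (e i).2 = h) -> 0 < n ->
  exists c a d, forall i, i < n -> e i = run h c a d i.
Proof.
move=> He Hh n0; have [c [a E0]] := gedgE (e 0); rewrite Hh // in E0.
have [n1|n1] := leqP n 1.
  exists c, a, true => i lt; have -> : i = 0 by lia.
  by rewrite E0 /run /= GRing.addr0.
have [c1 [a1 E1]] := gedgE (e 1); rewrite Hh // in E1.
have := He 0 1 isT n1; rewrite E0 E1 shared_same; case: (eqVneq c c1) => //= Ec Hs.
exists c, a, (a1 == a + 1)%R; set d := (a1 == _).
have Ed : a1 = (if d then a + 1 else a - 1)%R by rewrite /d; move: Hs; repeat case: eqP => ? /=;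
  lia.
suff: forall i, i.+1 < n -> e i = run h c a d i /\ e i.+1 = run h c a d i.+1.
  move=> H [_|i lt]; first by have [] := H 0 n1.
  by have [] := H i lt.
elim=> [_|i IH lt].
  by rewrite E0 E1 -Ec /run Ed; split; congr gedg; case: (d); lia.
have [IH1 IH2] := IH (ltnW lt); split=> //.
have [c2 [a2 E2]] := gedgE (e i.+2); rewrite Hh // in E2.
have := He i.+1 i.+2 (leqnn _) lt; have := He i i.+2 (leqnSn _) lt.
rewrite E2 IH1 IH2 /run !shared_same eqxx.
case: (eqVneq c c2) => [<-|] //=; have -> : i.+2 == i.+1 = false by lia.
by move=> A B; congr gedg; move: A B; case: (d); repeat case: eqP => ? /=; lia.
Qed.

Lemma run_mem h c a d n h' c' x : reflect (exists2 i, i < n & gedg h' c' x = run h c a d i)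
  [&& h' == h, c' == c & (if d then a <= x < a + n%:Z else a - n%:Z < x <= a)%R].
Proof.
apply: (iffP and3P) => [[/eqP-> /eqP-> H]|[i lt]].
  exists (absz (x - a)); first by move: H; case: d; lia.
  by rewrite /run; congr gedg; move: H; case: d; lia.
by rewrite /run /gedg; case: h; case: h' => // -[-> ->]; rewrite !eqxx; split=> //; case: d; lia.
Qed.

Definition dir_changes (ds : seq bool) := count (fun ab => ab.1 != ab.2) (zip ds (behead ds)).

Lemma bends_dirs s : bends s = dir_changes (map snd s).
Proof. by elim: s => [|e [|f s] IH] //=; rewrite /bends /dir_changes /= -/(bends _) IH. Qed.

Lemma dir_changes_nseq p q h : dir_changes (nseq p h ++ nseq q (~~ h)) <= 1.
Proof.
have H n b : dir_changes (nseq n b) = 0.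
  by case: n => // n; elim: n => // n; rewrite /dir_changes /= eqxx.
elim: p => [|p IH]; first by rewrite H.
case: p IH => [|p] IH; last by move: IH; rewrite /dir_changes /= eqxx.
by case: q {IH} => [|q] //=; have := H q.+1 (~~ h); rewrite /dir_changes /= => ->; case: h.
Qed.

Lemma dir_changes_le1 ds : 0 < size ds -> dir_changes ds <= 1 ->
  exists p q h, 0 < p /\ ds = nseq p h ++ nseq q (~~ h).
Proof.
have H0 b t : dir_changes (b :: t) = 0 -> b :: t = nseq (size t).+1 b.
  elim: t b => [|b' t IH] b //=; rewrite /dir_changes /= => /eqP.
  rewrite addn_eq0 => /andP[Hb /eqP/IH E]; rewrite E.
  by have -> : b = b' by case: (b =P b') Hb.
case: ds => // b t _; elim: t b => [|b' t IH] b; first by exists 1, 0, b.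
rewrite /dir_changes /= -/(dir_changes (b' :: t)); case: eqP => [->|ne] /= H.
  have [p [q [h [p0 E]]]] := IH b' H; exists p.+1, q, h; split=> //=; rewrite E.
  by congr cons; case: p p0 E => // p _ [].
have Eb : b' = ~~ b by case: b b' ne {H} => [] [].
exists 1, (size t).+1, b; split=> //.
have D0 : dir_changes (b' :: t) = 0 by move: H; case: (dir_changes _).
by rewrite (H0 _ _ D0) Eb.
Qed.

(** The corner is the far end of the first run and the near end of the second. A run of one edge may
    be attached at either end, because its flag [d] was chosen arbitrarily; this is the alternative
    [p = 1] or [q = 1]. *)
Lemma path_runs s : is_grid_path s -> bends s <= 1 ->
  exists h c a d p c' a' d' q, [/\ 0 < p,
    forall k z x, (gedg k z x \in s) =
      [&& k == h, z == c & (if d then a <= x < a + p%:Z else a - p%:Z < x <= a)%R] ||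
      [&& k == ~~ h, z == c' & (if d' then a' <= x < a' + q%:Z else a' - q%:Z < x <= a')%R] &
    0 < q -> (c' == (if d then a + p%:Z else a - p%:Z + 1) \/
              p = 1%N /\ c' = (if d then a else a + 1))%R /\
             (c == (if d' then a' else a' + 1) \/
              q = 1%N /\ c = (if d' then a' + 1 else a'))%R ].
Proof.
case=> s0 _ Hp; rewrite bends_dirs => /dir_changes_le1; rewrite size_map => /(_ s0).
case=> p [q [h [p0 Ed]]].
have Es : size s = p + q by rewrite -(size_map snd) Ed size_cat !size_nseq.
set e := nth edge0 s in Hp.
have Edir i : i < p + q -> (e i).2 = if i < p then h else ~~ h.
  move=> lt; rewrite -(nth_map _ true) ?Es // Ed nth_cat size_nseq !nth_nseq.
  by case: (ltnP i p) => pi //; case: ifP => //; lia.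
have [||c [a [d H1]]] := @pathf_straight e p h _ _ p0.
- by move=> i j ij jp; apply: Hp => //; rewrite Es; lia.
- by move=> i ip; rewrite Edir ?ip //; lia.
have [c' [a' [d' H2]]] : exists c' a' d', forall i, i < q -> e (p + i) = run (~~ h) c' a' d' i.
  have [->|q0] := posnP q; first by exists 0%R, 0%R, true.
  apply: (@pathf_straight (fun i => e (p + i)) q) => //.
    by move=> i j ij jq; rewrite Hp ?Es ?ltn_add2l // -addnS eqn_add2l.
  by move=> i iq; rewrite Edir ?ltn_add2l // ltnNge leq_addr.
exists h, c, a, d, p, c', a', d', q; split=> //.
  move=> k z x; apply/(nthP edge0)/orP => [[i lt Ei]|]; last first.
    case=> /run_mem [i lt ->]; [exists i; [by rewrite Es; lia | exact: H1] | exists (p + i);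
      [by rewrite Es; lia | exact: H2]].
  rewrite Es in lt; have [ip|pi] := ltnP i p.
    by left; apply/run_mem; exists i; rewrite // -H1.
  right; apply/run_mem; exists (i - p); first by lia.
  by rewrite -H2 ?subnKC //; lia.
move=> q0.
have Hc : shared_pts (run h c a d p.-1) (run (~~ h) c' a' d' 0) = 1.
  by rewrite -H1 -?H2 ?Hp ?Es ?addn0 ?prednK ?eqxx //; lia.
(* Edges next to the corner edges miss the other run. In a run of at least two edges this excludes
   the wrong end as the corner. *)
have Hc1 : 1 < p -> shared_pts (run h c a d p.-2) (run (~~ h) c' a' d' 0) = 0.
  move=> p1; rewrite -H1 -?H2 ?Hp ?Es ?addn0 //; try lia.
  by case: eqP => //; lia.
have Hc2 : 1 < q -> shared_pts (run h c a d p.-1) (run (~~ h) c' a' d' 1) = 0.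
  move=> p1; rewrite -H1 -?H2 ?Hp ?Es //; try lia.
  by case: eqP => //; lia.
move: Hc Hc1 Hc2; rewrite /run !shared_diff; case: (d); case: (d'); lia.
Qed.

(* A path with at most one bend is a horizontal segment [σ true] and a vertical segment
   [σ false], each given as (line, start, end) and possibly empty. *)
Definition shape := bool -> int * int * int.

Definition ln (σ : shape) h := (σ h).1.1.
Definition lo (σ : shape) h := (σ h).1.2.
Definition hi (σ : shape) h := (σ h).2.

(** The corner of two nonempty segments is the crossing of their lines and has to be an end of both,
    so the line of each passes through an end of the other. *)
Definition valid (σ : shape) : bool :=
  ((lo σ true < hi σ true)%R || (lo σ false < hi σ false)%R) &&
  ((lo σ true < hi σ true)%R ==> (lo σ false < hi σ false)%R ==>
   [&& (ln σ false == lo σ true) || (ln σ false == hi σ true) &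
       (ln σ true == lo σ false) || (ln σ true == hi σ false)]).

Definition ins (σ : shape) h (c x : int) := (c == ln σ h) && (lo σ h <= x < hi σ h)%R.

Lemma path_shape s : is_grid_path s -> bends s <= 1 ->
  exists2 σ, valid σ & forall h c x, (gedg h c x \in s) = ins σ h c x.
Proof.
move=> Hs Hb; have [h [c [a [d [p [c' [a' [d' [q [p0 Hin Hc]]]]]]]]]] := path_runs Hs Hb.
exists (fun k => if k == h then (c, if d then a else a - p%:Z + 1, if d then a + p%:Z else a + 1)
  else (c', if d' then a' else a' - q%:Z + 1, if d' then a' + q%:Z else a' + 1))%R.
  move: Hc; rewrite /valid /ln /lo /hi /=.
  by case: (h); case: (d); case: (d') => /=; lia.
move=> k z x; rewrite Hin /ins /ln /lo /hi.
by case: (k); case: (h) => /=; case: (d); case: (d') => /=; lia.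
Qed.

Lemma shared_eq e : shared_pts e e = 2.
Proof. by have [c [x ->]] := gedgE e; rewrite shared_same !eqxx /=; lia. Qed.

(** The horizontal segment is walked towards the corner and the vertical one away from it; [d] and
    [d'] record the resulting senses of travel. *)
Lemma shape_path σ : valid σ ->
  exists s, [/\ is_grid_path s, bends s <= 1 & forall h c x, (gedg h c x \in s) = ins σ h c x].
Proof.
move=> Hv.
pose len h := if (lo σ h < hi σ h)%R then absz (hi σ h - lo σ h) else 0.
pose d := (ln σ false == hi σ true); pose d' := (ln σ true == lo σ false).
pose p := len true; pose q := len false.
pose a (d : bool) h := if d then lo σ h else (hi σ h - 1)%R.
pose e i := if i < p then run true (ln σ true) (a d true) d i
            else run false (ln σ false) (a d' false) d' (i - p).
have He : pathf e (p + q).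
  move=> i j ij jn; rewrite /e; case: (ltnP j p) => jp.
    rewrite (ltn_trans ij jp) /run shared_same eqxx /=.
    by case: (d); repeat case: eqP => ? /=; lia.
  case: (ltnP i p) => ip; last first.
    rewrite /run shared_same eqxx /=.
    by case: (d'); repeat case: eqP => ? /=; lia.
  rewrite /run shared_diff; move: Hv jn ip jp; rewrite /valid /p /q /len /a /d /d'.
  case: ifP => h1; case: ifP => h2 /=;
  case: (eqVneq (ln σ false) (hi σ true)) => ?; case: (eqVneq (ln σ true) (lo σ false)) => ? /=;
  repeat case: eqP => ? /=; lia.
have mem e1 : reflect (exists2 i, i < p + q & e i = e1) (e1 \in mkseq e (p + q)).
  apply: (iffP mapP) => -[i]; rewrite ?mem_iota => lt; first by move->; exists i.
  by move=> <-; exists i; rewrite ?mem_iota.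
exists (mkseq e (p + q)); split.
- split; rewrite ?size_mkseq.
  + by move: Hv; rewrite /valid /p /q /len; case: ifP => ?; case: ifP => ?; lia.
  (* A repeated edge would share two points with itself, while the path condition allows at most
     one. *)
  + apply/mkseq_uniqP => i j; rewrite !inE => ilt jlt E.
    have F := shared_eq (e j).
    case: (ltngtP i j) => // ij; [move: (He _ _ ij jlt)|move: (He _ _ ij ilt)];
      by rewrite E F; case: ifP.
  + by move=> i j ij jn; rewrite !nth_mkseq ?He //; lia.
- have -> : bends (mkseq e (p + q)) = dir_changes (nseq p true ++ nseq q (~~ true)).
    rewrite bends_dirs; congr dir_changes; apply: (@eq_from_nth _ true).
      by rewrite size_map size_mkseq size_cat !size_nseq.
    move=> i; rewrite size_map size_mkseq => lt.
    rewrite (nth_map edge0) ?size_mkseq // nth_mkseq // nth_cat size_nseq !nth_nseq /e.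
    case: ltnP => // ip; have -> : i - p < q by lia.
    by [].
  exact: dir_changes_nseq.
move=> h c x.
have -> : (gedg h c x \in mkseq e (p + q)) =
   [&& h == true, c == ln σ true & (if d then a d true <= x < a d true + p%:Z
          else a d true - p%:Z < x <= a d true)%R] ||
   [&& h == false, c == ln σ false & (if d' then a d' false <= x < a d' false + q%:Z
          else a d' false - q%:Z < x <= a d' false)%R].
  apply/mem/orP => [[i lt]|].
    rewrite /e; case: ltnP => ip E; [left|right]; apply/run_mem; first by exists i.
    by exists (i - p) => //; lia.
  case=> /run_mem [i lt ->]; first by exists i; rewrite /e ?lt //; lia.
  by exists (p + i); rewrite /e ?ltn_add2l // ltnNge leq_addr addKn.
rewrite /ins /a /p /q /len; case: (h); case: (d); case: (d') => /=; case: ifP; lia.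
Qed.

Definition meets (σ τ : shape) := exists h c x, ins σ h c x /\ ins τ h c x.

Definition shape_rep n (adj : rel 'I_n) (σ : 'I_n -> shape) :=
  [/\ forall v, valid (σ v),
      forall u v, u != v -> (adj u v <-> meets (σ u) (σ v)) &
      forall S : {set 'I_n}, (forall u v, u \in S -> v \in S -> meets (σ u) (σ v)) ->
        exists h c x, forall u, u \in S -> ins (σ u) h c x].

(** Adjacency and the Helly condition depend only on the edge sets of the paths, so each path may be
    replaced by its pair of segments. *)
Lemma shape_repP n (adj : rel 'I_n) : has_Helly_B1_EPG adj <-> exists σ, shape_rep adj σ.
Proof.
have corr (P : 'I_n -> seq gedge) σ : (forall v h c x, (gedg h c x \in P v) = ins (σ v) h c x) ->
    (forall u v, edge_intersect (P u) (P v) <-> meets (σ u) (σ v)) /\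
    (forall S : {set 'I_n}, (exists g, forall u, u \in S -> g \in P u) <->
       exists h c x, forall u, u \in S -> ins (σ u) h c x).
  move=> H; split=> [u v|S]; split.
  - move/hasP => [e]; have [c [x ->]] := gedgE e; rewrite !H => ? ?.
    by exists e.2, c, x.
  - by move=> [h [c [x [? ?]]]]; apply/hasP; exists (gedg h c x); rewrite H.
  - move=> [e]; have [c [x ->]] := gedgE e => He.
    by exists e.2, c, x => u /He; rewrite H.
  - by move=> [h [c [x He]]]; exists (gedg h c x) => u /He; rewrite H.
split.
  case=> P [[[Hp Ha] Hb] HH].
  have /fin_all_exists2 [σ Hv Hin] : forall v, exists2 σ, valid σ & forall h c x,
      (gedg h c x \in P v) = ins σ h c x.
    by move=> v; apply: path_shape.
  have [C1 C2] := corr P σ Hin.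
  exists σ; split=> // [u v uv|S HS]; first by rewrite Ha ?C1.
  by apply/C2; apply: HH => u v uS vS; apply/C1; apply: HS.
case=> σ [Hv Ha HH].
have /fin_all_exists [P HP] : forall v, exists s, [/\ is_grid_path s, bends s <= 1 &
    forall h c x, (gedg h c x \in s) = ins (σ v) h c x].
  by move=> v; apply: shape_path.
have [|C1 C2] := corr P σ; first by move=> v; have [] := HP v.
exists P; split; last by move=> S HS; apply/C2; apply: HH => u v uS vS; apply/C1; apply: HS.
split; last by move=> v; have [] := HP v.
split=> [v|u v uv]; first by have [] := HP v.
by rewrite Ha ?C1.
Qed.

(** * The gadget graph of a not-all-equal instance *)

Definition ovl (σ τ : shape) h : bool :=
  [&& ln σ h == ln τ h, (lo σ h < hi τ h)%R, (lo τ h < hi σ h)%R,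
      (lo σ h < hi σ h)%R & (lo τ h < hi τ h)%R].

(** Lines are not compared, as containment is always used together with [ovl], which makes them
    equal. *)
Definition cont (σ τ : shape) h : bool := (lo τ h <= lo σ h)%R && (hi σ h <= hi τ h)%R.

Lemma meets_ovl σ τ : meets σ τ <-> ovl σ τ true || ovl σ τ false.
Proof.
split.
  by move=> [[] [c [x]]]; rewrite /ins /ovl => -[A B]; apply/orP; [left|right]; lia.
move=> H; have [h] : exists h, ovl σ τ h by case/orP: H => H; [exists true|exists false].
rewrite /ovl => E; exists h, (ln σ h), (if (lo σ h < lo τ h)%R then lo τ h else lo σ h).
by rewrite /ins; split; case: ifP => ?; lia.
Qed.

Lemma ovlC σ τ h : ovl σ τ h = ovl τ σ h.
Proof. by rewrite /ovl; lia. Qed.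

Lemma ovl_cont σ τ υ h : ovl σ τ h -> ovl τ υ h -> cont τ υ h -> ovl σ υ h.
Proof. by rewrite /ovl /cont; lia. Qed.

(* A segment has only two ends to stick out of. *)
Lemma three_ovl σ1 σ2 σ3 τ h : ovl σ1 τ h -> ovl σ2 τ h -> ovl σ3 τ h ->
  ~~ ovl σ1 σ2 h -> ~~ ovl σ1 σ3 h -> ~~ ovl σ2 σ3 h ->
  [|| cont σ1 τ h, cont σ2 τ h | cont σ3 τ h].
Proof. by rewrite /ovl /cont; lia. Qed.

Lemma card_le2 (T : finType) (A : {set T}) :
  (forall a b c, a \in A -> b \in A -> c \in A -> a != b -> a != c -> b != c -> False) ->
  #|A| <= 2.
Proof.
move=> H; rewrite leqNgt; apply/negP => /card_gt2P [a [b [c [[aA bA cA] [ab bc ca]]]]].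
by apply: (H a b c) => //; rewrite eq_sym.
Qed.

(** This settles the Helly condition for triangle-free graphs, where pairwise intersecting families
    have at most two members, and is also the base case of [gilmore]. *)
Lemma helly_card_le2 (T : finType) (E : Type) (P : T -> E -> Prop) (S : {set T}) (e0 : E) :
  #|S| <= 2 -> (forall u v, u \in S -> v \in S -> exists e, P u e /\ P v e) ->
  exists e, forall u, u \in S -> P u e.
Proof.
move=> S2 HS; have [->|[a aS]] := set_0Vmem S; first by exists e0 => u; rewrite inE.
have [E0|[b]] := set_0Vmem (S :\ a).
  have [e [He _]] := HS a a aS aS; exists e => u uS.
  have [->//|ua] := eqVneq u a; suff : u \in set0 by rewrite inE.
  by rewrite -E0 !inE ua.
rewrite !inE => /andP[ba bS]; have [e [h1 h2]] := HS a b aS bS.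
exists e => u uS; have [->//|ua] := eqVneq u a; have [->//|ub] := eqVneq u b.
have : 2 < #|S| by apply/card_gt2P; exists a, b, u; split; [split | split=> //; rewrite eq_sym].
by rewrite ltnNge S2.
Qed.

(* [Gad t a b c] is the [t]-th copy of the gadget of the variable vertices [a], [b], [c]. *)
Record gad := Gad { g_t : nat; g_a : nat; g_b : nat; g_c : nat }.

Definition gvar C m := match m with 0 => g_a C | 1 => g_b C | _ => g_c C end.

Definition gcode C := (g_t C, g_a C, g_b C, g_c C).
Definition gdecode x := let: (t, a, b, c) := x in Gad t a b c.
Lemma gcodeK : cancel gcode gdecode. Proof. by case. Qed.
HB.instance Definition _ := Equality.copy gad (can_type gcodeK).

(* The hub [Vh x] of the variable [x], its variable vertices [Vu a] with [a %/ 9 = x], and for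
   each gadget a centre [Vc], three links [Vp] from the centre to the variable vertices, and a
   pendant neighbour [Vq] of each link; [Vi] are isolated vertices. *)
Inductive vert := Vh of nat | Vu of nat | Vc of gad | Vp of gad & nat | Vq of gad & nat | Vi of nat.

Definition arc v w := match v, w with
  | Vu a, Vh x => a %/ 9 == x
  | Vp C m, Vu a => gvar C m == a
  | Vp C m, Vc C' => C == C'
  | Vq C m, Vp C' m' => (C == C') && (m == m')
  | _, _ => false
  end.

Definition vadj v w := arc v w || arc w v.

Section Instance.
Variables (N : nat) (cl : nat -> nat -> nat -> bool).

(** The vertices are required to be distinct even if the constraint repeats a variable; the drawing
    uses this to put one majority vertex before the other. *)
Definition active C :=
  [&& g_t C < 7, g_a C < 9 * N, g_b C < 9 * N, g_c C < 9 * N,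
      g_a C != g_b C, g_a C != g_c C, g_b C != g_c C &
      cl (g_a C %/ 9) (g_b C %/ 9) (g_c C %/ 9)].

Definition vok v := match v with
  | Vh x => x < N | Vu a => a < 9 * N | Vc C => active C
  | Vp C m | Vq C m => active C && (m < 3) | Vi _ => true end.

Definition nae (f : nat -> bool) := forall x y z, x < N -> y < N -> z < N -> cl x y z ->
  ~~ ((f x == f y) && (f y == f z)).

(** * From a representation to a not-all-equal assignment *)

Section Soundness.
Variable S : vert -> shape.
Hypothesis HS : forall v w, vok v -> vok w -> v <> w ->
  vadj v w = ovl (S v) (S w) true || ovl (S v) (S w) false.

Lemma nadj v w h : vok v -> vok w -> v <> w -> ~~ vadj v w -> ~~ ovl (S v) (S w) h.
Proof. by move=> Hv Hw ne; rewrite HS // negb_or => /andP[]; case: h. Qed.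

Definition good a d := ovl (S (Vu a)) (S (Vh (a %/ 9))) d && cont (S (Vu a)) (S (Vh (a %/ 9))) d.

(** The neighbours of a hub are pairwise nonadjacent, so in each direction at most two of them meet
    it without being contained. At most four of the nine are lost, and of the remaining five at
    least three are contained in the same direction. *)
Lemma goodP x : x < N -> exists d, 2 < #|[set i : 'I_9 | good (9 * x + i) d]|.
Proof.
move=> xN; have Eq9 (i : 'I_9) : (9 * x + i) %/ 9 = x by have := ltn_ord i; lia.
have ok (i : 'I_9) : vok (Vu (9 * x + i)) by have := ltn_ord i; rewrite /=; lia.
pose B d := [set i : 'I_9 | ovl (S (Vu (9 * x + i))) (S (Vh x)) d && ~~ good (9 * x + i) d].
have HB d : #|B d| <= 2.
  apply: card_le2 => a b c; rewrite !inE /good !Eq9.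
  move=> /andP[oa]; rewrite oa /= => ca /andP[ob]; rewrite ob /= => cb /andP[oc].
  rewrite oc /= => cc ab ac bc.
  have ne (i j : 'I_9) : i != j -> ~~ ovl (S (Vu (9 * x + i))) (S (Vu (9 * x + j))) d.
    by move=> ij; apply: nadj => // -[] /eqP; rewrite eqn_add2l => /eqP/val_inj E;
      rewrite E eqxx in ij.
  have := three_ovl oa ob oc (ne _ _ ab) (ne _ _ ac) (ne _ _ bc).
  by rewrite (negbTE ca) (negbTE cb) (negbTE cc).
have cov : [set: 'I_9] = [set i : 'I_9 | good (9 * x + i) true] :|:
    [set i : 'I_9 | good (9 * x + i) false] :|: (B true :|: B false).
  apply/setP => i; rewrite !inE.
  have := HS (ok i) (xN : vok (Vh x)); rewrite /vadj /= Eq9 eqxx /= => /(_ ltac:(by [])).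
  by case: (ovl _ _ true); case: (good _ true); case: (good _ false); case: (ovl _ _ false).
have := cardsT 'I_9; rewrite card_ord cov => E.
have := leq_card_setU ([set i : 'I_9 | good (9 * x + i) true] :|:
    [set i : 'I_9 | good (9 * x + i) false]) (B true :|: B false).
have := leq_card_setU [set i : 'I_9 | good (9 * x + i) true] [set i : 'I_9 | good (9 * x + i)
  false].
have := leq_card_setU (B true) (B false).
rewrite E => -[h1 _] [h2 _] [h3 _]; have := HB true; have := HB false => h4 h5.
case: (ltnP 2 #|[set i : 'I_9 | good (9 * x + i) true]|) => h; first by exists true.
by exists false; lia.
Qed.

Definition fS x := 2 < #|[set i : 'I_9 | good (9 * x + i) true]|.

Lemma fS_good x : x < N -> 2 < #|[set i : 'I_9 | good (9 * x + i) (fS x)]|.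
Proof.
move=> /goodP[d]; rewrite /fS; case: (ltnP 2 #|[set i : 'I_9 | good (9 * x + i) true]|) => // h.
by case: d => // h'; move: h; rewrite leqNgt h'.
Qed.

(** A constraint may mention a variable up to three times; with three good vertices one is left
    after excluding the at most two already chosen. *)
Lemma pick_good x (s : seq nat) : x < N -> size s <= 2 ->
  exists2 a, a \notin s & [/\ a < 9 * N, a %/ 9 = x & good a (fS x)].
Proof.
move=> xN ss; have := fS_good xN; set A := [set i | _] => hA.
have : ~~ (A \subset [set i : 'I_9 | 9 * x + i \in s]).
  apply/negP => /subset_leq_card; rewrite leqNgt => /negP; apply.
  apply: leq_trans hA; rewrite ltnS; apply: leq_trans ss.
  have inj : injective (fun i : 'I_9 => 9 * x + i).
    by move=> i j /eqP; rewrite eqn_add2l => /eqP/val_inj.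
  rewrite cardE -(size_map (fun i : 'I_9 => 9 * x + i)) uniq_leq_size ?map_inj_uniq ?enum_uniq //.
  by move=> y /mapP[i]; rewrite mem_enum inE => ? ->.
case/subsetPn => i; rewrite !inE => gi ni; exists (9 * x + i) => //.
by split=> //; have := ltn_ord i; lia.
Qed.

Lemma soundness : nae fS.
Proof.
move=> x y z xN yN zN Hcl; apply/negP => /andP[/eqP fxy /eqP fyz].
have [a _ [aN ax ga]] := @pick_good x [::] xN isT.
have [b] := @pick_good y [:: a] yN isT; rewrite inE => ba [bN by_ gb].
have [c] := @pick_good z [:: a; b] zN isT; rewrite !inE negb_or => /andP[ca cb] [cN cz gc].
rewrite fyz in fxy; rewrite fxy in ga; rewrite fyz in gb; move: (fS z) ga gb gc => d ga gb gc.
pose C (t : 'I_7) := Gad t a b c.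
have aC t : active (C t).
  by rewrite /active /= ltn_ord aN bN cN ax by_ cz Hcl eq_sym ba eq_sym ca eq_sym cb.
have gm m : m < 3 -> good (gvar (C ord0) m) d by case: m => [|[|[|m]]].
have vN (t : 'I_7) m : m < 3 -> gvar (C t) m < 9 * N by case: m => [|[|[|m]]].
have inj (t t' : 'I_7) : C t = C t' -> t = t' by case=> /val_inj.
(* A good vertex lies inside its hub along [d], so a link meeting it along [d] would meet the hub,
   to which it is not adjacent. *)
have pu (t : 'I_7) m : m < 3 -> ovl (S (Vp (C t) m)) (S (Vu (gvar (C t) m))) (~~ d).
  move=> m3; have ok1 : vok (Vp (C t) m) by rewrite /= aC.
  have ok2 : vok (Vu (gvar (C t) m)) by rewrite /=; apply: vN.
  have ok3 : vok (Vh (gvar (C t) m %/ 9)) by have := vN t m m3; rewrite /=; lia.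
  have := HS ok1 ok2; rewrite /vadj /= eqxx => /(_ ltac:(by [])).
  have /andP[g1 g2] : good (gvar (C t) m) d by exact: gm.
  have H : ~~ ovl (S (Vp (C t) m)) (S (Vu (gvar (C t) m))) d.
    apply/negP => o; have := ovl_cont o g1 g2; apply/negP; exact: nadj.
  by case: (d) H => /negbTE -> //=; rewrite orbF.
pose B m := [set t : 'I_7 | ~~ cont (S (Vp (C t) m)) (S (Vu (gvar (C t) m))) (~~ d)].
have HB m : m < 3 -> #|B m| <= 2.
  move=> m3; apply: card_le2 => t1 t2 t3; rewrite !inE => c1 c2 c3 n12 n13 n23.
  have ne t t' : t != t' -> ~~ ovl (S (Vp (C t) m)) (S (Vp (C t') m)) (~~ d).
    move=> tt; apply: nadj; rewrite ?/vok ?aC //=.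
    by move=> [/val_inj E]; rewrite E eqxx in tt.
  have := three_ovl (pu t1 m m3) (pu t2 m m3) (pu t3 m m3) (ne _ _ n12) (ne _ _ n13) (ne _ _ n23).
  by rewrite (negbTE c1) (negbTE c2) (negbTE c3).
(* For each of the three links at most two copies stick out of the variable vertex; these are at
   most six of the seven copies. *)
have [t Ht] : exists t, t \notin B 0 :|: B 1 :|: B 2.
  apply/existsP; rewrite -negb_forall; apply/negP => /forallP H.
  have /subset_leq_card : [set: 'I_7] \subset B 0 :|: B 1 :|: B 2 by apply/subsetP => t _; exact: H.
  have c4 : #|B 0 :|: B 1| <= 2 + 2.
    exact: leq_trans (leq_card_setU _ _).1 (leq_add (HB 0 isT) (HB 1 isT)).
  have c6 : #|B 0 :|: B 1 :|: B 2| <= 2 + 2 + 2.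
    exact: leq_trans (leq_card_setU _ _).1 (leq_add c4 (HB 2 isT)).
  by move=> h7; have := leq_trans h7 c6; rewrite cardsT card_ord.
have con m : m < 3 -> cont (S (Vp (C t) m)) (S (Vu (gvar (C t) m))) (~~ d).
  by move: Ht; rewrite !inE !negb_or !negbK => /andP[/andP[]]; case: m => [|[|[|m]]].
(* Across [d] the link is inside its variable vertex, so a neighbour of the link that is not
   adjacent to this vertex meets the link along [d]. This applies to the centre and to the
   pendant. *)
have side v m : m < 3 -> vok v -> v <> Vp (C t) m -> v <> Vu (gvar (C t) m) ->
    vadj v (Vp (C t) m) -> ~~ vadj v (Vu (gvar (C t) m)) -> ovl (S v) (S (Vp (C t) m)) d.
  move=> m3 ok ne1 ne2 ad nad.
  have ok1 : vok (Vp (C t) m) by rewrite /= aC.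
  have ok2 : vok (Vu (gvar (C t) m)) by rewrite /=; apply: vN.
  have H : ~~ ovl (S v) (S (Vp (C t) m)) (~~ d).
    by apply/negP => o; have := ovl_cont o (pu t m m3) (con m m3); apply/negP; exact: nadj.
  move: ad; rewrite HS //; by case: (d) H => /negbTE -> //=; rewrite orbF.
have cp m : m < 3 -> ovl (S (Vp (C t) m)) (S (Vc (C t))) d.
  by move=> m3; rewrite ovlC; apply: side; rewrite //= ?aC // /vadj /= eqxx.
have qp m : m < 3 -> ovl (S (Vq (C t) m)) (S (Vp (C t) m)) d.
  by move=> m3; apply: side; rewrite //= ?aC // /vadj /= !eqxx.
(* A link inside the centre would bring its pendant into contact with the centre. *)
have nc m : m < 3 -> ~~ cont (S (Vp (C t) m)) (S (Vc (C t))) d.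
  move=> m3; apply/negP => o; have := ovl_cont (qp m m3) (cp m m3) o; apply/negP.
  by apply: nadj; rewrite //= ?aC.
have ne m m' : m < 3 -> m' < 3 -> m != m' -> ~~ ovl (S (Vp (C t) m)) (S (Vp (C t) m')) d.
  by move=> m3 m3' mm; apply: nadj; rewrite ?/vok ?aC //= => -[E]; rewrite E eqxx in mm.
have := three_ovl (cp 0 isT) (cp 1 isT) (cp 2 isT) (ne 0 1 isT isT isT) (ne 0 2 isT isT isT) (ne 1
  2 isT isT isT).
by rewrite (negbTE (nc 0 isT)) (negbTE (nc 1 isT)) (negbTE (nc 2 isT)).
Qed.
End Soundness.
End Instance.

(** * Drawing the gadget graph *)

(* The lines used by the drawing; [LT x] carries the hub of [x], [LR a] the long segment of
   the variable vertex [a], [LK C] and [LM C] the two segments of the gadget [C]. *)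
Inductive tag := LT of nat | LK of gad | LR of nat | LM of gad | LI of nat.

(* the two majority variable vertices of a gadget, in increasing order, and the other one *)
Inductive role := Lo | Hi | Mi.

Section Drawing.
Variables (N : nat) (cl : nat -> nat -> nat -> bool) (f : nat -> bool).
Hypothesis Hnae : nae N cl f.

Let F a := f (a %/ 9).
Let U := 9 * N.
Let I := 7 * U ^ 3.
Definition gid C := g_t C + 7 * (g_a C + U * (g_b C + U * g_c C)).

(** [gmi] is the index of the odd value among the three, [go1] and [go2] are the other two indices,
    [gmaj] is their common value, and [gsw] tells whether the vertex of [go2] has the smaller
    number. *)
Definition gmi C := if F (g_a C) == F (g_b C) then 2 else if F (g_a C) == F (g_c C) then 1 else 0.
Definition go1 C := if gmi C == 0 then 1 else 0.
Definition go2 C := if gmi C == 2 then 1 else 2.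
Definition gmaj C := F (gvar C (go1 C)).
Definition gsw C := gvar C (go2 C) < gvar C (go1 C).
Definition grole C m := if m == gmi C then Mi else if (m == go1 C) (+) gsw C then Lo else Hi.
Definition alo C := if gsw C then gvar C (go2 C) else gvar C (go1 C).
Definition ahi C := if gsw C then gvar C (go1 C) else gvar C (go2 C).
Definition ami C := gvar C (gmi C).
Definition gsel C r := match r with Lo => alo C | Hi => ahi C | Mi => ami C end.

Notation active := (active N cl).
Notation vok := (vok N cl).

(** The not-all-equal property enters the drawing here: it provides a minority vertex whose value is
    opposite to that of the two others. *)
Lemma role_facts C : active C ->
  [/\ alo C < ahi C, ahi C < U & ami C < U] /\
  [/\ F (alo C) = gmaj C, F (ahi C) = gmaj C & F (ami C) = ~~ gmaj C].
Proof.
case/and5P=> _ aU bU cU /and4P[ab ac bc Hc].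
have := Hnae (x := g_a C %/ 9) (y := g_b C %/ 9) (z := g_c C %/ 9).
rewrite Hc -/(F (g_a C)) -/(F (g_b C)) -/(F (g_c C)) => H.
have {}H : ~~ ((F (g_a C) == F (g_b C)) && (F (g_b C) == F (g_c C))) by apply: H; lia.
rewrite /alo /ahi /ami /gmaj /gsw /go1 /go2 /gmi /U; move: H.
case Ea: (F (g_a C)); case Eb: (F (g_b C)); case Ec: (F (g_c C)) => //= _;
case: ifP; rewrite ?Ea ?Eb ?Ec; split; split=> //; lia.
Qed.

Lemma gvar_role C m : m < 3 -> gvar C m = gsel C (grole C m).
Proof.
rewrite /grole /gsel /alo /ahi /ami /go1 /go2; case E: (gmi C) => [|[|[|k]]];
  (try by move: E; rewrite /gmi; repeat case: ifP);
  by case: m => [|[|[|m]]] //= _; case: (gsw C).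
Qed.

Lemma grole_inj C m m' : m < 3 -> m' < 3 -> grole C m = grole C m' -> m = m'.
Proof.
rewrite /grole /go1; case E: (gmi C) => [|[|[|k]]];
  (try by move: E; rewrite /gmi; repeat case: ifP);
  by case: m => [|[|[|m]]] //= _; case: m' => [|[|[|m']]] //= _; case: (gsw C).
Qed.

(** Both axes use one scale. Hub lines lie below [U] and the lines [kp] in the next [I] places. Then
    each variable vertex [a] has a block of length [I + 8] starting at its line [Rp a]. The line
    [mp C] lies in the block of the lower majority vertex, at an offset of its own, hence strictly
    between the lines of the two majority vertices. The line of an isolated vertex is at [BIG] or
    beyond. *)
Definition Rp a := U + I + 3 + (I + 8) * a.
Definition kp C := U + gid C.
Definition mp C := Rp (alo C) + 2 + gid C.
Definition BIG := Rp U.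

Lemma Rp_lt a b : a < b -> Rp a + (I + 8) <= Rp b.
Proof. by rewrite /Rp => h; rewrite -addnA -mulnSr leq_add2l leq_mul2l h orbT. Qed.

Lemma Rp_ge a : U + I + 3 <= Rp a.
Proof. exact: leq_addr. Qed.

Lemma gid_lt C : active C -> gid C < I.
Proof.
case/and5P=> tl al bl cl' _; rewrite /gid /I -/U in al bl cl' *.
have h1 : g_b C + U * g_c C < U * U by nia.
have h2 : g_a C + U * (g_b C + U * g_c C) < U * (U * U) by nia.
by rewrite !expnS expn0 muln1; lia.
Qed.

Lemma gid_inj C C' : active C -> active C' -> gid C = gid C' -> C = C'.
Proof.
case/and5P=> tl al bl cl0 _; case/and5P=> tl' al' bl' cl0' _; rewrite /gid => E.
case: C C' tl al bl cl0 tl' al' bl' cl0' E => t a b c [t' a' b' c'] /=; rewrite -/U.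
move=> tl al bl cl0 tl' al' bl' cl0' E.
have Et : t = t' by lia.
have {}E : a + U * (b + U * c) = a' + U * (b' + U * c') by lia.
have dm x y z w : x < U -> y < U -> x + U * z = y + U * w -> x = y /\ z = w.
  move=> xU yU e; have U0 : 0 < U by lia.
  have := congr1 (modn^~ U) e; have := congr1 (divn^~ U) e.
  by rewrite ![_ + U * _]addnC ![U * _]mulnC !modnMDl !divnMDl // !modn_small // !divn_small //
    !addn0.
have [Ea {}E] := dm _ _ _ _ al al' E.
have [Eb Ec] := dm _ _ _ _ bl bl' E.
by rewrite Et Ea Eb Ec.
Qed.

Lemma mp_bounds C : active C ->
  [/\ Rp (alo C) + 2 <= mp C, mp C + 6 <= Rp (ahi C), mp C + 6 <= Rp (alo C) + (I + 8) &
      mp C + 6 <= BIG].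
Proof.
move=> ac; have [[h1 h2 h3] _] := role_facts ac; have g := gid_lt ac.
have r1 := Rp_lt h1; have r2 := Rp_lt h2; rewrite /mp /BIG; split; lia.
Qed.

Lemma mp_inj C C' : active C -> active C' -> mp C = mp C' -> C = C'.
Proof.
move=> ac ac'; have g := gid_lt ac; have g' := gid_lt ac'; rewrite /mp => E.
apply: gid_inj => //; case: (ltngtP (alo C) (alo C')) => [/Rp_lt|/Rp_lt|e]; try lia.
by rewrite e in E; lia.
Qed.

(** A variable vertex has a long segment along its value and a unit stub inside its hub. The two
    segments of a centre start at a common corner. On the line [LK C] the two majority links stick
    out of both ends, the lower one past the corner, which is possible because
    [Rp (alo C) < mp C < Rp (ahi C)]; on [LM C] the minority link sticks out of the far end. Each
    link continues with a unit edge on the long segment of its variable vertex, and each pendant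
    occupies a unit edge of the protruding part. The triple [(LI 0, 0, 0)] is an empty segment. *)
Definition seg v e : tag * nat * nat :=
  match v with
  | Vh x => if e != f x then (LT x, 0, BIG) else (LI 0, 0, 0)
  | Vu a => if e == F a then (LR a, a %/ 9, BIG) else (LT (a %/ 9), Rp a, (Rp a).+1)
  | Vc C => if e == gmaj C then (LM C, kp C, (Rp (ami C)).-1) else (LK C, mp C, (Rp (ahi C)).-1)
  | Vp C i => match grole C i with
     | Lo => if e == gmaj C then (LR (alo C), kp C, (kp C).+1) else (LK C, Rp (alo C), (mp C).+1)
     | Hi => if e == gmaj C then (LR (ahi C), kp C, (kp C).+1)
             else (LK C, (Rp (ahi C)).-2, Rp (ahi C))
     | Mi => if e == gmaj C then (LM C, (Rp (ami C)).-2, Rp (ami C))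
             else (LR (ami C), mp C, (mp C).+1)
     end
  | Vq C i => match grole C i with
     | Lo => if e == gmaj C then (LI 0, 0, 0) else (LK C, Rp (alo C), (Rp (alo C)).+1)
     | Hi => if e == gmaj C then (LI 0, 0, 0) else (LK C, (Rp (ahi C)).-1, Rp (ahi C))
     | Mi => if e == gmaj C then (LM C, (Rp (ami C)).-1, Rp (ami C)) else (LI 0, 0, 0)
     end
  | Vi n => if e then (LI n, 0, 1) else (LI 0, 0, 0)
  end.

Definition pos t := match t with
  | LT x => x | LK C => kp C | LR a => Rp a | LM C => mp C | LI n => BIG + n end.

Definition tagok t := match t with
  | LT x => x < N | LK C | LM C => active C | LR a => a < U | LI _ => true end.

(** This reduces the comparison of lines to that of tags, so unwanted contacts are only to be
    excluded between segments with the same tag. *)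
Lemma pos_inj t t' : tagok t -> tagok t' -> pos t = pos t' -> t = t'.
Proof.
suff H t1 t2 : tagok t1 -> tagok t2 -> pos t1 = pos t2 ->
    match t1, t2 with LT x, LT y => x = y | LK C, LK D => C = D | LR a, LR b => a = b
     | LM C, LM D => C = D | LI n, LI m => n = m | _, _ => False end.
  move=> o o' /(H _ _ o o'); case: t {o} => ?; case: t' {o'} => ? //; by move->.
have NU : N <= U by rewrite /U; lia.
have LB C : active C -> U <= kp C < U + I by move=> /gid_lt; rewrite /kp; lia.
have BB : U + I + 3 <= BIG := Rp_ge U.
have RM a C : active C -> Rp a = mp C -> False.
  move=> /mp_bounds[m1 m2 m3 _]; case: (ltngtP a (alo C)) => [/Rp_lt|/Rp_lt|->]; lia.
have RB a : a < U -> Rp a < BIG by move=> /Rp_lt; rewrite -/BIG; lia.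
case: t1 => [x|C|a|C|n]; case: t2 => [y|D|b|D|m] /= o o' E;
  try (have := LB _ o); try (have := LB _ o'); try (have := mp_bounds o => -[]);
  try (have := mp_bounds o' => -[]); try (have := RB _ o); try (have := RB _ o');
  try (have := Rp_ge a); try (have := Rp_ge b);
  try (have := Rp_ge (alo C)); try (have := Rp_ge (alo D));
  try lia.
- by move=> *; apply: gid_inj => //; move: E; rewrite /kp; lia.
- by move=> *; case: (ltngtP a b) => // /Rp_lt; lia.
- by move=> *; apply: (RM a D).
- by move=> *; apply: (RM b C).
- by move=> *; apply: mp_inj.
Qed.

Definition draw v : shape := fun e => let: (t, a, b) := seg v e in ((pos t)%:Z, a%:Z, b%:Z)%R.

Lemma seg_ok v e : vok v -> tagok (seg v e).1.1.
Proof.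
have roles C : active C -> [/\ alo C < U, ahi C < U & ami C < U].
  by move=> /role_facts[[h1 h2 h3] _]; split=> //; exact: ltn_trans h1 h2.
case: v => [x|a|C|C i|C i|n] /=.
- by move=> h; case: ifP.
- by move=> h; case: ifP => //= _; rewrite /U in h *; lia.
- by move=> h; case: ifP.
- by move=> /andP[/[dup] h /roles[h1 h2 h3] i3]; case: (grole C i); case: ifP.
- by move=> /andP[h i3]; case: (grole C i); case: ifP.
- by case: ifP.
Qed.

Definition sovl (s s' : tag * nat * nat) :=
  s.1.1 = s'.1.1 /\ [&& s.1.2 < s'.2, s'.1.2 < s.2, s.1.2 < s.2 & s'.1.2 < s'.2].

Lemma ovl_seg v w e : vok v -> vok w -> ovl (draw v) (draw w) e <-> sovl (seg v e) (seg w e).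
Proof.
move=> /(@seg_ok _ e) + /(@seg_ok _ e); rewrite /ovl /sovl /draw /ln /lo /hi.
case: (seg v e) => [[t a] b]; case: (seg w e) => [[t' a'] b'] /= ot ot'; split.
  by move=> H; split; [apply: pos_inj => //; lia | lia].
by case=> ->; lia.
Qed.

Lemma gad_bounds C : active C ->
  [/\ U <= kp C, (kp C).+3 < Rp (alo C), (kp C).+3 < Rp (ami C) & Rp (ami C) <= BIG]
  /\ [/\ Rp (alo C) + 2 <= mp C, mp C + 6 <= Rp (ahi C) & Rp (ahi C) <= BIG].
Proof.
move=> ac; have [h1 h2 h3 h4] := mp_bounds ac; have g := gid_lt ac.
have [[/Rp_lt r1 /Rp_lt r2 /Rp_lt r3] _] := role_facts ac.
have := Rp_ge (alo C); have := Rp_ge (ami C); rewrite /kp /BIG; split; split; lia.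
Qed.

Lemma draw_valid v : vok v -> valid (draw v).
Proof.
have V s t a b t' a' b' :
    (s true = (t, a, b) /\ s false = (t', a', b') \/ s true = (t', a', b') /\ s false = (t, a, b))
      ->
    ((a < b) || (a' < b')) -> ((a < b) -> (a' < b') ->
    ((pos t == a') || (pos t == b')) && ((pos t' == a) || (pos t' == b))) ->
    valid (fun e => let: (t, a, b) := s e in ((pos t)%:Z, a%:Z, b%:Z)%R).
  by rewrite /valid /ln /lo /hi => -[[-> ->]|[-> ->]] /=; lia.
have bool2 (T : Type) (x y : T) b : (if true == b then x else y) = x /\ (if false == b then x else
  y) = y \/
    (if true == b then x else y) = y /\ (if false == b then x else y) = x.
  by case: b; [left|right].
have bool3 (T : Type) (x y : T) b : (if true != b then x else y) = x /\ (if false != b then x else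
  y) = y \/
    (if true != b then x else y) = y /\ (if false != b then x else y) = x.
  by case: b; [right|left].
have R0 a : U + I + 3 <= Rp a := Rp_ge a.
case: v => [x|a|C|C i|C i|n] /= ok; rewrite /draw /=.
- by apply: (V _ _ _ _ _ _ _ (bool3 _ _ _ _)); have := R0 U; rewrite -/BIG; lia.
- apply: (V _ _ _ _ _ _ _ (bool2 _ _ _ _)) => /=; first by lia.
  by move=> _ _; rewrite !eqxx.
- have [[a1 a2 a3 a4] [a5 a6 a7]] := gad_bounds ok.
  by apply: (V _ _ _ _ _ _ _ (bool2 _ _ _ _)) => /=; lia.
- have /andP[/gad_bounds[[a1 a2 a3 a4] [a5 a6 a7]] _] := ok.
  by case: (grole C i); apply: (V _ _ _ _ _ _ _ (bool2 _ _ _ _)) => /=; lia.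
- have /andP[/gad_bounds[[a1 a2 a3 a4] [a5 a6 a7]] _] := ok.
  by case: (grole C i); apply: (V _ _ _ _ _ _ _ (bool2 _ _ _ _)) => /=; lia.
- by rewrite /valid /ln /lo /hi /=; lia.
Qed.

Lemma arc_ovl v w : vok v -> vok w -> arc v w -> exists e, sovl (seg v e) (seg w e).
Proof.
have nb (b : bool) : (~~ b == b) = false by case: b.
have gv C i : active C && (i < 3) -> gvar C i = gsel C (grole C i).
  by move=> /andP[_]; exact: gvar_role.
case: v => [x|a|C|C i|C i|n]; case: w => [y|b|D|D j|D j|m] //= ok ok'.
- move=> /eqP <-; exists (~~ f (a %/ 9)); rewrite /F nb; split => //=.
  by have /Rp_lt := ok; rewrite -/BIG; lia.
- rewrite gv //; have /andP[ac _] := ok => /eqP Eb; rewrite -{}Eb in ok' *;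
    exists (F (gsel C (grole C i))).
  have [[a1 a2 a3 a4] [a5 a6 a7]] := gad_bounds ac; have [_ [f1 f2 f3]] := role_facts ac.
  by case: (grole C i) ok' => /= ok'; rewrite ?f1 ?f2 ?f3 ?nb !eqxx; split=> //=;
    rewrite /U in a1; lia.
- move=> /eqP E; subst D; have [[a1 a2 a3 a4] [a5 a6 a7]] := gad_bounds ok'.
  case: (grole C i); [exists (~~ gmaj C)|exists (~~ gmaj C)|exists (gmaj C)];
    by rewrite ?nb ?eqxx; split=> //=; lia.
move=> /andP[/eqP E /eqP E']; subst D j; have /andP[/gad_bounds[[a1 a2 a3 a4] [a5 a6 a7]] _] := ok.
case: (grole C i); [exists (~~ gmaj C)|exists (~~ gmaj C)|exists (gmaj C)];
  by rewrite ?nb ?eqxx; split=> //=; lia.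
Qed.

(** An ordering of the kinds of vertices that halves the case analysis of [ovl_arc]. *)
Definition vrank v := match v with Vh _ => 0 | Vu _ => 1 | Vc _ => 2 | Vp _ _ => 3 | Vq _ _ => 4 |
  Vi _ => 5 end.

(** The lines of a gadget carry only its own vertices. On a hub line the stubs at the places [Rp a]
    are disjoint. On the long segment of a variable vertex the links occupy unit edges at [kp C] or
    [mp C]; these differ for distinct gadgets, and every [kp] is smaller than every [mp]. *)
Lemma ovl_arc v w e : vok v -> vok w -> vrank v <= vrank w -> sovl (seg v e) (seg w e) ->
  v = w \/ vadj v w.
Proof.
have gv C i : active C && (i < 3) -> gvar C i = gsel C (grole C i).
  by move=> /andP[_]; exact: gvar_role.
have kI C D : active C -> active D -> kp C < (kp D).+1 -> kp D < (kp C).+1 -> C = D.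
  by move=> o o' h1 h2; apply: gid_inj => //; move: h1 h2; rewrite /kp; lia.
have mI C D : active C -> active D -> mp C < (mp D).+1 -> mp D < (mp C).+1 -> C = D.
  by move=> o o' h1 h2; apply: mp_inj => //; lia.
have RI a b : Rp a < (Rp b).+1 -> Rp b < (Rp a).+1 -> a = b.
  by case: (ltngtP a b) => // /Rp_lt; lia.
have gb C i : active C && (i < 3) -> active C by case/andP.
have g3 C i : active C && (i < 3) -> i < 3 by case/andP.
case: v => [x|a|C|C i|C i|n]; case: w => [y|b|D|D j|D j|m] //= ok ok' _;
  try (have Gv := gv _ _ ok); try (have Gv' := gv _ _ ok');
  try (have Ro : exists r, grole C i = r by exists (grole C i)); 
  try (have Ro' : exists r, grole D j = r by exists (grole D j));
  try (case: Ro => -[] Er; rewrite Er /= in Gv * ); try (case: Ro' => -[] Er';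
    rewrite Er' /= in Gv' * );
  repeat case: ifP => ?; case=> /= T O; try (exfalso; lia); try discriminate T; case: T => T; subst;
  try (by left); try (by right; rewrite /vadj /= ?Gv ?Gv' eqxx ?orbT).
- by left; congr Vu; apply: RI; lia.
all: have aD : active D by first [exact: ok | exact: gb _ _ ok'].
all: have [[d1 d2 d3 d4] [d5 d6 d7]] := gad_bounds aD; try (exfalso; lia).
all: have [[f1 f2 f3] _] := role_facts aD.
all: have same : grole D i = grole D j -> i = j
  by apply: grole_inj; [exact: g3 _ _ ok | exact: g3 _ _ ok'].
all: try by (have Eij := same (etrans Er (esym Er')); subst; by [left | right;
  rewrite /vadj /= !eqxx ?orbT]).
all: have aC : active C by exact: gb _ _ ok.
all: have kR X Y : active X -> (kp X).+3 < Rp (alo Y)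
  by move=> /gid_lt; have := Rp_ge (alo Y); rewrite /kp; lia.
all: have [[c1 c2 c3 c4] [c5 c6 c7]] := gad_bounds aC.
all: have k1 := kR C D aC; have k2 := kR D C aD; try (exfalso; lia).
all: have E : C = D by first [by apply: kI => //; lia | by apply: mI => //; lia].
all: subst; try (exfalso; lia).
all: by left; congr Vp; apply: same; rewrite Er Er'.
Qed.

Lemma draw_adj v w : vok v -> vok w -> v <> w ->
  vadj v w = ovl (draw v) (draw w) true || ovl (draw v) (draw w) false.
Proof.
move=> ov ow ne; apply/idP/idP => [/orP[] /arc_ovl [] // e|].
- by move/(ovl_seg e ov ow); case: e => ->; rewrite ?orbT.
- by move/(ovl_seg e ow ov); rewrite ovlC; case: e => ->; rewrite ?orbT.
move=> H; have [e /(ovl_seg e ov ow)] : exists e, ovl (draw v) (draw w) e.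
  by case/orP: H => H; [exists true | exists false].
case: (leqP (vrank v) (vrank w)) => r; first by case/(ovl_arc ov ow r).
have sC s s' : sovl s s' -> sovl s' s by rewrite /sovl => -[-> ?]; split => //; lia.
by case/sC/(ovl_arc ow ov (ltnW r)) => [/esym //|]; rewrite /vadj orbC.
Qed.
End Drawing.

(** A two-colouring of the gadget graph: every arc has exactly one end among the hubs and links. *)
Definition side v := match v with Vh _ | Vp _ _ => true | _ => false end.

Lemma vadj_side v w : vadj v w -> side v = ~~ side w.
Proof. by case: v; case: w. Qed.

Lemma vadj_triangle u v w : vadj u v -> vadj v w -> vadj u w -> False.
Proof. by move=> /vadj_side a /vadj_side b /vadj_side; rewrite a b; case: (side w). Qed.

(** * Numbering the vertices *)

Section Numbering.
Variables (N : nat) (cl : nat -> nat -> nat -> bool).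
Let U := 9 * N.

(** Numbers are read with mixed-radix digits [k < 8], [t < 7] and three digits below [U], whence 56.
    The digit [k] is 0 for centres, 1 to 3 for links, 4 to 6 for pendants; under [k = 7] with
    vanishing last two digits, [t = 0] gives the variable vertices and [t = 1] the hubs. All other
    numbers become isolated vertices, so the number of vertices depends on [N] only. *)
Definition nv := 56 * U ^ 3.

Definition enc k C := k + 8 * (g_t C + 7 * (g_a C + U * (g_b C + U * g_c C))).

Definition gadn v :=
  let q := v %/ 56 in Gad (v %/ 8 %% 7) (q %% U) (q %/ U %% U) (q %/ U %/ U).

Definition dec v :=
  let k := v %% 8 in let C := gadn v in
  if k == 7 then
    if (g_b C == 0) && (g_c C == 0) then
      if g_t C == 0 then Vu (g_a C) else
      if (g_t C == 1) && (g_a C < N) then Vh (g_a C) else Vi v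
    else Vi v
  else if active N cl C then
    if k == 0 then Vc C else if k <= 3 then Vp C k.-1 else Vq C (k - 4)
  else Vi v.

Definition idx v := match v with
  | Vh x => enc 7 (Gad 1 x 0 0) | Vu a => enc 7 (Gad 0 a 0 0)
  | Vc C => enc 0 C | Vp C m => enc m.+1 C | Vq C m => enc (m + 4) C | Vi n => n end.

Lemma enc_lt k C : k < 8 -> g_t C < 7 -> g_a C < U -> g_b C < U -> g_c C < U -> enc k C < nv.
Proof.
case: C => t a b c /= k8 t7 aU bU cU; rewrite /enc /nv /= !expnS expn0 muln1.
have h1 : b + U * c < U * U by nia.
have h2 : a + U * (b + U * c) < U * (U * U) by nia.
lia.
Qed.

Lemma gadn_enc k C : k < 8 -> g_t C < 7 -> g_a C < U -> g_b C < U -> g_c C < U ->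
  gadn (enc k C) = C /\ enc k C %% 8 = k.
Proof.
case: C => t a b c /= k8 t7 aU bU cU; rewrite /enc /gadn /=.
have U0 : 0 < U by lia.
set q := a + U * (b + U * c).
have -> : (k + 8 * (t + 7 * q)) %/ 56 = q by lia.
have -> : (k + 8 * (t + 7 * q)) %/ 8 = t + 7 * q by lia.
have -> : (t + 7 * q) %% 7 = t by lia.
have Eq : q %/ U = b + U * c.
  by rewrite /q addnC mulnC divnMDl // divn_small // addn0.
split; last by lia.
rewrite Eq /q addnC mulnC modnMDl modn_small //.
by rewrite addnC mulnC divnMDl // divn_small // addn0 modnMDl modn_small.
Qed.

Lemma enc_gadn v : 0 < U -> enc (v %% 8) (gadn v) = v.
Proof.
move=> U0; rewrite /enc /gadn /=; set q := v %/ 56.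
have -> : q %% U + U * (q %/ U %% U + U * (q %/ U %/ U)) = q.
  have e1 := divn_eq q U; have e2 := divn_eq (q %/ U) U.
  by rewrite [U * (q %/ U %/ U)]mulnC [_ %% U + _ * U]addnC -e2 [U * _]mulnC addnC -e1.
by rewrite /q; lia.
Qed.

Lemma gadn_lt v : v < nv -> [/\ 0 < U, g_t (gadn v) < 7, g_a (gadn v) < U, g_b (gadn v) < U & g_c
  (gadn v) < U].
Proof.
move=> lt; have U0 : 0 < U by move: lt; rewrite /nv; case: (U).
split; rewrite //= ?ltn_pmod //.
by rewrite !ltn_divLR //; move: lt; rewrite /nv !expnS expn0 muln1; nia.
Qed.

Lemma dec_vok v : v < nv -> vok N cl (dec v).
Proof.
move=> /gadn_lt[U0 h1 h2 h3 h4]; rewrite /dec; have := ltn_pmod v (isT : 0 < 8).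
case: ifP => n7; first by move=> _; case: ifP => // _; case: ifP => // _; case: ifP => //= /andP[].
by case: ifP => // ac; case: ifP => //= k0; case: ifP => /= k3; rewrite ac /=; lia.
Qed.

Lemma decK v : v < nv -> idx (dec v) = v.
Proof.
move=> lt; have [U0 _ _ _ _] := gadn_lt lt; have E := enc_gadn v U0.
rewrite /dec; move: (gadn v) E => C E /=; case: eqP => [k7|n7].
  case: ifP => [/andP[/eqP hb /eqP hc]|_ //].
  case: eqP => [ht|_]; [|case: ifP => [/andP[/eqP ht _]|_ //]];
    by rewrite /= -[RHS]E k7; congr enc; case: C hb hc ht {E} => ? ? ? ? /= -> -> ->.
case: ifP => // _; case: eqP => [k0|k0] /=; first by rewrite -[RHS]E k0.
by case: ifP => k3 /=; rewrite -[RHS]E; congr enc; lia.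
Qed.

Lemma dec_inj u v : u < nv -> v < nv -> dec u = dec v -> u = v.
Proof. by move=> /decK hu /decK hv E; rewrite -hu E. Qed.

Definition isVi v := if v is Vi _ then true else false.

Lemma idxK v : vok N cl v -> ~~ isVi v -> idx v < nv /\ dec (idx v) = v.
Proof.
have gN x : x < N -> x < U by rewrite /U; lia.
have ac C : active N cl C -> [/\ g_t C < 7, g_a C < U, g_b C < U & g_c C < U].
  by case/and5P => ? ? ? ? _.
have D k C v' : [/\ k < 8, g_t C < 7, g_a C < U, g_b C < U & g_c C < U] ->
    (if k == 7 then
    if (g_b C == 0) && (g_c C == 0) then
      if g_t C == 0 then Vu (g_a C) else
      if (g_t C == 1) && (g_a C < N) then Vh (g_a C) else Vi (enc k C)
    else Vi (enc k C)
  else if active N cl C then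
    if k == 0 then Vc C else if k <= 3 then Vp C k.-1 else Vq C (k - 4)
  else Vi (enc k C)) = v' -> enc k C < nv /\ dec (enc k C) = v'.
  case=> k8 ht ha hb hc <-; split; first exact: enc_lt.
  by have [E1 E2] := gadn_enc k8 ht ha hb hc; rewrite /dec E2 E1.
case: v => [x|a|C|C i|C i|n] //= ok _; apply: D.
- by have := gN _ ok; split=> //=; lia.
- by rewrite /= ok.
- by split=> //=; rewrite -/U in ok; lia.
- by [].
- by have [? ? ? ?] := ac _ ok.
- by rewrite ok.
- by have /andP[/ac[? ? ? ?] i3] := ok; split=> //; lia.
- by have /andP[-> i3] := ok; case: i i3 {ok} => [|[|[|i]]].
- by have /andP[/ac[? ? ? ?] i3] := ok; split=> //; lia.
- by have /andP[-> i3] := ok; case: i i3 {ok} => [|[|[|i]]].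
Qed.

Definition gadj : rel 'I_nv := fun u v => vadj (dec u) (dec v).

Lemma vadj_sym v w : vadj v w = vadj w v.
Proof. by rewrite /vadj orbC. Qed.

Lemma vadj_irr v : vadj v v = false.
Proof. by apply/negP => /vadj_side; case: (side v). Qed.

Lemma gadj_simple : simple_graph gadj.
Proof. by split=> [u v|u]; rewrite /gadj ?vadj_irr // vadj_sym. Qed.

Lemma gadj_nae : has_Helly_B1_EPG gadj <-> exists f, nae N cl f.
Proof.
rewrite shape_repP; split=> [[σ [_ Ha _]]|[f Hf]].
  (* Isolated vertices may carry any number, also one outside the graph; they get an empty shape,
     which overlaps nothing. *)
  pose S v : shape := if isVi v then (fun=> (0, 0, 0)%R) else
    if @insub nat (fun i => i < nv) 'I_nv (idx v) is Some i then σ i else (fun=> (0, 0, 0)%R).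
  exists (fS S); apply: soundness => v w ov ow ne.
  have SVi u τ h : isVi u -> ovl (S u) τ h = false /\ ovl τ (S u) h = false.
    by rewrite /S => ->; rewrite /ovl /ln /lo /hi /= /Order.lt /= !andbF.
  have aVi u u' : isVi u -> vadj u u' = false by case: u => // ? _; case: u'.
  case Ev: (isVi v); first by have [-> _] := SVi v (S w) true Ev;
    have [-> _] := SVi v (S w) false Ev; exact: aVi.
  case Ew: (isVi w).
    have [_ ->] := SVi w (S v) true Ew; have [_ ->] := SVi w (S v) false Ew.
    by rewrite vadj_sym; exact: aVi.
  have [lv dv] := idxK ov (negbT Ev); have [lw dw] := idxK ow (negbT Ew).
  rewrite /S Ev Ew (insubT (fun i => i < nv) lv) (insubT (fun i => i < nv) lw).
  have := Ha (Ordinal lv) (Ordinal lw).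
  rewrite /gadj /= dv dw => H; apply/idP/idP.
    move/H => /(_ _) /meets_ovl; apply.
    by apply/eqP => /(congr1 val) /= E; case: ne; rewrite -dv -dw E.
  move/meets_ovl => M; apply/H => //.
  by apply/eqP => /(congr1 val) /= E; case: ne; rewrite -dv -dw E.
pose σ (i : 'I_nv) := draw N f (dec i).
have ok (i : 'I_nv) : vok N cl (dec i) by apply: dec_vok.
have ne (u v : 'I_nv) : u != v -> dec u <> dec v.
  by move=> uv /dec_inj E; case/eqP: uv; apply/val_inj/E.
have adj u v : u != v -> (gadj u v <-> meets (σ u) (σ v)).
  move=> uv; rewrite /gadj (draw_adj Hf (ok u) (ok v) (ne _ _ uv)); by rewrite -meets_ovl.
have val v : valid (σ v) by apply: (@draw_valid N cl f Hf).
exists σ; split=> // S HS.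
(* Three pairwise intersecting paths would give a triangle. *)
have [S2|] := leqP #|S| 2; last first.
  case/card_gt2P => a [b [c [[aS bS cS] [ab bc ca]]]].
  have /adj h1 := HS a b aS bS; have /adj h2 := HS b c bS cS; have /adj h3 := HS a c aS cS.
  by case: (@vadj_triangle (dec a) (dec b) (dec c)); [apply: h1 | apply: h2 | apply: h3;
    rewrite eq_sym].
have [|e He] := @helly_card_le2 _ _
  (fun u (e : bool * int * int) => ins (σ u) e.1.1 e.1.2 e.2) S (true, 0, 0)%R S2.
  by move=> u v uS vS; have [h [c [x ?]]] := HS u v uS vS; exists (h, c, x).
by exists e.1.1, e.1.2, e.2.
Qed.
End Numbering.

(** * Adjacency matrices as words *)

Lemma graph_enc_mkseq n (g : nat -> nat -> bool) :
  graph_enc (fun i j : 'I_n => g i j) = mkseq (fun k => g (k %/ n) (k %% n)) (n * n).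
Proof.
rewrite /graph_enc.
have -> : [seq g (nat_of_ord i) (nat_of_ord j) | i <- enum 'I_n, j <- enum 'I_n] =
    [seq g i j | i <- iota 0 n, j <- iota 0 n].
  by rewrite -val_enum_ord allpairs_mapl allpairs_mapr.
have H m : [seq g i j | i <- iota 0 m, j <- iota 0 n] =
    mkseq (fun k => g (k %/ n) (k %% n)) (m * n).
  elim: m => [|m IH]; first by rewrite mul0n.
  rewrite -addn1 iotaD allpairs_cat IH /= cats0 add0n mulnDl mul1n /mkseq iotaD map_cat.
  congr cat; rewrite add0n -[m * n]addn0 iotaDl -map_comp.
  apply/eq_in_map => j; rewrite mem_iota => /= lt.
  by rewrite divnMDl ?modnMDl ?divn_small ?modn_small ?addn0 //; lia.
exact: H.
Qed.

Lemma size_graph_enc n (g : rel 'I_n) : size (graph_enc g) = n * n.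
Proof. by rewrite /graph_enc size_allpairs !size_enum_ord. Qed.

Lemma nth_graph_enc n (g : rel 'I_n) (i j : 'I_n) : nth false (graph_enc g) (i * n + j) = g i j.
Proof.
pose g' a b := if insub a is Some i then if insub b is Some j then g i j else false else false.
have -> : graph_enc g = graph_enc (fun i j : 'I_n => g' i j).
  by apply: eq_allpairs => a b; rewrite /g' !valK.
have n0 : 0 < n by exact: leq_ltn_trans (leq0n _) (ltn_ord i).
have lt : i * n + j < n * n by have := ltn_ord i; have := ltn_ord j; nia.
rewrite graph_enc_mkseq nth_mkseq // divnMDl // modnMDl divn_small // modn_small // addn0.
by rewrite /g' !valK.
Qed.

(* Under a binder, every computable function is composed with the projection forgetting the
   bound variable. *)
Ltac dT_lift :=
  repeat match goal with H : dT _ |- _ => generalize (dT_tl H); clear H end;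
  generalize dT_hd; cbn [fst snd]; intros.

Ltac dT_step := lazymatch goal with
  | |- dT (fun c => nat_of_bool (@?P c)) => change (dB P)
  | |- dB (fun c => @?P c && @?Q c) => apply: (@dB_and P Q)
  | |- dB (fun c => @?P c || @?Q c) => apply: (@dB_or P Q)
  | |- dB (fun c => @?P c ==> @?Q c) => apply: (@dB_imp P Q)
  | |- dB (fun c => ~~ @?P c) => apply: (@dB_not P)
  | |- dB (fun c => onth (fst c) (@?F c) == Some ?b) => apply: (@dT_bit b F)
  | |- dB (fun c => @eq_op _ (@?F c) (@?G c)) =>
      first [apply: (@dB_eq F G) | apply: (@dB_iff F G)]
  | |- dB (fun c => leq (@?F c) (@?G c)) => apply: (@dB_leq F G)
  | |- dB (fun c => exb (@?F c) (fun v => @?P v c)) =>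
      refine (@dB_ex F (fun v c => P v c) _ _); [|dT_lift]
  | |- dB (fun c => allb (@?F c) (fun v => @?P v c)) =>
      refine (@dB_all F (fun v c => P v c) _ _); [|dT_lift]
  | |- dB (fun _ => ?b) => exact: (@dB_cst b)
  | |- dT (fun _ => ?n) => exact: (@dT_cst n)
  | |- dT (fun c => S (@?F c)) => apply: (@dTS F)
  | |- dT (fun c => addn (@?F c) (@?G c)) => apply: (@dT_add F G)
  | |- dT (fun c => muln (@?F c) (@?G c)) => apply: (@dT_mul F G)
  | |- dT (fun c => subn (@?F c) (@?G c)) => apply: (@dT_sub F G)
  | |- dT (fun c => divn (@?F c) (@?G c)) => apply: (@dT_div F G)
  | |- dT (fun c => modn (@?F c) (@?G c)) => apply: (@dT_mod F G)
  | |- dT (fun c => expn (@?F c) ?k) => apply: (@dT_exp F k)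
  | |- dT (fun c => head 0 (snd c)) => exact: dT_hd
  | |- dT (fun c => size (fst c)) => exact: dT_size
  | |- dT (fun c => match _ with _ => _ end) => apply: dT_if
  | |- _ => match goal with
     | H : ?G |- ?G => exact H
     | H : dT ?F |- dT (fun c => ?F c) => exact H
     | H : dB ?F |- dB (fun c => ?F c) => exact H
     end
  end.

(** * Computability of the reduction to graphs *)

Section Definable.
Variables (N : seq bool -> nat) (cl : seq bool -> nat -> nat -> nat -> bool).
Hypothesis HN : dT (fun c => N c.1).
Hypothesis Hcl : forall X Y Z, dT X -> dT Y -> dT Z ->
  dB (fun c => cl c.1 (X c) (Y c) (Z c)).

Section Fixed.
Variable x : seq bool.
Let U := 9 * N x.
(** The definitions from here to [ngadj] restate [dec] and [arc] directly on numbers, using only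
    operations for which closure of the computable functions is available. *)
Definition ga v := v %/ 56 %% U.
Definition gb v := v %/ 56 %/ U %% U.
Definition gc v := v %/ 56 %/ U %/ U.
Definition nact v := [&& ga v < 9 * N x, gb v < 9 * N x, gc v < 9 * N x,
  ga v != gb v, ga v != gc v, gb v != gc v & cl x (ga v %/ 9) (gb v %/ 9) (gc v %/ 9)].
Definition nU v := [&& v %% 8 == 7, gb v == 0, gc v == 0 & v %/ 8 %% 7 == 0].
Definition nH v := [&& v %% 8 == 7, gb v == 0, gc v == 0, v %/ 8 %% 7 == 1 & ga v < N x].
Definition nvar v := if v %% 8 == 1 then ga v else if v %% 8 == 2 then gb v else gc v.
Definition nP v := [&& nact v, 0 < v %% 8 & v %% 8 <= 3].
Definition nC v := nact v && (v %% 8 == 0).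
Definition nQ v := [&& nact v, 3 < v %% 8 & v %% 8 <= 6].
Definition narc u v :=
  [|| [&& nU u, nH v & ga u %/ 9 == ga v],
      [&& nP u, nU v & nvar u == ga v],
      [&& nP u, nC v & u %/ 8 == v %/ 8] |
      [&& nQ u, nP v, u %/ 8 == v %/ 8 & u %% 8 == v %% 8 + 3]].
Definition ngadj u v := narc u v || narc v u.

Lemma ngadjE u v : u < nv (N x) -> v < nv (N x) ->
  vadj (dec (N x) (cl x) u) (dec (N x) (cl x) v) = ngadj u v.
Proof.
move=> hu hv.
suff H w z : w < nv (N x) -> z < nv (N x) ->
    arc (dec (N x) (cl x) w) (dec (N x) (cl x) z) = narc w z.
  by rewrite /vadj /ngadj !H.
move=> hw hz {u v hu hv}.
have [U0 _ _ _ _] := gadn_lt hw.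
have act v : active (N x) (cl x) (gadn (N x) v) = nact v.
  by rewrite /active /= ltn_pmod.
have gadE : gadn (N x) w == gadn (N x) z = (w %/ 8 == z %/ 8).
  apply/eqP/eqP => [E|E]; last first.
    by have E2 : w %/ 56 = z %/ 56; [lia | rewrite /gadn E E2].
  have := enc_gadn w U0; have := enc_gadn z U0; rewrite E /enc.
  by move: (_ + 7 * _) => Q; lia.
have lt8 v : v %% 8 < 8 by rewrite ltn_pmod.
have d v : dec (N x) (cl x) v =
   if nU v then Vu (ga v) else if nH v then Vh (ga v) else
   if nC v then Vc (gadn (N x) v) else if nP v then Vp (gadn (N x) v) (v %% 8).-1 else
   if nQ v then Vq (gadn (N x) v) (v %% 8 - 4) else Vi v.
  rewrite /dec act /nU /nH /nC /nP /nQ /= -/(ga v) -/(gb v) -/(gc v); have := lt8 v.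
  case: (v %% 8) => [|[|[|[|[|[|[|[|k]]]]]]]] //= _; try by case: (nact v).
  by case: (gb v == 0); case: (gc v == 0) => //; case: (v %/ 8 %% 7) => [|[|n]] //=;
    case: ltnP => //; rewrite andbF.
have gv v : 0 < v %% 8 <= 3 -> gvar (gadn (N x) v) (v %% 8).-1 = nvar v.
  by rewrite /nvar; case: (v %% 8) => [|[|[|[|k]]]].
have dj v : [/\ nU v -> [/\ nH v = false, nC v = false, nP v = false & nQ v = false],
   nH v -> [/\ nC v = false, nP v = false & nQ v = false],
   nC v -> nP v = false /\ nQ v = false & nP v -> nQ v = false].
  rewrite /nU /nH /nC /nP /nQ; have := lt8 v.
  case: (v %% 8) => [|[|[|[|[|[|[|[|k]]]]]]]] //= _; rewrite ?andbF; split=> //;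
    try by move=> /and3P[_ _ /eqP ->]; rewrite !andbF.
rewrite !d /narc.
have [u1 u2 u3 u4] := dj w; have [v1 v2 v3 v4] := dj z.
case Uw: (nU w).
  have [a0 a1 a2 a3] := u1 Uw; rewrite ?a0 ?a1 ?a2 ?a3; case Uz: (nU z) => /=.
    by have [b0 b1 b2 b3] := v1 Uz; rewrite ?b0 ?b1 ?b2 ?b3.
  case Hz: (nH z) => /=; first by rewrite !orbF.
  by case: (nC z) => //=; case: (nP z) => //=; case: (nQ z).
case Hw: (nH w) => /=.
  have [a0 a1 a2] := u2 Hw; rewrite ?a0 ?a1 ?a2 /=.
  by case: (nU z) => //; case: (nH z) => //; case: (nC z) => //; case: (nP z) => //; case: (nQ z).
case Cw: (nC w) => /=.
  have [a0 a1] := u3 Cw; rewrite ?a0 ?a1 /=.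
  by case: (nU z) => //; case: (nH z) => //; case: (nC z) => //; case: (nP z) => //; case: (nQ z).
case Pw: (nP w) => /=.
  have a0 := u4 Pw; rewrite ?a0; have /and3P[_ p1 p2] := Pw.
  case Uz: (nU z) => /=.
    by have [b0 b1 b2 b3] := v1 Uz; rewrite ?b0 ?b1 ?b2 ?b3; rewrite gv ?p1 // !orbF.
  case Hz: (nH z) => /=; first by have [b0 b1 b2] := v2 Hz; rewrite ?b0 ?b1 ?b2.
  by case Cz: (nC z) => /=; [rewrite gadE orbF | case: (nP z) => //; case: (nQ z)].
case Qw: (nQ w) => /=; last first.
  by case: (nU z) => //; case: (nH z) => //; case: (nC z) => //; case: (nP z) => //; case: (nQ z).
case Uz: (nU z) => /=; first by have [b0 b1 b2 b3] := v1 Uz; rewrite ?b0 ?b1 ?b2 ?b3.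
case Hz: (nH z) => /=; first by have [b0 b1 b2] := v2 Hz; rewrite ?b0 ?b1 ?b2.
case Cz: (nC z) => /=; first by have [b0 b1] := v3 Cz; rewrite ?b0 ?b1.
case Pz: (nP z) => /=; last by case: (nQ z).
rewrite gadE; congr andb; move: Qw Pz; rewrite /nQ /nP => /and3P[_ q1 q2] /and3P[_ p1 p2].
by move: (w %% 8) (z %% 8) q1 q2 p1 p2; clear; lia.
Qed.
End Fixed.

Lemma d_ngadj X Y : dT X -> dT Y -> dB (fun c => ngadj c.1 (X c) (Y c)).
Proof.
have dU : dT (fun c => 9 * N c.1) by repeat dT_step.
have da Z : dT Z -> dT (fun c => ga c.1 (Z c)) by move=> HZ; rewrite /ga; repeat dT_step.
have db Z : dT Z -> dT (fun c => gb c.1 (Z c)) by move=> HZ; rewrite /gb; repeat dT_step.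
have dc Z : dT Z -> dT (fun c => gc c.1 (Z c)) by move=> HZ; rewrite /gc; repeat dT_step.
have dact Z : dT Z -> dB (fun c => nact c.1 (Z c)).
  move=> HZ; have ha := da _ HZ; have hb := db _ HZ; have hc := dc _ HZ.
  by rewrite /nact; repeat dT_step; apply: Hcl; repeat dT_step.
have dnU Z : dT Z -> dB (fun c => nU c.1 (Z c)).
  by move=> HZ; have ha := da _ HZ; have hb := db _ HZ; have hc := dc _ HZ; rewrite /nU;
    repeat dT_step.
have dnH Z : dT Z -> dB (fun c => nH c.1 (Z c)).
  by move=> HZ; have ha := da _ HZ; have hb := db _ HZ; have hc := dc _ HZ; rewrite /nH;
    repeat dT_step.
have dv Z : dT Z -> dT (fun c => nvar c.1 (Z c)).
  by move=> HZ; have ha := da _ HZ; have hb := db _ HZ; have hc := dc _ HZ; rewrite /nvar;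
    repeat dT_step.
have dnP Z : dT Z -> dB (fun c => nP c.1 (Z c)).
  by move=> HZ; have ha := dact _ HZ; rewrite /nP; repeat dT_step.
have dnC Z : dT Z -> dB (fun c => nC c.1 (Z c)).
  by move=> HZ; have ha := dact _ HZ; rewrite /nC; repeat dT_step.
have dnQ Z : dT Z -> dB (fun c => nQ c.1 (Z c)).
  by move=> HZ; have ha := dact _ HZ; rewrite /nQ; repeat dT_step.
have darc Z W : dT Z -> dT W -> dB (fun c => narc c.1 (Z c) (W c)).
  move=> HZ HW.
  have := (da _ HZ, da _ HW, dnU _ HZ, dnU _ HW); have := (dnH _ HW, dnP _ HZ, dnP _ HW, dnC _ HW).
  have := (dnQ _ HZ, dv _ HZ) => -[? ?] [[[? ?] ?] ?] [[[? ?] ?] ?].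
  by rewrite /narc; repeat dT_step.
by move=> HX HY; rewrite /ngadj; apply: dB_or; exact: darc.
Qed.

Lemma nae_reduction : exists h, poly_computable h /\
  forall x, Helly_B1_EPG_recognition (h x) <-> exists f, nae (N x) (cl x) f.
Proof.
pose n x := nv (N x).
exists (fun x => mkseq (fun k => ngadj x (k %/ n x) (k %% n x)) (n x * n x)); split.
  have dn : dT (fun c => n c.1) by rewrite /n /nv; repeat dT_step.
  apply: (@poly_computable_mkseq (fun c => n c.1 * n c.1)
    (fun c => ngadj c.1 (head 0 c.2 %/ n c.1) (head 0 c.2 %% n c.1))); first by repeat dT_step.
  by apply: d_ngadj; repeat dT_step.
move=> x.
have E : mkseq (fun k => ngadj x (k %/ n x) (k %% n x)) (n x * n x) =
    graph_enc (@gadj (N x) (cl x)).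
  rewrite /gadj (graph_enc_mkseq _ (fun u v => vadj (dec (N x) (cl x) u) (dec (N x) (cl x) v))).
  apply/eq_in_map => k; rewrite mem_iota => /= lt.
  have n0 : 0 < n x by case: (n x) lt.
  by rewrite ngadjE ?ltn_pmod ?ltn_divLR.
rewrite E -gadj_nae; split; last by move=> H; exists (nv (N x)), (@gadj (N x) (cl x)); split;
  [exact: gadj_simple | split].
(* The language quantifies over graphs, but the word determines its graph: its length is the square
   of the number of vertices, its bits are the adjacencies. *)
case=> m [adj [_ [Eg H]]].
have Em : m = nv (N x).
  by have := congr1 size Eg; rewrite !size_graph_enc => /eqP; rewrite !mulnn eqn_sqr => /eqP.
subst m; suff <- : adj = @gadj (N x) (cl x) by [].
have Ef i j : adj i j = @gadj (N x) (cl x) i j by rewrite -!nth_graph_enc Eg.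
by do 2 (apply: functional_extensionality => ?).
Qed.
End Definable.

(** * Computation tableaux *)

Section Trajectory.
Variable M : TM.

Definition cell : finType := (tm_sym M * option (tm_state M))%type.

Definition cellof (c : config M) h s : cell :=
  (tape c h s, if s == h then Some (cfg_state c) else None).

(** The new content of a cell depends on the cell and its two neighbours. Triples with several heads
    do not occur in a run; for them the order of the cases makes an arbitrary choice. *)
Definition loc (a b c : cell) : cell :=
  match b.2, a.2, c.2 with
  | Some q, _, _ => if tm_halt M q then b else
      let: (q', x, m) := tm_delta M q b.1 in (x, if m is Stay then Some q' else None)
  | None, Some q, _ => if tm_halt M q then b else
      let: (q', _, m) := tm_delta M q a.1 in (b.1, if m is MoveR then Some q' else None)
  | None, None, Some q => if tm_halt M q then b else
      let: (q', _, m) := tm_delta M q c.1 in (b.1, if m is MoveL then Some q' else None)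
  | None, None, None => b
  end.

Definition tstep (ch : config M * nat) : config M * nat :=
  let: (c, h) := ch in
  (tm_step c, if tm_halt M (cfg_state c) then h
              else mvh (tm_delta M (cfg_state c) (tape c h h)).2 h).

Lemma tm_step_halt (c : config M) : tm_halt M (cfg_state c) -> tm_step c = c.
Proof. by case: c => [[[q l] a] r] /= ->. Qed.

Lemma loc_correct c h s : 0 < h ->
  cellof (tstep (c, h)).1 (tstep (c, h)).2 s.+1 =
  loc (cellof c h s) (cellof c h s.+1) (cellof c h s.+2).
Proof.
move=> h0; rewrite /cellof /loc /=.
case Hh: (tm_halt M (cfg_state c)).
  rewrite (tm_step_halt Hh); case: (s.+1 == h); first by rewrite Hh.
  by case: (s == h); [rewrite Hh | case: (s.+2 == h); rewrite ?Hh].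
case E: (tm_delta M (cfg_state c) (tape c h h)) => [[q' x] m].
have [||e1 e2] := @tape_step M c h q' x m _ E; rewrite ?Hh // e1 e2 /upd /=.
case: (eqVneq s.+1 h) => [<-|n1] in E *; first rewrite Hh E.
  by case: m {E e2} => /=; congr (_, _); case: eqP => //; lia.
case: (eqVneq s h) => [Es|n2] in E *; first rewrite Hh ?Es E; last first.
  case: (eqVneq s.+2 h) => [Es|n3] in E *; first rewrite Hh ?Es E.
    by case: m {E e2} => /=; congr (_, _); case: eqP => //; lia.
  by case: m {E e2} => /=; congr (_, _); case: eqP => //; lia.
by case: m {E e2} => /=; congr (_, _); case: eqP => //; lia.
Qed.

Definition traj z h t := iter t tstep (tm_init M z, h).

Lemma traj_run z h t : (traj z h t).1 = tm_run M t z.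
Proof. by elim: t => //= t; rewrite /traj /tm_run /= => <-; case: (iter _ _ _). Qed.

Lemma traj_head z h t : h - t <= (traj z h t).2 <= h + t.
Proof.
elim: t => [|t]; first by rewrite /=; lia.
rewrite /traj /=; case: (iter _ _ _) => c k /= H; case: ifP => _; first by lia.
by case: (tm_delta _ _ _) => [[? ?] []] /=; lia.
Qed.

Definition CC z h t s := cellof (traj z h t).1 (traj z h t).2 s.

(** A head that starts at [h] cannot have reached cell 0 after [t < h] steps, so a left move stays
    within the numbered cells. *)
Lemma CC_step z h t s : t < h ->
  CC z h t.+1 s.+1 = loc (CC z h t s) (CC z h t s.+1) (CC z h t s.+2).
Proof.
move=> lt; have := traj_head z h t; rewrite /CC {2 3}/traj /= -/(traj z h t).
by case: (traj z h t) => c k /= H; apply: (@loc_correct c k s); lia.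
Qed.

Definition symo (o : option bool) := if o is Some b then tm_in M b else tm_blank M.

Lemma CC0 z h s : CC z h 0 s =
  (symo (if s < h then None else onth z (s - h)), if s == h then Some (tm_start M) else None).
Proof.
rewrite /CC /cellof /= tape_init; congr (_, _); last by case: (z).
case: ltnP => // hs; case: (ltnP (s - h) (size z)) => lt.
  have := onthTE z (s - h); rewrite lt; case E: (onth z (s - h)) => [b|//] _.
  by rewrite (nth_map b) //=; congr tm_in; apply: onth_nth E.
by rewrite nth_default ?size_map // onth_default.
Qed.
End Trajectory.

Lemma onth_pair_str x w i : onth (pair_str x w) i =
  if i < 2 * size x then (if i %% 2 == 0 then Some true else onth x (i %/ 2))
  else if i == 2 * size x then Some false else onth w (i - (2 * size x).+1).
Proof.
elim: x i => [|b x IH] i /=; first by case: i => [|i] //=; rewrite subn1.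
rewrite mulnS; case: i => [|[|i]] //=; rewrite -/(pair_str x w) IH.
have -> : (i.+2 < 2 + 2 * size x) = (i < 2 * size x) by lia.
have -> : (i.+2 == 2 + 2 * size x) = (i == 2 * size x) by lia.
have -> : i.+2 %% 2 = i %% 2 by lia.
have -> : i.+2 %/ 2 = (i %/ 2).+1 by lia.
by have -> : i.+2 - (2 + 2 * size x).+1 = i - (2 * size x).+1 by lia.
Qed.

Lemma size_pair_str x w : size (pair_str x w) = (2 * size x + size w).+1.
Proof.
by elim: x => [|b x IH] //=; rewrite -/(pair_str x w) IH; lia.
Qed.

(** * Not-all-equal instances for languages in NP *)

Fixpoint allp (T : Type) (P : T -> Prop) s := if s is a :: s' then P a /\ allp P s' else True.

Lemma allp_cat T (P : T -> Prop) s1 s2 : allp P (s1 ++ s2) <-> allp P s1 /\ allp P s2.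
Proof. by elim: s1 => [|a s1 IH] /=; [split=> [|[]] | rewrite IH; tauto]. Qed.

Lemma allp_map (T1 : eqType) T2 (P : T2 -> Prop) (g : T1 -> T2) s :
  allp P (map g s) <-> forall a, a \in s -> P (g a).
Proof.
elim: s => [|a s IH] /=; first by split.
rewrite IH; split=> [[Ha Hs] b|H]; first by rewrite inE => /predU1P[->|/Hs].
by split=> [|b bs]; apply: H; rewrite inE ?eqxx // bs orbT.
Qed.

Lemma allp_impl T (P Q : T -> Prop) s : (forall a, P a -> Q a) -> allp P s -> allp Q s.
Proof. by move=> H; elim: s => //= a s IH [/H ? /IH]. Qed.

Lemma dB_has_allp T (P : T -> ctx -> bool) s :
  allp (fun a => dB (P a)) s -> dB (fun c => has (P^~ c) s).
Proof.
by elim: s => [_|a s IH] /=; [exact: dB_cst | case=> Ha /IH; exact: dB_or].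
Qed.

Section CookLevin.
Variables (M : TM) (k k2 : nat).

Let A := cell M.
Definition nlen (x : seq bool) := size x.
Definition clen x := poly_bound k (nlen x).
Definition tmax x := poly_bound k2 (2 * nlen x + clen x).+1.
(** The borders of the tableau are unconstrained, so the part known to be correct loses a cell on
    either side at each step. At time [tmax x] the head may be [tmax x] away from its start and must
    still be in that part; hence margins of twice [tmax x] on both sides. *)
Definition hpos x := 2 * tmax x + 1.
Definition wpos x := (hpos x + 2 * nlen x).+1.
Definition width x := hpos x + 2 * tmax x + 2 * nlen x + clen x + 10.

(* Propositional variables: content of a cell, conjunctions of two and of three adjacent
   contents, choice of a certificate bit, and the constant false. *)
Inductive kind := KX of A | KY of A & A | KZ of A & A & A | KW of option bool | KF.
Definition kcode κ : A + A * A + A * A * A + option bool + unit := match κ with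
  | KX a => inl (inl (inl (inl a))) | KY a b => inl (inl (inl (inr (a, b))))
  | KZ a b c => inl (inl (inr (a, b, c))) | KW o => inl (inr o) | KF => inr tt end.
Definition kdecode z := match z with
  | inl (inl (inl (inl a))) => KX a | inl (inl (inl (inr (a, b)))) => KY a b
  | inl (inl (inr (a, b, c))) => KZ a b c | inl (inr o) => KW o | inr tt => KF end.
Lemma kcodeK : cancel kcode kdecode. Proof. by case. Qed.
HB.instance Definition _ := Countable.copy kind (can_type kcodeK).
HB.instance Definition _ : isFinite kind := CanIsFinite kcodeK.

(* a variable or, when the sign is [false], its negation *)
Definition skind : finType := (kind * bool)%type.
Let KN := #|skind|.

Definition nvars x := (tmax x).+1 * width x * KN.
Definition var x t s (κ : skind) := (t * width x + s) * KN + enum_rank κ.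

(* The literal of kind [κ] at time [t + dt] and position [s + ds], or at time and position 0. *)
Inductive lit := At of nat & nat & skind | AtOrigin of skind.
Definition lvar x t s l := match l with
  | At dt ds κ => var x (t + dt) (s + ds) κ | AtOrigin κ => var x 0 0 κ end.
Definition litF := AtOrigin (KF, true).

Record schema := Schema { cond : seq bool -> nat -> nat -> bool; lit1 : lit; lit2 : lit;
  lit3 : lit }.

(** Outside the certificate region the initial tape is known: [pair_str] writes true before each bit
    of [x] and false after the last one, and the rest is blank. *)
Definition fixed o x s := match o with
  | None => (s < hpos x) || (wpos x + clen x <= s)
  | Some b => (hpos x <= s) &&
      ((s < hpos x + 2 * nlen x) &&
         (((s - hpos x) %% 2 == 0) && b ||
          ((s - hpos x) %% 2 == 1) && (onth x ((s - hpos x) %/ 2) == Some b))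
       || (s == hpos x + 2 * nlen x) && ~~ b)
  end.
Definition choice x s := (wpos x <= s) && (s < wpos x + clen x).

Definition plus κ : skind := (κ, true).
Definition minus κ : skind := (κ, false).
Definition obools := [:: None; Some true; Some false].

(* The constraint NAE(¬a, ¬b, y) forces y to hold when a and b do, and is satisfied when y is
   the conjunction of a and b; NAE(¬a, b, F) with F false is the implication from a to b. *)
Definition schemas : seq schema :=
  [seq Schema (fun _ _ _ => true) (At 0 0 (plus κ)) (At 0 0 (minus κ)) (At 0 0 (minus κ)) | κ <-
    enum {: kind}] ++
  [seq Schema (fun x t s => s + 1 < width x)
     (At 0 0 (minus (KX ab.1))) (At 0 1 (minus (KX ab.2))) (At 0 0 (plus (KY ab.1 ab.2))) | ab <-
       enum {: A * A}] ++
  [seq Schema (fun x t s => s + 2 < width x)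
     (At 0 0 (minus (KY abc.1.1 abc.1.2))) (At 0 2 (minus (KX abc.2))) (At 0 0 (plus (KZ abc.1.1
       abc.1.2 abc.2)))
    | abc <- enum {: A * A * A}] ++
  [seq Schema (fun x t s => (t < tmax x) && (s + 2 < width x))
     (At 0 0 (minus (KZ abc.1.1 abc.1.2 abc.2))) (At 1 1 (plus (KX (loc abc.1.1 abc.1.2 abc.2))))
       litF
    | abc <- enum {: A * A * A}] ++
  [seq Schema (fun x t s => [&& t == 0, fixed o x s & s != hpos x])
     (At 0 0 (plus (KX (symo M o, None)))) (At 0 0 (plus (KX (symo M o, None)))) litF | o <-
       obools] ++
  [seq Schema (fun x t s => [&& t == 0, fixed o x s & s == hpos x])
     (At 0 0 (plus (KX (symo M o, Some (tm_start M))))) (At 0 0 (plus (KX (symo M o, Some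
       (tm_start M))))) litF
    | o <- obools] ++
  [seq Schema (fun x t s => (t == 0) && choice x s)
     (At 0 0 (minus (KW o))) (At 0 0 (plus (KX (symo M o, None)))) litF | o <- obools] ++
  [:: Schema (fun x t s => (t == 0) && choice x s)
     (At 0 0 (plus (KW None))) (At 0 0 (plus (KW (Some true)))) (At 0 0 (plus (KW (Some false))));
      Schema (fun x t s => [&& t == 0, choice x s & choice x s.+1])
     (At 0 0 (minus (KW None))) (At 0 1 (plus (KW None))) litF] ++
  [seq Schema (fun x t s => t == tmax x)
     (At 0 0 (minus (KX (qa.2, Some qa.1)))) (At 0 0 (minus (KX (qa.2, Some qa.1)))) litF
    | qa <- enum [pred qa : tm_state M * tm_sym M | ~~ tm_accept M qa.1]].

Definition cl x v1 v2 v3 := has (fun sc => exb (tmax x).+1 (fun t => exb (width x) (fun s =>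
  [&& cond sc x t s, v1 == lvar x t s (lit1 sc), v2 == lvar x t s (lit2 sc) &
      v3 == lvar x t s (lit3 sc)]))) schemas.

Lemma d_clen : dT (fun c => clen c.1).
Proof. by rewrite /clen /poly_bound /nlen; repeat dT_step. Qed.

Lemma d_tmax : dT (fun c => tmax c.1).
Proof. by have := d_clen; rewrite /tmax /poly_bound /nlen => H; repeat dT_step. Qed.

Lemma d_width : dT (fun c => width c.1).
Proof. by have := d_clen; have := d_tmax; rewrite /width /hpos /nlen => H H'; repeat dT_step. Qed.

Lemma d_nvars : dT (fun c => nvars c.1).
Proof. by have := d_width; have := d_tmax; rewrite /nvars => H H'; repeat dT_step. Qed.

Definition dcond (P : seq bool -> nat -> nat -> bool) :=
  forall X Y, dT X -> dT Y -> dB (fun c => P c.1 (X c) (Y c)).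

Lemma d_fixed o X : dT X -> dB (fun c => fixed o c.1 (X c)).
Proof.
move=> HX; have := d_clen; have := d_tmax; rewrite /fixed /wpos /hpos /nlen => ? ?.
by case: o => [b|]; repeat dT_step.
Qed.

Lemma d_choice X : dT X -> dB (fun c => choice c.1 (X c)).
Proof.
by move=> HX; have := d_clen; have := d_tmax; rewrite /choice /wpos /hpos /nlen => ? ?;
  repeat dT_step.
Qed.

Lemma d_schemas : allp (fun sc => dcond (cond sc)) schemas.
Proof.
have dw := d_width; have dt := d_tmax.
have dh : dT (fun c => hpos c.1) by rewrite /hpos; repeat dT_step.
rewrite /schemas !allp_cat !allp_map /=.
do ![split] => //; (try move=> ? _) => X Y HX HY; try (have df o := d_fixed o HY);
  try (have dc := d_choice HY); try (have dc' := d_choice (dTS HY)); try have df1 := df a;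
  rewrite /=; repeat dT_step; try exact: df.
Qed.

Lemma d_cl X Y Z : dT X -> dT Y -> dT Z -> dB (fun c => cl c.1 (X c) (Y c) (Z c)).
Proof.
move=> HX HY HZ; have dw := d_width; have dt := d_tmax.
rewrite /cl; apply: dB_has_allp; apply: allp_impl d_schemas => sc Hsc.
have dl U V l : dT U -> dT V -> dT (fun c => lvar c.1 (U c) (V c) l).
  by move=> HU HV; case: l => [dt' ds κ|κ]; rewrite /lvar /var; repeat dT_step.
repeat dT_step; [apply: Hsc | apply: dl ..]; repeat dT_step.
Qed.

Definition inrange x t s l := match l with
  | At dt ds _ => (t + dt <= tmax x) && (s + ds < width x) | AtOrigin _ => true end.

Lemma width_gt0 x : 0 < width x.
Proof. by rewrite /width addnS. Qed.

Lemma var_lt x t s κ : t <= tmax x -> s < width x -> var x t s κ < nvars x.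
Proof.
move=> ht hs; rewrite /var /nvars; have := ltn_ord (enum_rank κ); rewrite -/KN.
move: (nat_of_ord _) => r hr; have : t * width x + s < (tmax x).+1 * width x by nia.
by move: (_ * width x + s) (_.+1 * width x) => a b; nia.
Qed.

Lemma lvar_lt x t s l : inrange x t s l -> lvar x t s l < nvars x.
Proof.
by case: l => [dt ds κ|κ] => [/andP[h1 h2]|_]; apply: var_lt; rewrite ?width_gt0.
Qed.

Definition naelit x (f : nat -> bool) t s sc :=
  ~~ ((f (lvar x t s (lit1 sc)) == f (lvar x t s (lit2 sc))) &&
      (f (lvar x t s (lit2 sc)) == f (lvar x t s (lit3 sc)))).

Lemma has_allp T (a : pred T) (P : T -> Prop) s : has a s -> allp P s -> exists2 b, a b & P b.
Proof. by elim: s => //= b s IH /orP[ab [Pb _]|/IH H [_ /H]] //; exists b. Qed.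

(** Schemas contain functions and have no decidable equality; that [b] is in the list is rendered by
    saying that every predicate true of [b] is true somewhere in the list. *)
Lemma allp_has T (Q : T -> Prop) s :
  (forall b, (forall a : pred T, a b -> has a s) -> Q b) -> allp Q s.
Proof.
elim: s => //= b s IH H; split; first by apply: H => a ab; rewrite ab.
by apply: IH => b' hb'; apply: H => a /hb' ->; rewrite orbT.
Qed.

Definition sat x f sc := forall t s, t <= tmax x -> s < width x -> cond sc x t s ->
  inrange x t s (lit1 sc) -> inrange x t s (lit2 sc) -> inrange x t s (lit3 sc) ->
  naelit x f t s sc.

Lemma nae_sat x f : nae (nvars x) (cl x) f -> allp (sat x f) schemas.
Proof.
move=> H; apply: allp_has => sc Hsc t s ht hs hc r1 r2 r3.
apply: H; [exact: lvar_lt | exact: lvar_lt | exact: lvar_lt | apply: Hsc].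
apply/exbP; exists t => //; apply/exbP; exists s => //.
by rewrite hc !eqxx.
Qed.

(** A position beyond the width would be the code of a variable of the next row, so the conditions
    have to keep the shifted literals inside the tableau. *)
Lemma cond_offsets : allp (fun sc => forall x t s, cond sc x t s -> t <= tmax x -> s < width x ->
  [&& inrange x t s (lit1 sc), inrange x t s (lit2 sc) & inrange x t s (lit3 sc)]) schemas.
Proof.
have hc x s : choice x s -> s.+1 < width x by rewrite /choice /wpos /width; lia.
rewrite /schemas !allp_cat !allp_map /=.
do ![split] => //; (try move=> ? _) => x t s; rewrite /= ?andbT ?addn0;
  by move=> H h1 h2; rewrite ?h1 ?h2 //=; move: H; try (case/and3P => _ _ /hc); lia.
Qed.

Lemma sat_nae x f : allp (sat x f) schemas -> nae (nvars x) (cl x) f.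
Proof.
move=> H v1 v2 v3 _ _ _ /has_allp Hc.
have : allp (fun sc => sat x f sc /\ forall x t s, cond sc x t s -> t <= tmax x -> s < width x ->
  [&& inrange x t s (lit1 sc), inrange x t s (lit2 sc) & inrange x t s (lit3 sc)]) schemas.
  by elim: schemas H cond_offsets => //= sc s IH [? /IH H] [? /H].
case/Hc => sc /exbP[t ht /exbP[s hs /and4P[hc /eqP -> /eqP -> /eqP ->]]] [Hs Ho].
have /and3P[r1 r2 r3] := Ho x t s hc ht hs.
exact: Hs.
Qed.
End CookLevin.

(** * Tableau constraints and accepting runs *)

Section Equivalence.
Variables (M : TM) (k k2 : nat) (x : seq bool).

Notation tmax := (tmax k k2).
Notation hpos := (hpos k k2).
Notation wpos := (wpos k k2).
Notation width := (width k k2).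
Notation cl := (@cl M k k2).
Notation nvars := (@nvars M k k2).
Notation var := (@var M k k2).
Notation schemas := (schemas M k k2).
Let KN := #|skind M|.

Lemma fixed_onth w s o : size w <= clen k x -> fixed k k2 o x s ->
  (if s < hpos x then None else onth (pair_str x w) (s - hpos x)) = o.
Proof.
move=> hw; rewrite onth_pair_str /fixed /wpos /nlen; case: o => [b|] H.
  have -> : s < hpos x = false by lia.
  case: ifP => h1; first by case: ifP => h2; [congr Some; lia | apply/eqP; lia].
  by case: ifP => h2; [congr Some; lia | lia].
case: ltnP => // h; have -> : s - hpos x < 2 * size x = false by lia.
have -> : s - hpos x == 2 * size x = false by lia.
by rewrite onth_default //; lia.
Qed.

Lemma fixedP s : hpos x <= s < wpos x -> exists o, fixed k k2 o x s.
Proof.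
rewrite /fixed /wpos /nlen => H.
case: (eqVneq s (hpos x + 2 * size x)) => [->|ne]; first by exists (Some false); lia.
case: (eqVneq ((s - hpos x) %% 2) 0) => [E|E].
  by exists (Some true); rewrite E; lia.
have := onthTE x ((s - hpos x) %/ 2); have -> : (s - hpos x) %/ 2 < size x by lia.
case Eb: (onth _ _) => [b|//] _; exists (Some b); rewrite eqxx; lia.
Qed.

Section Complete.
Variable w : seq bool.
Hypothesis hw : size w <= clen k x.
Let z := pair_str x w.
Hypothesis Hacc : tm_accept M (cfg_state (tm_run M (tmax x) z)).

Notation ct t s := (CC M z (hpos x) t s).

Definition intended t s (κ : kind M) : bool := match κ with
  | KX a => ct t s == a
  | KY a b => (ct t s == a) && (ct t s.+1 == b)
  | KZ a b c => [&& ct t s == a, ct t s.+1 == b & ct t s.+2 == c]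
  | KW o => onth w (s - wpos x) == o
  | KF => false end.

Definition tableau v : bool :=
  if @insub nat (fun i => i < KN) 'I_KN (v %% KN) is Some i then
    let: (κ, b) := @enum_val (skind M) predT i in b == intended (v %/ KN %/ width x) (v %/ KN %%
      width x) κ
  else false.

Lemma tableau_var t s κ : s < width x -> tableau (var x t s κ) = (κ.2 == intended t s κ.1).
Proof.
move=> hs; rewrite /tableau /var -/KN; have := ltn_ord (enum_rank κ); rewrite -/KN => hr.
have K0 : 0 < KN by apply: leq_ltn_trans hr.
rewrite modnMDl modn_small // divnMDl // (divn_small hr) addn0.
rewrite divnMDl ?width_gt0 // (divn_small hs) addn0 modnMDl modn_small //.
by rewrite (valK (enum_rank κ)) enum_rankK; case: κ {hr}.
Qed.

Lemma completeness : nae (nvars x) (cl x) tableau.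
Proof.
apply: sat_nae.
have F : tableau (lvar k k2 x 0 0 (litF M)) = false by rewrite /= tableau_var ?width_gt0.
have F' t s : tableau (lvar k k2 x t s (litF M)) = false by [].
have nb (b : bool) : (~~ b == b) = false by case: b.
have W0 : forall s, s < width x -> s + 1 < width x -> s.+1 < width x by move=> *; lia.
rewrite /schemas !allp_cat !allp_map; do ![split] => //.
- move=> κ _ t s ht hs _ _ _ _; rewrite /naelit /= !addn0 !tableau_var //=.
  by case: (intended _ _ _).
- move=> [a b] _ t s ht hs /= hc _ _ _; rewrite /naelit /= !addn0 !tableau_var ?addn1 //=; last
    by lia.
  by case: (_ == a); case: (_ == b).
- move=> [[a b] c] _ t s ht hs /= hc _ _ _; rewrite /naelit /= !addn0 !tableau_var ?addn2 //=;
    last by lia.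
  by case: (_ == a); case: (_ == b); case: (_ == c).
- move=> [[a b] c] _ t s ht hs /= /andP[tt hc] _ _ _;
    rewrite /naelit F' /= !addn0 !tableau_var ?addn1 //=; last by lia.
  rewrite CC_step; last by rewrite /hpos; lia.
  case Ez: [&& _, _ & _]; last by case: (true == _).
  by move/and3P: Ez => [/eqP E1 /eqP E2 /eqP E3]; rewrite E1 E2 E3 eqxx.
- move=> o _ t s ht hs /= /and3P[/eqP -> Hf hne] _ _ _;
    rewrite /naelit F' /= !addn0 !tableau_var //=.
  by rewrite CC0 (fixed_onth hw Hf) (negbTE hne) !eqxx.
- move=> o _ t s ht hs /= /and3P[/eqP -> Hf /eqP he] _ _ _;
    rewrite /naelit F' /= !addn0 !tableau_var //=.
  by rewrite CC0 (fixed_onth hw Hf) he !eqxx.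
- move=> o _ t s ht hs /= /andP[/eqP -> hc] _ _ _; rewrite /naelit F' /= !addn0 !tableau_var //=.
  move: hc; rewrite /choice => /andP[h1 h2].
  rewrite CC0; have -> : s < hpos x = false by move: h1; rewrite /wpos; lia.
  have -> : s == hpos x = false by move: h1; rewrite /wpos; lia.
  have -> : onth z (s - hpos x) = onth w (s - wpos x).
    rewrite onth_pair_str; have -> : s - hpos x < 2 * size x = false by move: h1;
      rewrite /wpos /nlen; lia.
    have -> : s - hpos x == 2 * size x = false by move: h1; rewrite /wpos /nlen; lia.
    by congr onth; rewrite /wpos /nlen; lia.
  case Eo: (onth w _ == o); last by case: (true == _).
  by rewrite (eqP Eo) eqxx.
- move=> t s ht hs /= /andP[/eqP -> hc] _ _ _; rewrite /naelit /= !addn0 !tableau_var //=.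
  by case: (onth _ _) => [[]|].
- move=> t s ht hs /= /and3P[/eqP -> hc hc'] _ h _;
    rewrite /naelit F' /= !addn0 !tableau_var ?addn1 //=; last by lia.
  have -> : s.+1 - wpos x = (s - wpos x).+1 by move: hc; rewrite /choice; lia.
  case Eo: (onth w (s - wpos x) == None); last by case: (true == _).
  move/eqP: Eo => E; suff -> : onth w (s - wpos x).+1 = None by [].
  by apply: onth_default; have := onthNE w (s - wpos x); rewrite E => /esym /leqW.
- move=> [q a]; rewrite mem_enum inE /= => hq t s ht hs /= /eqP -> _ _ _.
  rewrite /naelit F' /= !addn0 !tableau_var //=.
  case Ea: (_ == (a, Some q)) => //; case/negP: hq; move/eqP: Ea;
    rewrite /CC /cellof traj_run => -[_].
  by case: eqP => // _ [<-].
Qed.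
End Complete.

Section Sound.
Variable f : nat -> bool.
Hypothesis Hf : nae (nvars x) (cl x) f.

(* NAE constraints are symmetric, so the constant may be assumed to be false. *)
Definition tval t s κ := f (var x t s κ) != f (var x 0 0 (KF M, true)).

(** These are the schemas read back as implications between positive literals, once the first schema
    has made negative literals the negations of positive ones. *)
Lemma tval_facts :
  [/\ forall t s κ, t <= tmax x -> s < width x -> tval t s (κ, false) = ~~ tval t s (κ, true),
      forall t s a b, t <= tmax x -> s + 1 < width x -> tval t s (plus (KX a)) -> tval t s.+1
        (plus (KX b)) ->
        tval t s (plus (KY a b)),
      forall t s a b c, t <= tmax x -> s + 2 < width x -> tval t s (plus (KY a b)) ->
        tval t s.+2 (plus (KX c)) -> tval t s (plus (KZ a b c)) &
      forall t s a b c, t < tmax x -> s + 2 < width x -> tval t s (plus (KZ a b c)) ->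
        tval t.+1 s.+1 (plus (KX (loc a b c)))] /\
  [/\ forall s o, s < width x -> fixed k k2 o x s ->
        tval 0 s (plus (KX (symo M o, if s == hpos x then Some (tm_start M) else None))),
      forall s o, s < width x -> choice k k2 x s -> tval 0 s (plus (KW M o)) ->
        tval 0 s (plus (KX (symo M o, None))),
      forall s, s < width x -> choice k k2 x s ->
        [|| tval 0 s (plus (KW M None)), tval 0 s (plus (KW M (Some true))) | tval 0 s (plus (KW M
          (Some false)))],
      forall s, s.+1 < width x -> choice k k2 x s -> choice k k2 x s.+1 -> tval 0 s (plus (KW M
        None)) ->
        tval 0 s.+1 (plus (KW M None)) &
      forall s q a, s < width x -> ~~ tm_accept M q -> ~~ tval (tmax x) s (plus (KX (a, Some q)))].
Proof.
have := nae_sat Hf; rewrite /schemas !allp_cat !allp_map.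
case=> H1 [H2 [H3 [H4 [H5 [H6 [H7 [[H8 [H9 _]] H10]]]]]]].
have neg t s κ : t <= tmax x -> s < width x -> tval t s (κ, false) = ~~ tval t s (κ, true).
  move=> ht hs; have := H1 κ; rewrite mem_enum => /(_ isT t s ht hs isT); rewrite /= !addn0 ht hs.
  move=> /(_ isT isT isT); rewrite /naelit /= !addn0 /tval /plus /minus.
  by case: (f _); case: (f _); case: (f _).
have oI o : o \in obools by case: o => [[]|].
split; split=> //.
- move=> t s a b ht hs; have hs' : s < width x by lia.
  have := H2 (a, b); rewrite mem_enum => /(_ isT t s ht hs' hs); rewrite /= !addn0 ht hs hs'.
  move=> /(_ isT isT isT); rewrite /naelit /= !addn0 !addn1.
  have := neg t s (KX a) ht hs'; have := neg t s.+1 (KX b) ht; rewrite addn1 in hs; move=> /(_ hs).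
  by rewrite /tval /plus /minus; case: (f _); case: (f _); case: (f _); case: (f _); case: (f _);
    case: (f _).
- move=> t s a b c ht hs; have hs' : s < width x by lia.
  have := H3 (a, b, c); rewrite mem_enum => /(_ isT t s ht hs' hs); rewrite /= !addn0 ht hs hs'.
  move=> /(_ isT isT isT); rewrite /naelit /= !addn0 !addn2.
  have := neg t s (KY a b) ht hs'; have := neg t s.+2 (KX c) ht; rewrite addn2 in hs;
    move=> /(_ hs).
  by rewrite /tval /plus /minus; case: (f _); case: (f _); case: (f _); case: (f _); case: (f _);
    case: (f _).
- move=> t s a b c ht hs; have hs' : s < width x by lia.
  have hc : (t < tmax x) && (s + 2 < width x) by rewrite ht.
  have := H4 (a, b, c); rewrite mem_enum => /(_ isT t s (ltnW ht) hs' hc).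
  rewrite /= !addn0 !addn1 (ltnW ht) hs' ht => /(_ isT); have -> : s.+1 < width x by lia.
  move=> /(_ isT isT); rewrite /naelit /= !addn0 !addn1.
  have := neg t s (KZ a b c) (ltnW ht) hs'.
  by rewrite /tval /plus /minus; case: (f _); case: (f _); case: (f _); case: (f _).
- move=> s o hs fx; case: eqP => he.
    have := H6 o (oI o) 0 s (leq0n _) hs; rewrite /= fx he eqxx !addn0 -he hs => /(_ isT isT isT
      isT).
    by rewrite /naelit /= !addn0 /tval /plus; case: (f _); case: (f _).
  have := H5 o (oI o) 0 s (leq0n _) hs; rewrite /= fx !addn0 hs; have -> : s != hpos x by apply/eqP.
  move=> /(_ isT isT isT isT).
  by rewrite /naelit /= !addn0 /tval /plus; case: (f _); case: (f _).
- move=> s o hs fx; have := H7 o (oI o) 0 s (leq0n _) hs;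
    rewrite /= fx !addn0 hs => /(_ isT isT isT isT).
  rewrite /naelit /= !addn0; have := neg 0 s (KW M o) (leq0n _) hs.
  by rewrite /tval /plus /minus; case: (f _); case: (f _); case: (f _); case: (f _).
- move=> s hs fx; have := H8 0 s (leq0n _) hs; rewrite /= fx !addn0 hs => /(_ isT isT isT isT).
  by rewrite /naelit /= !addn0 /tval /plus; case: (f _); case: (f _); case: (f _); case: (f _).
- move=> s hs c1 c2; have hs' := ltnW hs.
  have := H9 0 s (leq0n _) hs'; rewrite /= c1 c2 !addn0 addn1 hs hs' => /(_ isT isT isT isT).
  rewrite /naelit /= !addn0 !addn1; have := neg 0 s (KW M None) (leq0n _) hs'.
  by rewrite /tval /plus /minus; case: (f _); case: (f _); case: (f _); case: (f _).
- move=> s q a hs hq; have := H10 (q, a); rewrite mem_enum inE => /(_ hq (tmax x) s (leqnn _) hs).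
  rewrite /= eqxx !addn0 leqnn hs => /(_ isT isT isT isT); rewrite /naelit /= !addn0.
  have := neg (tmax x) s (KX (a, Some q)) (leqnn _) hs.
  by rewrite /tval /plus /minus; case: (f _); case: (f _); case: (f _).
Qed.

Lemma sound : exists2 w, size w <= clen k x &
  tm_accept M (cfg_state (tm_run M (tmax x) (pair_str x w))).
Proof.
have [[neg conj2 conj3 step] [fix0 wit cho nxt fin]] := tval_facts.
pose isN j := tval 0 (wpos x + j) (plus (KW M None)).
pose p := clen k x.
have wW j : j < p -> (wpos x + j).+1 < width x by rewrite /width /wpos /p; lia.
have ch j : j < p -> choice k k2 x (wpos x + j) by rewrite /choice /p; lia.
(* The certificate ends at the first cell marked [None]; the mark propagates to the right, so all
   later cells of the region carry it, and the earlier ones hold a bit. *)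
pose j0 := find isN (iota 0 p).
have j0p : j0 <= p by rewrite -[X in _ <= X](size_iota 0 p) find_size.
have before j : j < j0 -> ~~ isN j.
  move=> lt; have := before_find 0 lt; rewrite nth_iota ?add0n => [->//|].
  exact: leq_trans lt j0p.
have after j : j0 <= j -> j < p -> isN j.
  move=> le lt; have hj : j0 < p by apply: leq_ltn_trans lt.
  have h0 : isN j0.
    have hh : has isN (iota 0 p) by rewrite has_find size_iota.
    by have := nth_find 0 hh; rewrite nth_iota ?add0n.
  elim: j le lt => [|j IH]; first by rewrite leqn0 => /eqP <-.
  rewrite leq_eqVlt => /predU1P[<- //|le lt]; rewrite /isN addnS.
  by apply: nxt; [apply: wW; lia | apply: ch; lia | rewrite -addnS; apply: ch | apply: IH => //;
    lia].
pose w := mkseq (fun j => tval 0 (wpos x + j) (plus (KW M (Some true)))) j0.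
exists w; first by rewrite size_mkseq.
have wv j : j < p -> tval 0 (wpos x + j) (plus (KW M (onth w j))).
  move=> lt; case: (ltnP j j0) => h; last by rewrite onth_default ?size_mkseq //; exact: after.
  have -> : onth w j = Some (tval 0 (wpos x + j) (plus (KW M (Some true)))).
    by rewrite onthE (nth_map false) ?size_mkseq // nth_mkseq.
  have := cho _ (ltnW (wW _ lt)) (ch _ lt); rewrite -/(isN j) (negbTE (before j h)) /=.
  by case E: (tval _ _ (plus (KW M (Some true)))) => //= H; rewrite E.
have init s : s < width x -> tval 0 s (plus (KX (CC M (pair_str x w) (hpos x) 0 s))).
  move=> hs; rewrite CC0.
  have sw : size w <= clen k x by rewrite size_mkseq.
  have viafix o : fixed k k2 o x s -> tval 0 s
     (plus (KX (symo M (if s < hpos x then None else onth (pair_str x w) (s - hpos x)),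
             if s == hpos x then Some (tm_start M) else None))).
    by move=> fo; rewrite (fixed_onth sw fo); exact: fix0.
  case: (ltnP s (hpos x)) => h1; first by have := viafix None; rewrite /fixed h1; apply.
  case: (ltnP s (wpos x)) => h2.
    by have [|o fo] := @fixedP s; [rewrite h1 | have := viafix o fo; rewrite ltnNge h1].
  case: (ltnP s (wpos x + p)) => h3; last first.
    by have := viafix None; rewrite /fixed -/p h3 orbT ltnNge h1; apply.
  have -> : s == hpos x = false by move: h2; rewrite /wpos; lia.
  have [j lt Es] : exists2 j, j < p & s = wpos x + j by exists (s - wpos x); lia.
  rewrite Es onth_pair_str.
  have -> : wpos x + j - hpos x < 2 * size x = false by rewrite /wpos /nlen; lia.
  have -> : wpos x + j - hpos x == 2 * size x = false by rewrite /wpos /nlen; lia.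
  have -> : wpos x + j - hpos x - (2 * size x).+1 = j by rewrite /wpos /nlen; lia.
  by apply: wit; [apply: ltnW; apply: wW | apply: ch | apply: wv].
(* The induction shrinks the range of cells by one at each end, as a cell is derived from its two
   neighbours one step earlier. *)
have run t s : t <= tmax x -> t <= s -> s + t < width x ->
    tval t s (plus (KX (CC M (pair_str x w) (hpos x) t s))).
  elim: t s => [|t IH] s ht hts hs; first by apply: init; lia.
  case: s hts hs => // s hts hs; rewrite CC_step; last by rewrite /hpos; lia.
  apply: step => //; first by lia.
  apply: conj3; [lia | lia | apply: conj2; [lia | lia | apply: IH; lia | apply: IH;
    lia] | apply: IH; lia].
have hd := traj_head M (pair_str x w) (hpos x) (tmax x).
set T := tmax x in hd *; set h := (traj M (pair_str x w) (hpos x) T).2 in hd.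
have h1 : T <= h by move: hd; rewrite /hpos -/T; lia.
have h2 : h + T < width x by move: hd; rewrite /width /hpos -/T; lia.
have := run T h (leqnn _) h1 h2; rewrite /CC /cellof -/h eqxx traj_run.
case Ha: (tm_accept M _) => // Hv; have := fin h _ (tape (tm_run M T (pair_str x w)) h h) _ (negbT
  Ha).
by rewrite Hv => /(_ ltac:(lia)).
Qed.
End Sound.
End Equivalence.

Lemma poly_bound_mono k m n : m <= n -> poly_bound k m <= poly_bound k n.
Proof. by move=> le; rewrite leq_add2r; case: k => // k; rewrite leq_exp2r. Qed.

Theorem Helly_B1_EPG_hard : NP_hard Helly_B1_EPG_recognition.
Proof.
move=> L [V [k [[M [k2 HM]] HL]]].
have [h [hp hE]] := nae_reduction (d_nvars M k k2) (@d_cl M k k2).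
exists h; split=> // x; rewrite hE HL.
have acc w : size w <= clen k x -> (tm_accept M (cfg_state (tm_run M (tmax k k2 x) (pair_str x
  w))) <-> V (pair_str x w)).
  move=> hw; have [Hh <-] := HM (pair_str x w).
  (* [tmax] is the time allowed for the longest certificate; for a shorter one the machine has
     halted before and stays in its final configuration. *)
  rewrite (@tm_run_halted M _ (poly_bound k2 (size (pair_str x w))) (tmax k k2 x)) //.
  by apply: poly_bound_mono; rewrite size_pair_str ltnS leq_add2l.
split=> [[w [hw /(acc w hw) Hw]]|[f /sound[w hw /(acc w hw) Hw]]]; last by exists w.
by exists (tableau M k k2 x w); apply: completeness.
Qed.

(** * Certificates *)

Section Compression.
Variables (n : nat) (adj : rel 'I_n) (σ : 'I_n -> shape).
Hypothesis Hσ : shape_rep adj σ.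

(* the coordinates used along the axis of direction [h] *)
Definition coords h : seq int :=
  flatten [seq [:: lo (σ v) h; hi (σ v) h; ln (σ v) (~~ h)] | v <- enum 'I_n].

(** Counting the smaller coordinates, with multiplicity, keeps order and equality among the
    coordinates that occur, and the ranks are at most [3 * n]. *)
Definition rk h (z : int) := count (fun y => (y < z)%R) (coords h).

Lemma size_coords h : size (coords h) = 3 * n.
Proof.
rewrite /coords -[in RHS](size_enum_ord n).
by elim: (enum _) => [|v s IH] //=; rewrite IH mulnS.
Qed.

Lemma rk_lt_bound h z : rk h z < 3 * n + 1.
Proof. by rewrite addn1 ltnS -(size_coords h) count_size. Qed.

Lemma coords_mem h v : [/\ lo (σ v) h \in coords h, hi (σ v) h \in coords h & ln (σ v) (~~ h) \in
  coords h].
Proof.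
have H z : z \in [:: lo (σ v) h; hi (σ v) h; ln (σ v) (~~ h)] -> z \in coords h.
  by move=> zin; apply/flatten_mapP; exists v; rewrite ?mem_enum.
by split; apply: H; rewrite !inE eqxx ?orbT.
Qed.

Lemma rk_le h y z : (y <= z)%R -> rk h y <= rk h z.
Proof. by move=> le; apply: sub_count => w /=; lia. Qed.

Lemma rk_lt h y z : y \in coords h -> (y < z)%R -> rk h y < rk h z.
Proof.
rewrite /rk; elim: (coords h) => //= a s IH; rewrite inE => /predU1P[<-|/IH{}IH] lt.
  have -> : (y < y)%R = false by lia.
  rewrite lt add0n add1n ltnS; apply: sub_count => w /=; lia.
have Ha : (a < y)%R ==> (a < z)%R by lia.
by have := IH lt; move: Ha; case: (a < y)%R; case: (a < z)%R => //=; lia.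
Qed.

Lemma rk_ltE h y z : y \in coords h -> (rk h y < rk h z) = (y < z)%R.
Proof. by move=> yin; apply/idP/idP => [|/(rk_lt yin)//]; rewrite Order.TotalTheory.ltNge => H;
  apply/negP => /(rk_le h); lia. Qed.

Lemma rk_eqE h y z : y \in coords h -> z \in coords h -> (rk h y == rk h z) = (y == z).
Proof.
move=> yin zin; case: (Order.TotalTheory.ltgtP y z) => [/(rk_lt yin)|/(rk_lt zin)|->];
  rewrite ?eqxx //; lia.
Qed.

Definition cshape v h := (rk (~~ h) (ln (σ v) h), rk h (lo (σ v) h), rk h (hi (σ v) h)).

Definition zshape (s : bool -> nat * nat * nat) : shape :=
  fun h => let: (l, a, b) := s h in (l%:Z, a%:Z, b%:Z)%R.

Lemma zshapeE v h : [/\ ln (zshape (cshape v)) h = rk (~~ h) (ln (σ v) h),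
  lo (zshape (cshape v)) h = rk h (lo (σ v) h) & hi (zshape (cshape v)) h = rk h (hi (σ v) h)].
Proof. by []. Qed.

Lemma compress_rep : shape_rep adj (fun v => zshape (cshape v)).
Proof.
have [Hv Ha HH] := Hσ.
have mem v h : [/\ lo (σ v) h \in coords h, hi (σ v) h \in coords h & ln (σ v) h \in coords (~~ h)].
  by have [h1 h2 _] := coords_mem h v; have [_ _ h3] := coords_mem (~~ h) v; rewrite negbK in h3.
have lt u v h : (rk h (lo (σ u) h) < rk h (hi (σ v) h)) = (lo (σ u) h < hi (σ v) h)%R.
  by have [h1 h2 h3] := mem u h; rewrite rk_ltE.
have ov u v h : ovl (zshape (cshape u)) (zshape (cshape v)) h = ovl (σ u) (σ v) h.
  have [u1 u2 u3] := mem u h; have [v1 v2 v3] := mem v h.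
  have := rk_eqE u3 v3; have := lt u u h; have := lt v v h; have := lt u v h; have := lt v u h.
  by rewrite /ovl; have [-> -> ->] := zshapeE u h; have [-> -> ->] := zshapeE v h; lia.
have mt u v : meets (zshape (cshape u)) (zshape (cshape v)) <-> meets (σ u) (σ v).
  by rewrite !meets_ovl !ov.
split=> [v|u v uv|S HS].
- have := Hv v; rewrite /valid.
  have [-> -> ->] := zshapeE v true; have [-> -> ->] := zshapeE v false.
  have [v1 v2 v3] := mem v true; have [w1 w2 w3] := mem v false.
  have := lt v v true; have := lt v v false.
  have := rk_eqE w3 v1; have := rk_eqE w3 v2; have := rk_eqE v3 w1; have := rk_eqE v3 w2.
  by rewrite /=; lia.
- by rewrite Ha // mt.
have [|h [c [x Hx]]] := HH S; first by move=> u v uS vS; apply/mt; apply: HS.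
(* The position [x] need not be a coordinate. The unit edge ending at the rank of [x + 1] is common
   to all: [lo <= x < x + 1] puts the rank of [lo] strictly below it, and [x + 1 <= hi] keeps it
   within the segment. *)
exists h, (rk (~~ h) c)%:Z%R, ((rk h (x + 1)%R).-1)%:Z%R => u uS.
have := Hx u uS; rewrite /ins => /andP[/eqP -> hx]; have [-> -> ->] := zshapeE u h.
rewrite eqxx /=; have [u1 u2 u3] := mem u h.
have h1 : rk h (lo (σ u) h) < rk h (x + 1)%R by apply: rk_lt => //; lia.
have h2 : rk h (x + 1)%R <= rk h (hi (σ u) h) by apply: rk_le; lia.
lia.
Qed.
End Compression.

(* Gilmore's criterion: in a minimal counterexample [S], a common element of [S] minus a
   member is missed by that member only, so three of these lie, two at a time, in all of [S]. *)
Lemma gilmore (T : finType) (E : Type) (ok : E -> Prop) (P : T -> E -> bool) :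
  (exists e, ok e) ->
  (forall e1 e2 e3, ok e1 -> ok e2 -> ok e3 -> exists2 g, ok g & forall v,
     [|| P v e1 && P v e2, P v e1 && P v e3 | P v e2 && P v e3] -> P v g) ->
  forall S : {set T}, (forall u v, u \in S -> v \in S -> exists2 e, ok e & P u e && P v e) ->
  exists2 e, ok e & forall u, u \in S -> P u e.
Proof.
move=> [e0 ok0] H3 S; move: {2}#|S| (leqnn #|S|) => m; elim: m S => [|m IH] S.
  by rewrite leqn0 cards_eq0 => /eqP -> _; exists e0 => // u; rewrite inE.
move=> le HS; have [lt|] := leqP #|S| 2; last first.
  case/card_gt2P => a [b [c [[aS bS cS] [ab bc ca]]]].
  have D z : z \in S -> exists2 e, ok e & forall u, u \in S -> u != z -> P u e.
    move=> zS; have [||e oke He] := IH (S :\ z).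
    - by move: le; rewrite (cardsD1 z) zS.
    - by move=> u v; rewrite !inE => /andP[_ uS] /andP[_ vS]; exact: HS.
    by exists e => // u uS uz; apply: He; rewrite !inE uz.
  have [ea oa Ha] := D a aS; have [eb ob Hb] := D b bS; have [ec oc Hc] := D c cS.
  have [g okg Hg] := H3 ea eb ec oa ob oc; exists g => // u uS; apply: Hg.
  have [ua|ua] := eqVneq u a; first by rewrite ua (Hb a aS ab) (Hc a aS) ?orbT // eq_sym.
  rewrite (Ha u uS ua); have [ub|ub] := eqVneq u b; first by rewrite ub (Hc b bS bc) orbT.
  by rewrite (Hb u uS ub).
have [|e He] := @helly_card_le2 _ _ (fun u (e : {e | ok e}) => P u (sval e)) S (exist _ _ ok0) lt.
  by move=> u v uS vS; have [e oke /andP[h1 h2]] := HS u v uS vS; exists (exist _ e oke).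
by exists (sval e); [exact: svalP | exact: He].
Qed.

(** * The certificate check *)

Definition validn l1 a1 b1 l0 a0 b0 := ((a1 < b1) || (a0 < b0)) &&
  ((a1 < b1) ==> (a0 < b0) ==> ((l0 == a1) || (l0 == b1)) && ((l1 == a0) || (l1 == b0))).

Definition chk_graph n (X : nat -> bool) :=
  allb n (fun i => allb n (fun j => X (i * n + j) == X (j * n + i))) &&
  allb n (fun i => ~~ X (i * n + i)).

(** The incidence table does not contain the shapes; the six coordinates of a path are found by
    exhaustive search, which takes only [m ^ 6] attempts. The direction is coded by 1 for horizontal
    and 0 for vertical. *)
Definition chk_shapes n m (E : nat -> nat -> nat -> nat -> bool) :=
  allb n (fun v => exb m (fun l1 => exb m (fun a1 => exb m (fun b1 =>
   exb m (fun l0 => exb m (fun a0 => exb m (fun b0 => validn l1 a1 b1 l0 a0 b0 &&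
   allb m (fun c => allb m (fun x =>
    (E v 1 c x == ((c == l1) && ((a1 <= x) && (x < b1)))) &&
    (E v 0 c x == ((c == l0) && ((a0 <= x) && (x < b0))))))))))))).

Definition chk_adj n m (X : nat -> bool) (E : nat -> nat -> nat -> nat -> bool) :=
  allb n (fun u => allb n (fun v => (u != v) ==>
    (X (u * n + v) == exb 2 (fun h => exb m (fun c => exb m (fun x => E u h c x && E v h c x)))))).

Definition chk_helly n m (E : nat -> nat -> nat -> nat -> bool) :=
  allb 2 (fun h1 => allb m (fun c1 => allb m (fun x1 =>
  allb 2 (fun h2 => allb m (fun c2 => allb m (fun x2 =>
  allb 2 (fun h3 => allb m (fun c3 => allb m (fun x3 =>
  exb 2 (fun h => exb m (fun c => exb m (fun x => allb n (fun v =>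
    (E v h1 c1 x1 && E v h2 c2 x2) || ((E v h1 c1 x1 && E v h3 c3 x3) ||
     (E v h2 c2 x2 && E v h3 c3 x3)) ==> E v h c x))))))))))))).

Definition check n m X E :=
  chk_graph n X && (chk_shapes n m E && (chk_adj n m X E && chk_helly n m E)).

Section CheckCorrect.
Variables (n m : nat) (X : nat -> bool) (E : nat -> nat -> nat -> nat -> bool).
Hypothesis m0 : 0 < m.
Let adj : rel 'I_n := fun i j => X (i * n + j).

Definition bnd (e : nat * nat * nat) := [/\ e.1.1 < 2, e.1.2 < m & e.2 < m].

Lemma check_sound : check n m X E -> simple_graph adj /\ exists σ, shape_rep adj σ.
Proof.
case/and4P => /andP[/allbP g1 /allbP g2] /allbP Hs /allbP Ha Hh.
split.
  split=> [i j|i]; last by apply: negbTE; exact: g2.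
  by have /allbP/(_ j (ltn_ord j))/eqP := g1 i (ltn_ord i).
have : forall v : 'I_n, exists σ, valid σ /\ forall (h : bool) c x, 
    (c < m -> x < m -> E v h c x = ins σ h c%:Z%R x%:Z%R) /\
    forall (c x : int), ins σ h c x -> exists2 cx : nat * nat, cx.1 < m /\ cx.2 < m & 
        c = cx.1%:Z%R /\ x = cx.2%:Z%R.
  move=> v; have := Hs v (ltn_ord v).
  move=> /exbP[l1 hl1 /exbP[a1 ha1 /exbP[b1 hb1 /exbP[l0 hl0 /exbP[a0 ha0 /exbP[b0 hb0]]]]]].
  case/andP=> Hval /allbP HE.
  exists (zshape (fun h => if h then (l1, a1, b1) else (l0, a0, b0))); split.
    by move: Hval; rewrite /valid /validn /ln /lo /hi /=; lia.
  move=> h c x; split.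
    move=> hc hx; have /allbP/(_ x hx)/andP[/eqP e1 /eqP e2] := HE c hc.
    by rewrite /ins /ln /lo /hi; case: h; rewrite /= ?e1 ?e2; lia.
  rewrite /ins /ln /lo /hi => c' x' H; exists (`|c'|, `|x'|)%N; move: H; case: h => /=; lia.
case/fin_all_exists => σ Hσ.
have Em (v : 'I_n) e : bnd e -> E v e.1.1 e.1.2 e.2 = ins (σ v) (e.1.1 == 1) e.1.2%:Z%R e.2%:Z%R.
  move=> [e1 e2 e3]; have [H _] := (Hσ v).2 (e.1.1 == 1) e.1.2 e.2; rewrite -H //.
  by case: (e.1.1) e1 => [|[|]].
have mt u v : meets (σ u) (σ v) <-> exists2 e, bnd e & E u e.1.1 e.1.2 e.2 && E v e.1.1 e.1.2 e.2.
  split=> [[h [c [x [H1 H2]]]]|[e be]]; last first.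
    by rewrite !Em // => /andP[? ?]; exists (e.1.1 == 1), e.1.2%:Z%R, e.2%:Z%R.
  have [_ H] := (Hσ u).2 h 0 0; have [[c' x'] [hc hx] [Ec Ex]] := H _ _ H1.
  have be : bnd (nat_of_bool h, c', x') by split=> //; case: (h).
  by exists (nat_of_bool h, c', x') => //; rewrite !Em //= eqb1 -Ec -Ex H1 H2.
exists σ; split=> [v|u v uv|S HS]; first by have [] := Hσ v.
  have /allbP/(_ v (ltn_ord v)) := Ha u (ltn_ord u).
  rewrite mt /adj uv /= => /eqP ->; split.
    by move=> /exbP[h hh /exbP[c hc /exbP[x hx He]]]; exists (h, c, x).
  move=> [[[h c] x] [hh hc hx] He].
  by apply/exbP; exists h => //; apply/exbP; exists c => //; apply/exbP; exists x.
pose P (v : 'I_n) (e : nat * nat * nat) := E v e.1.1 e.1.2 e.2.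
have ex0 : exists e, bnd e by exists (0, 0, 0).
have G e1 e2 e3 : bnd e1 -> bnd e2 -> bnd e3 -> exists2 g, bnd g & forall v,
     [|| P v e1 && P v e2, P v e1 && P v e3 | P v e2 && P v e3] -> P v g.
  case: e1 e2 e3 => [[h1 c1] x1] [[h2 c2] x2] [[h3 c3] x3].
  move=> [/= hh1 hc1 hx1] [/= hh2 hc2 hx2] [/= hh3 hc3 hx3].
  move: Hh => /allbP/(_ h1 hh1)/allbP/(_ c1 hc1)/allbP/(_ x1 hx1)/allbP/(_ h2 hh2)/allbP/(_ c2 hc2).
  move=> /allbP/(_ x2 hx2)/allbP/(_ h3 hh3)/allbP/(_ c3 hc3)/allbP/(_ x3 hx3).
  move=> /exbP[h hh /exbP[c hc /exbP[x hx /allbP He]]]; exists (h, c, x) => // v Hv.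
  exact: (implyP (He v (ltn_ord v))).
have [|e be He] := gilmore ex0 G (S := S); first by move=> u v uS vS; apply/mt; exact: HS.
exists (e.1.1 == 1), e.1.2%:Z%R, e.2%:Z%R => u uS.
by rewrite -Em //; exact: He.
Qed.

Lemma check_complete (τ : 'I_n -> bool -> nat * nat * nat) : simple_graph adj ->
  shape_rep adj (fun v => zshape (τ v)) ->
  (forall v h, [/\ (τ v h).1.1 < m, (τ v h).1.2 < m & (τ v h).2 < m]) ->
  (forall (v : 'I_n) h c x, c < m -> x < m -> h < 2 -> E v h c x = ins (zshape (τ v)) (h == 1)
    c%:Z%R x%:Z%R) ->
  check n m X E.
Proof.
move=> [Hsym Hirr] [Hv Ha HH] Hb HE.
have insn (v : 'I_n) h c x : ins (zshape (τ v)) h c%:Z%R x%:Z%R =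
    [&& c == (τ v h).1.1, (τ v h).1.2 <= x & x < (τ v h).2].
  by rewrite /ins /ln /lo /hi /zshape; case: (τ v h) => [[l a] b] /=; lia.
have insz (v : 'I_n) h (c x : int) : ins (zshape (τ v)) h c x -> exists c' x' : nat,
    [/\ c' < m, x' < m, c = c'%:Z%R & x = x'%:Z%R].
  have := Hb v h; rewrite /ins /ln /lo /hi /zshape; case: (τ v h) => [[l a] b] /= [h1 h2 h3] H.
  by exists `|c|%N, `|x|%N; split; lia.
have ordP (P : nat -> bool) : (forall v : 'I_n, P v) -> allb n P.
  by move=> H; apply/allbP => i lt; exact: (H (Ordinal lt)).
apply/and4P; split.
- apply/andP; split; first by apply: (ordP _) => i; apply: (ordP _) => j; apply/eqP;
    exact: (Hsym i j).
  by apply: (ordP _) => i; apply: negbT; exact: (Hirr i).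
- apply: (ordP _) => v; have [a1 a2 a3] := Hb v true; have [b1 b2 b3] := Hb v false.
  apply/exbP; exists (τ v true).1.1 => //; apply/exbP; exists (τ v true).1.2 => //.
  apply/exbP; exists (τ v true).2 => //; apply/exbP; exists (τ v false).1.1 => //.
  apply/exbP; exists (τ v false).1.2 => //; apply/exbP; exists (τ v false).2 => //.
  apply/andP; split.
    have := Hv v; rewrite /valid /validn /ln /lo /hi /zshape.
    by case: (τ v true) => [[? ?] ?]; case: (τ v false) => [[? ?] ?] /=; lia.
  apply/allbP => c hc; apply/allbP => x hx; rewrite !HE // !insn.
  by rewrite !eqxx.
- apply: (ordP _) => u; apply: (ordP _) => v; apply/implyP => uv.
  have {}uv : u != v by apply: contraNneq uv => ->.
  have := Ha u v uv; rewrite /adj => H; apply/eqP; apply/idP/idP.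
    move/H => [h [c [x [H1 H2]]]]; have [c' [x' [hc hx Ec Ex]]] := insz _ _ _ _ H1.
    apply/exbP; exists (nat_of_bool h); first by case: (h).
    apply/exbP; exists c' => //; apply/exbP; exists x' => //.
    by rewrite !HE //; [rewrite eqb1 -Ec -Ex H1 H2 | case: (h) ..].
  move=> /exbP[h hh /exbP[c hc /exbP[x hx]]]; rewrite !HE // => /andP[H1 H2].
  by apply/H; exists (h == 1), c%:Z%R, x%:Z%R.
apply/allbP => h1 hh1; apply/allbP => c1 hc1; apply/allbP => x1 hx1.
apply/allbP => h2 hh2; apply/allbP => c2 hc2; apply/allbP => x2 hx2.
apply/allbP => h3 hh3; apply/allbP => c3 hc3; apply/allbP => x3 hx3.
(* Each member uses two of the three edges, so any two members have one of them in common, and the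
   Helly condition applies to [S]. *)
pose S := [set v : 'I_n | (E v h1 c1 x1 && E v h2 c2 x2) || ((E v h1 c1 x1 && E v h3 c3 x3) ||
     (E v h2 c2 x2 && E v h3 c3 x3))].
have [|h [c [x He]]] := HH S.
  have M (u v : 'I_n) h c x : h < 2 -> c < m -> x < m -> E u h c x -> E v h c x ->
      meets (zshape (τ u)) (zshape (τ v)).
    by move=> hh hc hx; rewrite !HE // => H1 H2; exists (h == 1), c%:Z%R, x%:Z%R.
  move=> u v; rewrite !inE => Hu Hv'.
  case: (boolP (E u h1 c1 x1 && E v h1 c1 x1)) => [/andP[]|n1]; first exact: M.
  case: (boolP (E u h2 c2 x2 && E v h2 c2 x2)) => [/andP[]|n2]; first exact: M.
  case: (boolP (E u h3 c3 x3 && E v h3 c3 x3)) => [/andP[]|n3]; first exact: M.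
  move: Hu Hv' n1 n2 n3.
  case: (E u h1 c1 x1); case: (E u h2 c2 x2); case: (E u h3 c3 x3); rewrite //=;
  by case: (E v h1 c1 x1); case: (E v h2 c2 x2); case: (E v h3 c3 x3).
have [S0|[u uS]] := set_0Vmem S.
  apply/exbP; exists 0 => //; apply/exbP; exists 0 => //; apply/exbP; exists 0 => //.
  by apply: (ordP _) => v; apply/implyP => Hv'; have : v \in S; [rewrite inE | rewrite S0 inE].
have [c' [x' [hc hx Ec Ex]]] := insz _ _ _ _ (He u uS).
apply/exbP; exists (nat_of_bool h); first by case: (h).
apply/exbP; exists c' => //; apply/exbP; exists x' => //.
apply: (ordP _) => v; apply/implyP => Hv'; rewrite HE //; last by case: (h).
by rewrite eqb1 -Ec -Ex; apply: He; rewrite inE.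
Qed.
End CheckCorrect.

Definition xbit (y : seq bool) i := onth y (2 * i + 1) == Some true.
Definition ebit (y : seq bool) m n v h c x :=
  onth y ((2 * m).+1 + (((v * n + c) * n + x) * 2 + h)) == Some true.

(** The length [m] of the first word is recovered as the first [m] with false at position [2 * m];
    it has to be a square, as the word is an adjacency matrix. *)
Definition verify y := exb (size y) (fun m =>
  (onth y (2 * m) == Some false) && (allb m (fun i => onth y (2 * i) == Some true) &&
  exb m.+1 (fun n => (n * n == m) && check n (3 * n + 1) (xbit y) (ebit y m (3 * n + 1))))).

Lemma d_verify : dB (fun c => verify c.1).
Proof.
rewrite /verify /check /chk_graph /chk_shapes /chk_adj /chk_helly /validn /xbit /ebit.
by repeat dT_step.
Qed.

Lemma verify_pair x w : verify (pair_str x w) <->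
  exists2 n, n * n = size x & check n (3 * n + 1) (fun i => nth false x i)
    (fun v h c z => onth w (((v * (3 * n + 1) + c) * (3 * n + 1) + z) * 2 + h) == Some true).
Proof.
have ev i : i < size x -> onth (pair_str x w) (2 * i) = Some true.
  move=> lt; rewrite onth_pair_str; have -> : 2 * i < 2 * size x by lia.
  by have -> : (2 * i) %% 2 = 0 by lia.
have sep : onth (pair_str x w) (2 * size x) = Some false.
  by rewrite onth_pair_str ltnn eqxx.
have chk n : n * n = size x -> check n (3 * n + 1) (xbit (pair_str x w))
     (ebit (pair_str x w) (size x) (3 * n + 1)) =
   check n (3 * n + 1) (fun i => nth false x i)
    (fun v h c z => onth w (((v * (3 * n + 1) + c) * (3 * n + 1) + z) * 2 + h) == Some true).
  move=> En.
  have -> : ebit (pair_str x w) (size x) (3 * n + 1) = fun v h c z =>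
      onth w (((v * (3 * n + 1) + c) * (3 * n + 1) + z) * 2 + h) == Some true.
    do 4 (apply: functional_extensionality => ?); rewrite /ebit onth_pair_str.
    set k := (_ * 2 + _); have -> : (2 * size x).+1 + k < 2 * size x = false by lia.
    have -> : (2 * size x).+1 + k == 2 * size x = false by lia.
    by rewrite addKn.
  have HX i : i < size x -> xbit (pair_str x w) i = nth false x i.
    move=> lt; rewrite /xbit onth_pair_str; have -> : 2 * i + 1 < 2 * size x by lia.
    have -> : (2 * i + 1) %% 2 == 0 = false by lia.
    have -> : (2 * i + 1) %/ 2 = i by lia.
    have := onthTE x i; rewrite lt; case E: (onth x i) => [b|//] _.
    have -> : nth false x i = b by exact: onth_nth E.
    by case: (b).
  have lt2 i j : i < n -> j < n -> i * n + j < size x by rewrite -En; nia.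
  rewrite /check; congr (_ && (_ && (_ && _))).
    congr (_ && _); apply: eq_in_all => i; rewrite mem_iota /= add0n => hi; last by rewrite HX ?lt2.
    by apply: eq_in_all => j; rewrite mem_iota /= add0n => hj; rewrite !HX ?lt2.
  apply: eq_in_all => i; rewrite mem_iota /= add0n => hi.
  by apply: eq_in_all => j; rewrite mem_iota /= add0n => hj; rewrite HX ?lt2.
split=> [/exbP[m hm /and3P[/eqP e1 /allbP e2 /exbP[n hn /andP[/eqP En Hc]]]]|[n En Hc]].
  have Em : m = size x.
    case: (ltngtP m (size x)) => // lt; first by rewrite ev in e1.
    by have := e2 _ lt; rewrite sep.
  by rewrite Em in En Hc; exists n; rewrite -?chk.
apply/exbP; exists (size x); first by rewrite size_pair_str; lia.
rewrite sep eqxx /=; apply/andP; split; first by apply/allbP => i /ev ->.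
apply/exbP; exists n; first by rewrite -En ltnS; nia.
by rewrite En eqxx chk.
Qed.

Theorem Helly_B1_EPG_in_NP : in_NP Helly_B1_EPG_recognition.
Proof.
(* The certificate has [n * m * m * 2] bits with [m = 3 * n + 1]; since [n <= n * n], the input
   length [s = n * n] may replace [n] in the bound. *)
have [k Hk] : exists k, forall s, s * (3 * s + 1) * (3 * s + 1) * 2 <= poly_bound k s.
  by apply: poly_bound_poly; solve_poly.
exists (fun y => verify y), k; split; first by exact: (dB_in_P (P := fun c => verify c.1) d_verify).
move=> x; split=> [[n [adj [Hs [-> /shape_repP[σ Hσ]]]]]|[w [_ /verify_pair[n En Hc]]]].
  have Hn : n <= n * n by nia.
  set m := 3 * n + 1; set τ := cshape σ.
  pose w := mkseq (fun i => if @insub nat (fun v => v < n) 'I_n (i %/ 2 %/ m %/ m) is Some v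
     then ins (zshape (τ v)) (i %% 2 == 1) (i %/ 2 %/ m %% m)%:Z%R (i %/ 2 %% m)%:Z%R else false)
     (n * m * m * 2).
  exists w; split.
    rewrite size_mkseq size_graph_enc; apply: leq_trans (Hk _); rewrite /m.
    by rewrite leq_mul2r leq_mul // ?leq_mul // ?leq_add2r ?leq_mul2l ?Hn ?orbT.
  apply/verify_pair; exists n; first by rewrite size_graph_enc.
  rewrite -/m; have m0 : 0 < m by rewrite /m addn1.
  have Eadj : (fun i j : 'I_n => nth false (graph_enc adj) (i * n + j)) = adj.
    by do 2 (apply: functional_extensionality => ?); rewrite nth_graph_enc.
  apply: (check_complete m0 (τ := τ)); rewrite ?Eadj //.
  - exact: compress_rep.
  - by move=> v h; rewrite /τ /cshape /=; split; exact: rk_lt_bound.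
  move=> v h c z hc hz hh; rewrite onthE.
  set i := (_ * 2 + h); have hv := ltn_ord v.
  have e2 : i %/ 2 = (v * m + c) * m + z by rewrite /i; lia.
  have e1 : i %% 2 = h by rewrite /i; lia.
  have lt : i < n * m * m * 2.
    have : v * m + c < n * m by nia.
    by rewrite /i; nia.
  rewrite (nth_map false) ?size_mkseq // nth_mkseq // e1 e2.
  rewrite !divnMDl // (divn_small hz) addn0 divnMDl // (divn_small hc) addn0 !modnMDl !modn_small
    //.
  by rewrite valK; case: (ins _ _ _ _).
have m0 : 0 < 3 * n + 1 by rewrite addn1.
have [H1 H2] := check_sound m0 Hc; rewrite -shape_repP in H2.
exists n, (fun i j : 'I_n => nth false x (i * n + j)); split=> //; split=> //.
rewrite (graph_enc_mkseq n (fun i j => nth false x (i * n + j))).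
apply: (@eq_from_nth _ false); first by rewrite size_mkseq.
by move=> i lt; rewrite nth_mkseq ?En // -divn_eq.
Qed.

Theorem theorem4p1 : NP_complete Helly_B1_EPG_recognition.
Proof. exact: conj Helly_B1_EPG_in_NP Helly_B1_EPG_hard. Qed.
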